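(* Assume (P1), (P2), (P3), (P4) (stated in the context) and let $(Y,\wp)\in\mathfrak{S}$. Let $\hat\nu:=\inf\{t\in[0,T]:Z_t=\widehat{Y}_t\}$. Then $\hat\nu\in\mathcal{T}$ and there exists $\widehat{\mathbb{P}}\in\mathcal{P}$ such that $$Z_0=\overline{\mathscr{E}}_0[Z_{\hat\nu}]=\mathbb{E}_{\widehat{\mathbb{P}}}[Z_{\hat\nu}]=\mathbb{E}_{\widehat{\mathbb{P}}}[\widehat{Y}_{\hat\nu}].$$ In other words, $(\widehat{\mathbb{P}},\hat\nu)$ solves $\sup_{(\mathbb{P},\gamma)\in\mathcal{P}\times\mathcal{T}}\mathbb{E}_{\mathbb{P}}[\widehat{Y}_\gamma]=\mathbb{E}_{\widehat{\mathbb{P}}}[\widehat{Y}_{\hat\nu}]$. Moreover, for every $\zeta\in\mathcal{T}$, $$Z_0=\overline{\mathscr{E}}_0[Z_{\hat\nu\wedge\zeta}]=\mathbb{E}_{\widehat{\mathbb{P}}}[Z_{\hat\nu\wedge\zeta}].$$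
   Context: **Canonical space.** Fix $d\in\mathbb{N}$, $T\in(0,\infty)$. For $t\in[0,T]$ let $\Omega^t=\{\omega\in C([t,T];\mathbb{R}^d):\omega(t)=0\}$ with $\|\omega\|_{t,s}=\sup_{r\in[t,s]}|\omega(r)|$ and topology of the uniform norm $\|\cdot\|_{t,T}$; $B^t$ is the canonical process on $\Omega^t$, $\mathcal{F}^t_s=\sigma(B^t_r:r\in[t,s])$, $\mathbf{F}^t=\{\mathcal{F}^t_s\}_{s\in[t,T]}$ (raw natural filtration), $\mathcal{T}^t$ is the set of $[t,T]$-valued $\mathbf{F}^t$-stopping times, $\mathfrak{P}_t$ the set of all probabilities on $(\Omega^t,\mathcal{F}^t_T)$. The index $t$ is dropped when $t=0$. For $s\in[t,T]$, $\delta>0$, $\omega\in\Omega^t$: $O^s_\delta(\omega)=\{\omega'\in\Omega^t:\|\omega'-\omega\|_{t,s}<\delta\}$. $\Pi^t_s:\Omega^t\to\Omega^s$ is $(\Pi^t_s(\omega))(r)=\omega(r)-\omega(s)$, and $\gamma(\Pi^t_s)=\gamma\circ\Pi^t_s$. **Shifts.** For $\omega\in\Omega^t,\tilde\omega\in\Omega^s$: $(\omega\otimes_s\tilde\omega)(r)=\omega(r)$ for $r\in[t,s)$ and $=\omega(s)+\tilde\omega(r)$ for $r\in[s,T]$. For a random variable $\xi$ on $\Omega^t$, $\xi^{s,\omega}(\tilde\omega)=\xi(\omega\otimes_s\tilde\omega)$; for a process $X$, $X^{s,\omega}_r=(X_r)^{s,\omega}$, so $X^{s,\omega}_\gamma(\tilde\omega)=X(\gamma(\tilde\omega),\omega\otimes_s\tilde\omega)$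 for $\gamma\in\mathcal{T}^s$. For $\mathbb{P}\in\mathfrak{P}_t$, let $\{\mathbb{P}^\omega_s\}_{\omega\in\Omega^t}$ be the regular conditional probability distribution of $\mathbb{P}$ given $\mathcal{F}^t_s$ with $\mathbb{P}^\omega_s(\omega\otimes_s\Omega^s)=1$ for all $\omega$; set $\mathbb{P}^{s,\omega}(A)=\mathbb{P}^\omega_s(\omega\otimes_sA)$, $A\in\mathcal{F}^s_T$. **Moduli.** A modulus of continuity function is a nondecreasing $\rho:[0,\infty)\to[0,\infty)$ with $\lim_{x\downarrow0}\rho(x)=0$. $\mathfrak{M}$ is the set of those for which there are $C>0$, $0<p_1\le p_2$ with $\rho(x)\le C(x^{p_1}\vee x^{p_2})$ for all $x\ge0$. A process $X$ is uniformly continuous on $[0,T]\times\Omega$ w.r.t. $\rho$ if $|X_{t_1}(\omega_1)-X_{t_2}(\omega_2)|\le\rho\big(|t_1-t_2|+\|\omega_1(\cdot\wedge t_1)-\omega_2(\cdot\wedge t_2)\|_{0,T}\big)$ for all $(t_i,\omega_i)$. A process is bounded by $C$ if $|X_t(\omega)|\le C$ for all $(t,\omega)$. **The set $\mathfrak{S}$.** All pairs $(Y,\wp)$ where $Y$ is a real-valued process bounded by some $M_Y>0$ and uniformly continuous on $[0,T]\times\Omega$ w.r.t. some $\rho_Y\in\mathfrak{M}$, and $\wp\in\mathcal{T}$ satisfies $|\wp(\omega)-\wp(\omega')|\le\kappa_\wp\|\omega-\omega'\|_{0,T}$ for some $\kappa_\wp>0$. Put $\widehat{Y}_t=Y_{\wp\wedge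 t}$. **Probability class.** $\mathcal{P}_t\subset\mathfrak{P}_t$, $t\in[0,T]$, are nonempty sets, $\mathcal{P}=\mathcal{P}_0$. (P1) $\mathcal{P}$ is weakly compact (topology of weak convergence). (P2) For any $\rho\in\mathfrak{M}$ there is $\hat\rho\in\mathfrak{M}$ such that for all $t\in[0,T)$, $\delta\in(0,\infty)$: $\sup_{(\mathbb{P},\zeta)\in\mathcal{P}_t\times\mathcal{T}^t}\mathbb{E}_{\mathbb{P}}\big[\rho\big(\delta+\sup_{r\in[\zeta,(\zeta+\delta)\wedge T]}|B^t_r-B^t_\zeta|\big)\big]\le\hat\rho(\delta)$. In particular, for one given $\rho_0\in\mathfrak{M}$ (fixed in the paper; it plays no other role in this statement) $\hat\rho_0$ is required to satisfy $\hat\rho_0(x)\le\hat{\mathfrak{C}}(x^{\hat{\mathfrak{p}}_1}\vee x^{\hat{\mathfrak{p}}_2})$ for some $\hat{\mathfrak{C}}>0$, $1<\hat{\mathfrak{p}}_1\le\hat{\mathfrak{p}}_2$. (P3) For any $0\le t<s\le T$ and $\mathbb{P}\in\mathcal{P}_t$ there are an extension $(\Omega^t,\mathcal{F}',\mathbb{P}')$ of $(\Omega^t,\mathcal{F}^t_T,\mathbb{P})$ (i.e. $\mathcal{F}^t_T\subset\mathcal{F}'$, $\mathbb{P}'|_{\mathcal{F}^t_T}=\mathbb{P}$) and $\Omega'\in\mathcal{F}'$ with $\mathbb{P}'(\Omega')=1$ such that $\mathbb{P}^{s,\tilde\omega}\in\mathcal{P}_s$ for all $\tilde\omega\in\Omega'$.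 (P4) For any $(Y,\wp)\in\mathfrak{S}$ there is a modulus of continuity function $\bar\rho_Y$ such that for any $0\le t<s\le T$, $\omega\in\Omega$, $\mathbb{P}\in\mathcal{P}_t$: given a positive rational $\delta$, $\lambda\in\mathbb{N}$, and an $\mathcal{F}^t_s$-partition $\{\mathcal{A}_j\}_{j=0}^\lambda$ of $\Omega^t$ with, for $j=1,\dots,\lambda$, $\mathcal{A}_j\subset O^s_{\delta_j}(\tilde\omega_j)$ for some $\delta_j\in((0,\delta]\cap\mathbb{Q})\cup\{\delta\}$ and $\tilde\omega_j\in\Omega^t$, then for any $\{\mathbb{P}_j\}_{j=1}^\lambda\subset\mathcal{P}_s$ there is $\widehat{\mathbb{P}}\in\mathcal{P}_t$ with (i) $\widehat{\mathbb{P}}(A\cap\mathcal{A}_0)=\mathbb{P}(A\cap\mathcal{A}_0)$ for all $A\in\mathcal{F}^t_T$; (ii) for $j=1,\dots,\lambda$ and $A\in\mathcal{F}^t_s$, $\widehat{\mathbb{P}}(A\cap\mathcal{A}_j)=\mathbb{P}(A\cap\mathcal{A}_j)$ and $\mathbb{E}_{\widehat{\mathbb{P}}}\big[\mathbf{1}_{A\cap\mathcal{A}_j}\widehat{Y}^{t,\omega}_{\gamma(\Pi^t_s)}\big]\ge\mathbb{E}_{\mathbb{P}}\big[\mathbf{1}_{\{\tilde\omega\in A\cap\mathcal{A}_j\}}\big(\mathbb{E}_{\mathbb{P}_j}[\widehat{Y}^{s,\omega\otimes_t\tilde\omega}_\gamma]-\bar\rho_Y(\delta)\big)\big]$ for all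 $\gamma\in\mathcal{T}^s$. **Snell envelope and nonlinear expectation.** $Z_t(\omega)=\sup_{(\mathbb{P},\gamma)\in\mathcal{P}_t\times\mathcal{T}^t}\mathbb{E}_{\mathbb{P}}[\widehat{Y}^{t,\omega}_\gamma]$, $(t,\omega)\in[0,T]\times\Omega$ ($Z_0$ is a constant). For bounded $\mathcal{F}_T$-measurable $\xi$, $\overline{\mathscr{E}}_t[\xi](\omega)=\sup_{\mathbb{P}\in\mathcal{P}_t}\mathbb{E}_{\mathbb{P}}[\xi^{t,\omega}]$; in particular $\overline{\mathscr{E}}_0[\xi]=\sup_{\mathbb{P}\in\mathcal{P}}\mathbb{E}_{\mathbb{P}}[\xi]$. *)

(* Defs.v *)
From HB Require Import structures.
From mathcomp Require Import all_boot all_order all_algebra.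
From mathcomp Require Import all_classical all_reals all_analysis.

Set Implicit Arguments.
Unset Strict Implicit.
Unset Printing Implicit Defensive.

Import Order.TTheory GRing.Theory Num.Theory.
Import numFieldNormedType.Exports.

Local Open Scope classical_set_scope.
Local Open Scope ring_scope.

(* The library norm of 'rV[R]_d is the max norm, hence a separate Euclidean one. *)
Definition enorm (R : realType) (d : nat) (x : 'rV[R]_d) : R :=
  Num.sqrt (\sum_(i < d) x ord0 i ^+ 2).

Definition supnorm (R : realType) (d : nat) (a b : R) (f : R -> 'rV[R]_d) : R :=
  sup [set enorm (f r) | r in `[a, b]].

Section norms.
Context (R : realType) (d : nat).
Implicit Types (x y : 'rV[R]_d) (f g : R -> 'rV[R]_d).

Let sqn x : R := \sum_(i < d) x ord0 i ^+ 2.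
Let dot x y : R := \sum_(i < d) x ord0 i * y ord0 i.

Let sqn_ge0 x : 0 <= sqn x.
Proof. by apply: sumr_ge0 => i _; exact: sqr_ge0. Qed.

Lemma enorm_ge0 x : 0 <= enorm x. Proof. exact: sqrtr_ge0. Qed.

Lemma enorm_eq0 x : enorm x = 0 -> x = 0.
Proof.
move/eqP; rewrite sqrtr_eq0 => sx0; apply/rowP => i; rewrite mxE.
have /eqP : sqn x = 0 by apply/eqP; rewrite eq_le sx0 sqn_ge0.
rewrite psumr_eq0; last by move=> j _; exact: sqr_ge0.
by move=> /allP/(_ i (mem_index_enum _)) /=; rewrite sqrf_eq0 => /eqP.
Qed.

Lemma enorm0 : enorm (0 : 'rV[R]_d) = 0.
Proof.
by rewrite /enorm big1 ?sqrtr0// => i _; rewrite mxE expr0n.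
Qed.

Lemma enormN x : enorm (- x) = enorm x.
Proof.
by congr Num.sqrt; apply: eq_bigr => i _; rewrite mxE sqrrN.
Qed.

Let dot_sqn x y : dot x y ^+ 2 <= sqn x * sqn y.
Proof.
have [y0|y0] := eqVneq (sqn y) 0.
  have -> : dot x y = 0; last by rewrite expr0n y0 mulr0.
  have -> : y = 0 by apply: enorm_eq0; rewrite /enorm -/(sqn y) y0 sqrtr0.
  by rewrite /dot big1// => i _; rewrite mxE mulr0.
have yp : 0 < sqn y by rewrite lt_neqAle eq_sym y0 sqn_ge0.
rewrite -subr_ge0 -(pmulr_rge0 _ yp).
have -> : sqn y * (sqn x * sqn y - dot x y ^+ 2)
    = \sum_(i < d) (sqn y * x ord0 i - dot x y * y ord0 i) ^+ 2.
  transitivity (\sum_(i < d) (sqn y ^+ 2 * x ord0 i ^+ 2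
     - (sqn y * dot x y *+ 2) * (x ord0 i * y ord0 i)
     + dot x y ^+ 2 * y ord0 i ^+ 2)); last first.
    apply: eq_bigr => i _; rewrite sqrrB !exprMn; congr (_ - _ + _).
    by rewrite mulrnAl mulrACA.
  rewrite big_split/= sumrB -!mulr_sumr -/(sqn x) -/(sqn y) -/(dot x y).
  rewrite mulrBr mulrA (mulrC (sqn y) (sqn x)) -mulrA -expr2 (mulrC (sqn x)).
  rewrite mulrnAl -mulrA -expr2 (mulrC (dot x y ^+ 2)) mulr2n opprD addrA.
  by rewrite addrNK.
by apply: sumr_ge0 => i _; exact: sqr_ge0.
Qed.

Lemma enormD x y : enorm (x + y) <= enorm x + enorm y.
Proof.
rewrite -(@ler_pXn2r _ 2)// ?nnegrE ?enorm_ge0 ?addr_ge0 ?enorm_ge0//.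
rewrite sqrrD !sqr_sqrtr ?sqn_ge0//.
have -> : \sum_(i < d) (x + y) ord0 i ^+ 2 = sqn x + dot x y *+ 2 + sqn y.
  rewrite /sqn /dot -sumrMnl -!big_split/=.
  by apply: eq_bigr => i _; rewrite mxE sqrrD.
rewrite lerD2r lerD2l lerMn2r/= -sqrtrM ?sqn_ge0//.
rewrite (le_trans (ler_norm _))// -sqrtr_sqr.
by apply: ler_wsqrtr; exact: dot_sqn.
Qed.

Lemma enorm_continuous f : continuous f -> continuous (fun r => enorm (f r)).
Proof.
move=> cf r; apply: (@continuous_comp _ _ _ _ Num.sqrt);
  last exact: sqrt_continuous.
suff H (l : seq 'I_d) : \sum_(i <- l) f s ord0 i ^+ 2 @[s --> r] -->
  \sum_(i <- l) f r ord0 i ^+ 2 by exact: H.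
elim: l => [|i l IH].
  by under eq_fun do rewrite big_nil; rewrite big_nil; exact: cvg_cst.
under eq_fun do rewrite big_cons expr2.
rewrite big_cons expr2.
apply: cvgD; last exact: IH.
apply: cvgM;
  by apply: (@continuous_comp _ _ _ f (fun M : 'rV[R]_d => M ord0 i));
    [exact: cf|exact: coord_continuous].
Qed.

Lemma supnorm_has_sup a b f : a <= b -> continuous f ->
  has_sup [set enorm (f r) | r in `[a, b]].
Proof.
move=> ab cf; split.
  by exists (enorm (f a)), a => //=; rewrite in_itv/= lexx.
have [|c _ cmax] := @EVT_max R (fun r => enorm (f r)) a b ab.
  by apply: continuous_subspaceT; exact: enorm_continuous.
by exists (enorm (f c)) => _ [r /= rab <-]; exact: cmax.
Qed.

Lemma supnorm_ub a b f r : a <= b -> continuous f -> r \in `[a, b] ->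
  enorm (f r) <= supnorm a b f.
Proof.
move=> ab cf rab.
by apply: sup_upper_bound; [exact: supnorm_has_sup|exists r].
Qed.

Lemma supnorm_le a b f M : 0 <= M ->
  (forall r, r \in `[a, b] -> enorm (f r) <= M) -> supnorm a b f <= M.
Proof.
move=> M0 fM; have [ab|ab] := leP a b.
  apply: ge_sup; first by exists (enorm (f a)), a => //=; rewrite in_itv/= lexx.
  by move=> _ [r /= rab <-]; exact: fM.
rewrite /supnorm set_itv_ge ?bnd_simp -?ltNge// image_set0 sup0//.
Qed.

Lemma supnorm_ge0 a b f : 0 <= supnorm a b f.
Proof.
rewrite /supnorm; set E := [set _ | _ in _].
have [[[x Ex] ubE]|/sup_out->//] := pselect (has_sup E).
have x0 : 0 <= x by case: Ex => r _ <-; exact: enorm_ge0.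
by rewrite (le_trans x0)//; apply: sup_upper_bound => //; split=> //; exists x.
Qed.

End norms.

(* C_0([t, T]; R^d), each path being extended to the real line by the constant
   values 0 on the left of t and w(T) on the right of T. This makes Leibniz
   equality of paths the same as equality on [t, T]. *)
Definition is_path (R : realType) (d : nat) (T t : R) : set (R -> 'rV[R]_d) :=
  [set w : R -> 'rV[R]_d | [/\ continuous w, forall r, r <= t -> w r = 0
             & forall r, T <= r -> w r = w T]].

Record Omega (R : realType) (d : nat) (T t : R) : Type := Path {
  path_fun :> R -> 'rV[R]_d ;
  path_funP : path_fun \in is_path T t }.

HB.instance Definition _ (R : realType) (d : nat) (T t : R) :=
  [isSub for @path_fun R d T t].
HB.instance Definition _ (R : realType) (d : nat) (T t : R) :=
  [Choice of Omega d T t by <:].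

Lemma is_path0 (R : realType) (d : nat) (T t : R) :
  (fun=> 0) \in @is_path R d T t.
Proof. by apply/mem_set; split=> // r; exact: cvg_cst. Qed.

HB.instance Definition _ (R : realType) (d : nat) (T t : R) :=
  isPointed.Build (Omega d T t) (Path (is_path0 d T t)).

Section path_metric.
Context (R : realType) (d : nat) (T t : R).
Implicit Types w : Omega d T t.

Lemma path_continuous w : continuous w.
Proof. by have /set_mem[] := path_funP w. Qed.

Lemma path_eq0 w r : r <= t -> w r = 0.
Proof. by have /set_mem[_ + _] := path_funP w => /[apply]. Qed.

Lemma path_eqT w r : T <= r -> w r = w T.
Proof. by have /set_mem[_ _] := path_funP w => /[apply]. Qed.

Lemma path_subC w1 w2 : continuous (w1 \- w2).
Proof. by move=> r; apply: cvgB; exact: path_continuous. Qed.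

Let pdist w1 w2 : R := supnorm t T (w1 \- w2).

Let pdistxx w : pdist w w = 0.
Proof.
apply/eqP; rewrite eq_le supnorm_ge0 andbT; apply: supnorm_le => // r _ /=.
by rewrite subrr enorm0.
Qed.

Let pdist_positivity w1 w2 : pdist w1 w2 = 0 -> w1 = w2.
Proof.
move=> w120; apply/val_inj/funext => r /=.
have [rt|tr] := leP r t; first by rewrite !path_eq0.
wlog rT : r tr / r <= T.
  move=> H; have [/H->//|/ltW Tr] := leP r T.
  rewrite (path_eqT w1 Tr) (path_eqT w2 Tr).
  by have [Tt|/H->//] := leP T t; rewrite !path_eq0.
apply/eqP; rewrite -subr_eq0; apply/eqP/enorm_eq0/eqP.
rewrite eq_le enorm_ge0 andbT -w120.
apply: (@supnorm_ub _ _ _ _ (w1 \- w2)); last by rewrite in_itv/= (ltW tr).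
  by rewrite (le_trans (ltW tr)).
exact: path_subC.
Qed.

Let pdist_sym w1 w2 : pdist w1 w2 = pdist w2 w1.
Proof.
by congr sup; apply: eq_imagel => r _ /=; rewrite -enormN opprB.
Qed.

Let pdist_triangle w2 w1 w3 : pdist w1 w3 <= pdist w1 w2 + pdist w2 w3.
Proof.
have [tT|Tt] := leP t T; last first.
  rewrite /pdist /supnorm set_itv_ge ?bnd_simp -?ltNge// !image_set0 sup0.
  by rewrite addr0.
apply: supnorm_le => [|r rtT]; first by rewrite addr_ge0// supnorm_ge0.
have -> : (w1 \- w3) r = (w1 \- w2) r + (w2 \- w3) r by rewrite /= addrA subrK.
rewrite (le_trans (enormD _ _))// lerD// supnorm_ub//; exact: path_subC.
Qed.

HB.instance Definition _ := @isMetric.Build R (Omega d T t)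
  pdist pdistxx pdist_positivity pdist_sym pdist_triangle.

Lemma mdist_pathE w1 w2 : mdist w1 w2 = supnorm t T (w1 \- w2).
Proof. by []. Qed.

End path_metric.

Section filtration.
Context (R : realType) (d : nat) (T t : R).

Definition cylinders (s : R) : set_system (Omega d T t) :=
  [set A | exists r (U : set 'rV[R]_d), [/\ t <= r <= s, <<s open >> U &
     A = [set w : Omega d T t | U (w r)]]].

Definition filtration (s : R) : set_system (Omega d T t) := <<s cylinders s >>.

HB.instance Definition _ :=
  Measurable.copy (Omega d T t) (g_sigma_algebraType (cylinders T)).

Lemma measurable_filtrationT : measurable = filtration T.
Proof. by []. Qed.

Definition stopping : set (Omega d T t -> R) :=
  [set g | (forall w, t <= g w <= T) /\
     forall s, t <= s <= T -> filtration s [set w | g w <= s]].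

End filtration.

Section path_operations.
Context (R : realType) (d : nat) (T : R).

(* The default value is only reached when t <= s <= T fails, see concatE. *)
Definition concat (t s : R) (w : Omega d T t) (w' : Omega d T s) :
    Omega d T t :=
  insubd (point : Omega d T t) (fun r => if r < s then w r else w s + w' r).

Lemma concatE t s (w : Omega d T t) (w' : Omega d T s) : t <= s <= T ->
  concat w w' = (fun r => if r < s then w r else w s + w' r) :> (R -> 'rV[R]_d).
Proof.
move=> /andP[ts sT]; rewrite /concat insubdK//; apply/mem_set.
have -> : (fun r => if r < s then w r else w s + w' r)
    = (fun r => w (Num.min r s) + w' r).
  apply/funext => r; case: ltP => // rs.
  by rewrite (path_eq0 w' (ltW rs)) addr0.
split=> [r|r rt|r Tr].
- apply: cvgD; last exact: path_continuous.
  apply: (@continuous_comp _ _ _ (fun r => Num.min r s) w).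
    by apply: continuous_min; [exact: cvg_id|exact: cvg_cst].
  exact: path_continuous.
- by rewrite (path_eq0 w') ?(le_trans rt)// path_eq0 ?addr0// ge_min rt.
- by rewrite (path_eqT w' Tr) !min_r// (le_trans sT).
Qed.

Definition tail_fun (t s : R) (w : Omega d T t) (r : R) : 'rV[R]_d :=
  if r < s then 0 else w r - w s.

Lemma is_path_tail t s (w : Omega d T t) : tail_fun s w \in is_path T s.
Proof.
have -> : tail_fun s w = (fun r => w (Num.max r s) - w s).
  by apply/funext => r; rewrite /tail_fun; case: ltP => // _; rewrite subrr.
apply/mem_set; split=> [r|r rs|r Tr].
- apply: cvgB; last exact: cvg_cst.
  apply: (@continuous_comp _ _ _ (fun r => Num.max r s) w).
    by apply: continuous_max; [exact: cvg_id|exact: cvg_cst].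
  exact: path_continuous.
- by rewrite max_r// subrr.
- congr (_ - _); rewrite path_eqT ?le_max ?Tr//.
  by rewrite [RHS]path_eqT// le_max lexx.
Qed.

Definition tail_path (t s : R) (w : Omega d T t) : Omega d T s :=
  Path (is_path_tail s w).

Definition shift_rv (V : Type) (t s : R) (xi : Omega d T t -> V)
    (w : Omega d T t) : Omega d T s -> V := fun w' => xi (concat w w').

Definition shift_process (V : Type) (t s : R) (X : R -> Omega d T t -> V)
    (w : Omega d T t) : R -> Omega d T s -> V := fun r => shift_rv (X r) w.

Definition sample (V : Type) (t : R) (X : R -> Omega d T t -> V)
  (g : Omega d T t -> R) : Omega d T t -> V := fun w => X (g w) w.

Definition near_path (t s delta : R) (w : Omega d T t) : set (Omega d T t) :=
  [set w' : Omega d T t | supnorm t s (w' \- w) < delta].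

End path_operations.

Section moduli.
Context (R : realType).

Definition modulus (rho : R -> R) : Prop :=
  [/\ forall x, 0 <= x -> 0 <= rho x,
      forall x y, 0 <= x -> x <= y -> rho x <= rho y
    & rho x @[x --> 0^'+] --> 0].

Definition power_bound (C p1 p2 : R) (rho : R -> R) : Prop :=
  forall x, 0 <= x -> rho x <= C * Num.max (x `^ p1) (x `^ p2).

Definition power_modulus (rho : R -> R) : Prop :=
  modulus rho /\
  exists C p1 p2, [/\ 0 < C, 0 < p1, p1 <= p2 & power_bound C p1 p2 rho].

End moduli.

Section processes.
Context (R : realType) (d : nat) (T : R).
Implicit Types (Y : R -> Omega d T 0 -> R) (wp : Omega d T 0 -> R).

Definition uniformly_continuous Y (rho : R -> R) : Prop :=
  forall t1 t2 (w1 w2 : Omega d T 0), 0 <= t1 <= T -> 0 <= t2 <= T ->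
    `|Y t1 w1 - Y t2 w2| <= rho (`|t1 - t2| +
      supnorm 0 T (fun r => w1 (Num.min r t1) - w2 (Num.min r t2))).

(* Measurability of Y needs no separate clause, since
   uniform continuity makes Y_t a continuous function of w(. /\ t). *)
Definition frakS Y wp : Prop :=
  [/\ exists2 M, 0 < M & forall t w, 0 <= t <= T -> `|Y t w| <= M,
      exists2 rho, power_modulus rho & uniformly_continuous Y rho,
      stopping wp
    & exists2 kappa, 0 < kappa &
        forall w w' : Omega d T 0,
          `|wp w - wp w'| <= kappa * supnorm 0 T (w \- w')].

Definition Yhat Y wp : R -> Omega d T 0 -> R :=
  fun t w => Y (Num.min (wp w) t) w.

End processes.

Section weak_convergence.
Context (R : realType) (d : nat) (T t : R).

Definition bounded_continuous : Type :=
  {f : Omega d T t -> R |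
    continuous f /\ exists M : R, forall w, `|f w| <= M}.

Definition weak_eval (P : probability (Omega d T t) R) :
  {ptws bounded_continuous -> R} := fun f => \int[P]_w sval f w.

(* Compactness in the topology of weak convergence, i.e. the coarsest topology
   for which all the maps P |-> E_P[f], f bounded continuous, are continuous. *)
Definition weakly_compact (S : set (probability (Omega d T t) R)) : Prop :=
  @compact (initial_topology weak_eval) S.

End weak_convergence.

(* kappa is a regular conditional probability distribution of P given F^t_s
   such that kappa(w) is carried by the paths that coincide with w on [t, s].
   It is F^t_s-measurable in w because it is a kernel from (Omega^t, F^t_s). *)
Definition is_rcpd (R : realType) (d : nat) (T t s : R)
    (P : probability (Omega d T t) R)
    (kappa : R.-pker (g_sigma_algebraType (@cylinders R d T t s))
               ~> (Omega d T t)) : Prop :=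
  (forall A B : set (Omega d T t), measurable A -> filtration s B ->
     (\int[P]_(w in B) kappa w A = P (A `&` B))%E) /\
  (forall w : Omega d T t, kappa w (concat w @` [set: Omega d T s]) = 1%E).

Arguments is_rcpd {R d T t} s P kappa.

Section conditions.
Context (R : realType) (d : nat) (T : R).
Context (PP : forall t : R, set (probability (Omega d T t) R)).
Local Open Scope ereal_scope.

Definition condP1 : Prop := weakly_compact (@PP 0%R).

Definition osc_bound (rho rhohat : R -> R) : Prop :=
  forall t delta, (0 <= t < T)%R -> (0 < delta)%R ->
    ereal_sup [set 'E_P[fun w => rho (delta + supnorm (zeta w)
                   (Num.min (zeta w + delta) T) (fun r => w r - w (zeta w)))%R]
              | P in @PP t & zeta in @stopping R d T t] <= (rhohat delta)%:E.

Definition condP2 (rho0 : R -> R) : Prop :=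
  (forall rho, power_modulus rho ->
     exists2 rhohat, power_modulus rhohat & osc_bound rho rhohat) /\
  exists rhohat0, [/\ power_modulus rhohat0, osc_bound rho0 rhohat0 &
    exists C p1 p2, [/\ 0 < C, 1 < p1, p1 <= p2 &
      power_bound C p1 p2 rhohat0]%R].

(* Measures of the library are functions on all subsets, so P^{s,w} \in P_s is
   stated as: some element of P_s coincides with P^{s,w} on F^s_T. *)
Definition condP3 : Prop :=
  forall t s (P : probability (Omega d T t) R),
    (0 <= t)%R -> (t < s)%R -> (s <= T)%R -> @PP t P ->
    exists2 kappa, is_rcpd s P kappa &
    exists (F' : set_system (Omega d T t))
           (P' : probability (g_sigma_algebraType F') R)
           (Omega' : set (Omega d T t)),
      [/\ sigma_algebra setT F',
          filtration T `<=` F' /\ (forall A, filtration T A -> P' A = P A),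
          F' Omega', P' Omega' = 1 &
          forall w, Omega' w -> exists2 Q, @PP s Q &
            forall A : set (Omega d T s), measurable A ->
              Q A = kappa w (concat w @` A)].

Definition condP4 : Prop :=
  forall Y wp, frakS Y wp -> exists2 rhobar, modulus rhobar &
  forall t s (w : Omega d T 0) (P : probability (Omega d T t) R),
    (0 <= t)%R -> (t < s)%R -> (s <= T)%R -> @PP t P ->
  forall (delta : rat) (lambda : nat) (A : nat -> set (Omega d T t)),
    (0 < delta)%R -> (0 < lambda)%N ->
    (forall j, (j <= lambda)%N -> filtration s (A j)) ->
    trivIset `I_lambda.+1 A -> \bigcup_(j < lambda.+1) A j = setT ->
    (forall j, (0 < j <= lambda)%N ->
       exists (deltaj : R) (wj : Omega d T t),
         ((0 < deltaj <= ratr delta)%R /\ (exists q : rat, deltaj = ratr q)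
          \/ deltaj = ratr delta) /\ A j `<=` near_path s deltaj wj) ->
  forall Q : nat -> probability (Omega d T s) R,
    (forall j, (0 < j <= lambda)%N -> @PP s (Q j)) ->
  exists2 Phat, @PP t Phat &
    (forall B, filtration T B -> Phat (B `&` A 0%N) = P (B `&` A 0%N)) /\
    forall j, (0 < j <= lambda)%N -> forall B, filtration s B ->
      Phat (B `&` A j) = P (B `&` A j) /\
      forall gamma, @stopping R d T s gamma ->
        \int[Phat]_(w' in B `&` A j)
           (sample (shift_process (Yhat Y wp) w) (gamma \o tail_path s) w')%:E
        >= \int[P]_(w' in B `&` A j)
             ('E_(Q j)[sample (shift_process (Yhat Y wp) (concat w w')) gamma]
              - (rhobar (ratr delta))%:E).

End conditions.

Section value.
Context (R : realType) (d : nat) (T : R).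
Context (PP : forall t : R, set (probability (Omega d T t) R)).
Local Open Scope ereal_scope.

Definition snell (Y : R -> Omega d T 0 -> R) (wp : Omega d T 0 -> R) :
    R -> Omega d T 0 -> \bar R :=
  fun t w => ereal_sup [set 'E_P[sample (shift_process (Yhat Y wp) w) gamma]
                       | P in @PP t & gamma in @stopping R d T t].

Definition upper_expectation (t : R) (xi : Omega d T 0 -> \bar R) :
    Omega d T 0 -> \bar R :=
  fun w => ereal_sup [set \int[P]_w' shift_rv xi w w' | P in @PP t].

Definition nuhat (Y : R -> Omega d T 0 -> R) (wp : Omega d T 0 -> R) :
    Omega d T 0 -> R :=
  fun w => inf [set t | (0 <= t <= T)%R /\ snell Y wp t w = (Yhat Y wp t w)%:E].

End value.

(* Main.v *)
(** The Snell envelope Z dominates every reward (disintegration, P3), is a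
    supermartingale under every P in the class (pasting, P4) and is continuous in
    time and space (P2); hence the contact time nuhat is a stopping time at which
    Z equals the reward. It remains to find P with E_P[Z_nuhat] >= Z_0. Let P_n,
    gamma_n be 1/n-optimal and let P be a weak cluster point of (P_n). The first
    passage of Z - Yhat below a level is not a continuous function of the path, so
    on a finite time grid one uses the continuous functional
      Z_0 + sum_i phi_i (Z_{t_{i+1}} - Z_{t_i}),
      phi_i = prod_{j <= i} clip (((Z - Yhat)_{t_j} - delta) / delta).
    The weights phi_i lie between the indicators that Z - Yhat has stayed above
    2 delta, respectively delta, and by the supermartingale property expectations
    decrease as the weights grow. Near-optimality of gamma_n makes the P_n-mean of
    Z at the passage below delta almost Z_0, which bounds the functional from below
    under P_n, then under P, and therefore also Z at the passage below 2 delta under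
    P. Refining the grid and letting delta tend to 0 gives the claim. *)

Require Import Defs.
From HB Require Import structures.
From mathcomp Require Import all_boot all_order all_algebra.
From mathcomp Require Import all_classical all_reals all_analysis.
From mathcomp Require Import measurable_realfun.
From mathcomp Require Import ring lra.

Set Implicit Arguments.
Unset Strict Implicit.
Unset Printing Implicit Defensive.

Import Order.TTheory GRing.Theory Num.Theory.
Import numFieldNormedType.Exports.

Local Open Scope classical_set_scope.
Local Open Scope ring_scope.

(** Weak compactness controls the expectation of one continuous functional at a time, and only along
    a cluster point. This dictates the order of choices: the mesh and the tolerance of the lower
    bound depend on [del] and [e] alone, uniformly over laws and controls, because (P2) bounds
    oscillations uniformly over the class. The grid can therefore be fixed before an approximating
    law is picked for it. The class need not have a dominating measure, so regularity of Z is proved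
    path by path. Z is a supremum over an uncountable family; its measurability comes from
    continuity in the path, each uniformly open set being a countable union of tubes. Adapted
    weights with values in [0, 1] put passage flags, caps at a stopping time and continuous ramps on
    the same footing: one monotonicity statement covers every comparison between them, including
    optional sampling. *)

Lemma dist_min_max (R : realType) (u1 u2 r : R) :
  Num.min u1 u2 <= r <= Num.max u1 u2 -> `|r - Num.min u1 u2| <= `|u1 - u2|.
Proof.
move=> /andP[r1 r2]; rewrite ger0_norm ?subr_ge0//.
rewrite (le_trans (lerB r2 (lexx _)))//.
by case: (leP u1 u2) => h; [rewrite distrC ger0_norm ?subr_ge0|rewrite gtr0_norm ?subr_gt0].
Qed.

Lemma min_dist_le (R : realType) (a b c e x y : R) :
  `|a - b| <= x -> `|c - e| <= y -> 0 <= x -> 0 <= y ->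
  `|Num.min a c - Num.min b e| <= x + y.
Proof.
rewrite !ler_norml => /andP[? ?] /andP[? ?] ? ?.
by case: (leP a c) => ?; case: (leP b e) => ?; apply/andP; split; lra.
Qed.

Lemma min_dist_lt (R : realType) (x y c e : R) : 0 < e -> y < x + e -> x < y + e ->
  `|Num.min y c - Num.min x c| < e.
Proof.
move=> ? ? ?; rewrite ltr_norml.
by case: (leP y c) => ?; case: (leP x c) => ?; apply/andP; split; lra.
Qed.

(** * Euclidean norm against the max norm *)

Section enorm_theory.
Context (R : realType) (d : nat).
Implicit Types (x y : 'rV[R]_d).

Lemma norm_le_enorm x : `|x| <= enorm x.
Proof.
rewrite [leLHS]/Num.norm /= mx_normrE; apply/bigmax_leP; split=> [|[i j] _].
  exact: enorm_ge0.
rewrite /enorm /= -sqrtr_sqr; apply: ler_wsqrtr.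
rewrite (bigD1 j)//= [i]ord1 lerDl.
by apply: sumr_ge0 => k _; exact: sqr_ge0.
Qed.

Lemma enorm_le_norm x : enorm x <= d%:R * `|x|.
Proof.
have n0 : 0 <= d%:R * `|x| by rewrite mulr_ge0.
rewrite -[leRHS]ger0_norm// -sqrtr_sqr /enorm; apply: ler_wsqrtr.
apply: (@le_trans _ _ (\sum_(i < d) `|x| ^+ 2)).
  apply: ler_sum => i _; rewrite -real_normK ?num_real// ler_pXn2r ?nnegrE//.
  by rewrite [leRHS]/Num.norm /= mx_normrE; apply/bigmax_geP; right; exists (ord0, i).
rewrite sumr_const card_ord exprMn -[leLHS]mulr_natl.
apply: ler_wpM2r; first exact: sqr_ge0.
by rewrite expr2 -natrM ler_nat; case: (d) => // n; exact: leq_pmulr.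
Qed.

Lemma enormB x y : enorm (x - y) = enorm (y - x).
Proof. by rewrite -enormN opprB. Qed.

Lemma enorm_triangle y x z : enorm (x - z) <= enorm (x - y) + enorm (y - z).
Proof. by rewrite (le_trans _ (enormD _ _))// addrA subrK. Qed.

Lemma continuous_enormP (w : R -> 'rV[R]_d) r e : continuous w -> 0 < e ->
  exists2 h, 0 < h & forall r', `|r - r'| < h -> enorm (w r - w r') < e.
Proof.
move=> cw e0.
have d0 : 0 < e / (d%:R + 1) by rewrite divr_gt0// ltr_wpDl.
have /cvgrPdist_lt /(_ _ d0) := cw r.
case/nbhs_ballP => h /= h0 H; exists h => // r' rr'.
rewrite (le_lt_trans (enorm_le_norm _))//.
have := H r' rr'; rewrite ltr_pdivlMr ?ltr_wpDl// => /(le_lt_trans _); apply.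
by rewrite mulrC ler_wpM2l// lerDl.
Qed.

Lemma open_enorm (U : set 'rV[R]_d) x : open U -> U x ->
  exists2 e, 0 < e & forall y, enorm (y - x) < e -> U y.
Proof.
rewrite openE => /(_ x) /[apply] /nbhs_ballP[e /= e0 H]; exists e => // y yx.
apply: H; rewrite -ball_normE /= distrC.
exact: le_lt_trans (norm_le_enorm _) yx.
Qed.

Lemma closed_enorm_ball x e : closed [set y | enorm (y - x) <= e].
Proof.
rewrite -openC openE => y /= /negP; rewrite -ltNge => xy.
have h0 : 0 < (enorm (y - x) - e) / (d%:R + 1) by rewrite divr_gt0 ?subr_gt0// ltr_wpDl.
apply/nbhs_ballP; exists ((enorm (y - x) - e) / (d%:R + 1)) => //= z.
rewrite -ball_normE /= ltr_pdivlMr; last exact: ltr_wpDl.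
move=> yz; apply/negP.
rewrite -ltNge; have := enorm_triangle z y x; have := enorm_le_norm (y - z).
have : 0 <= `|y - z| by []. nra.
Qed.

End enorm_theory.

(** * Uniform continuity of paths *)

Section paths.
Context (R : realType) (d : nat) (T : R).
Local Notation Om t := (Omega d T t).

(** A path is continuous on the whole line and constant outside a segment, so its uniform continuity
    is global; no order between [t] and [T] enters. *)
Lemma path_unif_continuous t (w : Om t) e : 0 < e ->
  exists2 h, 0 < h &
    forall r r', `|r - r'| <= h -> enorm (w r - w r') <= e.
Proof.
move=> e0; pose a := Num.min t T - 1; pose b := Num.max t T + 1.
have /compact_near_coveringP/near_covering_withinP := @segment_compact R a b.
move=> /(_ R (0 : R)^'+ (fun h r => forall r', `|r - r'| <= h ->
   enorm (w r - w r') <= e)).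
have e20 : 0 < e / 2 by rewrite divr_gt0.
case=> [x xab|].
  have [h h0 H] := continuous_enormP x (@path_continuous _ _ _ _ w) e20.
  near=> x' h' => _ r' xr'; rewrite /= in xr' *.
  have h1 : `|x - x'| < h / 2.
    by near: x'; apply: cvgr_dist_lt => //; rewrite divr_gt0.
  have h2 : h' < h / 2 by near: h'; apply: nbhs_right_lt; rewrite divr_gt0.
  have A1 := ler_distD x' x r'.
  have A2 : enorm (w x - w r') < e / 2 by apply: H; lra.
  have A3 : enorm (w x - w x') < e / 2 by apply: H; lra.
  have := enorm_triangle (w x) (w x') (w r'); rewrite (enormB (w x') (w x)).
  lra.
move=> M /= M0 H0.
(* The padding of [[a, b]] by 1 and the cap [h <= 1 / 2] prevent [r] and [r'] from lying on opposite
   sides of the segment: if both are outside, they are where the path is constant. *)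
pose h := Num.min (M / 2) (1 / 2).
have h0 : 0 < h by rewrite lt_min !divr_gt0.
have hM : h < M by rewrite gt_min; apply/orP; left; lra.
have hb : h <= 1 / 2 by rewrite ge_min lexx orbT.
have {}H0 r : r \in `[a, b] -> forall r', `|r - r'| <= h -> enorm (w r - w r') <= e.
  move=> rab; apply: (H0 h) => //=.
  by rewrite sub0r normrN gtr0_norm.
exists h => // r r' rr'.
wlog rle : r r' rr' / r <= r'.
  move=> H; have [/H->//|/ltW rle] := leP r r'.
  by rewrite enormB H// distrC.
have [rab|] := boolP (r \in `[a, b]); first exact: H0.
have [r'ab _|] := boolP (r' \in `[a, b]).
  by rewrite enormB H0// distrC.
have mT : Num.min t T <= t by rewrite ge_min lexx.
have MT : T <= Num.max t T by rewrite le_max lexx orbT.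
have mM : Num.min t T <= Num.max t T by rewrite ge_min le_max lexx.
move: rr'; rewrite ler_norml => /andP[? ?].
rewrite !in_itv/= /a /b !negb_and -!ltNge => /orP[A|A] /orP[B|B].
- have [r't|r't] := leP r' t.
    by rewrite !path_eq0 ?subrr ?enorm0 ?(ltW e0)//; lra.
  lra.
- by rewrite !(path_eqT w) ?subrr ?enorm0 ?(ltW e0)//; lra.
- by rewrite !path_eq0 ?subrr ?enorm0 ?(ltW e0)//; lra.
- by rewrite !(path_eqT w) ?subrr ?enorm0 ?(ltW e0)//; lra.
Unshelve. all: by end_near. Qed.

End paths.

(** * Concatenation, tails and seminorm estimates *)

Section paths.
Context (R : realType) (d : nat) (T : R).
Local Notation Om t := (Omega d T t).

Lemma path_ext t (w1 w2 : Om t) : (forall r, w1 r = w2 r) -> w1 = w2.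
Proof. by move=> e; apply/val_inj/funext. Qed.

Lemma concat_min t s (w : Om t) (w' : Om s) r : t <= s <= T ->
  concat w w' r = w (Num.min r s) + w' r.
Proof.
by move=> tsT; rewrite concatE//; case: ltP => // rs; rewrite (path_eq0 w') ?addr0// ltW.
Qed.

Lemma concat_le t s (w : Om t) (w' : Om s) r : t <= s <= T -> r <= s ->
  concat w w' r = w r.
Proof. by move=> tsT rs; rewrite concat_min// min_l// (path_eq0 w' rs) addr0. Qed.

Lemma concat0 t (w w' : Om t) : t <= T -> concat w w' = w'.
Proof.
move=> tT; apply: path_ext => r; rewrite concat_min ?lexx//.
by rewrite path_eq0 ?add0r// ge_min lexx orbT.
Qed.

Lemma concatA t s u (w : Om t) (w1 : Om s) (w2 : Om u) :
  t <= s -> s <= u -> u <= T ->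
  concat w (concat w1 w2) = concat (concat w w1) w2.
Proof.
move=> ts su uT.
have sT : s <= T := le_trans su uT.
have tu : t <= u := le_trans ts su.
apply: path_ext => r; rewrite !concat_min ?ts ?su ?sT ?uT ?tu//.
by rewrite -minA (min_r su) addrA.
Qed.

Lemma tail_pathE t s (w : Om t) r : tail_path s w r = w (Num.max r s) - w s.
Proof. by rewrite /= /tail_fun; case: ltP => // _; rewrite subrr. Qed.

Lemma concat_tail t s (w w1 : Om t) : t <= s <= T ->
  (forall r, r <= s -> w1 r = w r) -> concat w (tail_path s w1) = w1.
Proof.
move=> tsT ww1; apply: path_ext => r; rewrite concat_min// tail_pathE.
have [rs|/ltW sr] := leP r s; first by rewrite -ww1// subrr addr0.
by rewrite -ww1// addrC subrK.
Qed.

Lemma concat_range t s (w : Om t) : t <= s <= T ->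
  concat w @` [set: Om s] = [set w1 : Om t | forall r, r <= s -> w1 r = w r].
Proof.
move=> tsT; apply/seteqP; split=> [_ [w' _ <-] r rs|w1 ww1] /=.
  by rewrite concat_le.
by exists (tail_path s w1) => //; exact: concat_tail.
Qed.

Lemma supnorm_path_le t u (w w' : Om t) r : t <= u -> r <= u ->
  enorm (w r - w' r) <= supnorm t u (w \- w').
Proof.
move=> tu ru; have [rt|tr] := leP r t.
  by rewrite !path_eq0// subrr enorm0 supnorm_ge0.
apply: (@supnorm_ub _ _ _ _ (w \- w')) => //; first exact: path_subC.
by rewrite in_itv/= ru ltW.
Qed.

(** The path [w1] stopped at [u2] serves as intermediate point: it differs from [w1] stopped at [u1]
    only by an oscillation of [w1] between the two times. Measuring this oscillation from the
    earlier time matches the form of the bound in (P2). *)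
Lemma supnorm_stopped_le t (w1 w2 : Om t) u1 u2 x y : 0 <= x -> 0 <= y ->
  (forall r, enorm (w1 r - w2 r) <= x) ->
  (forall r, Num.min u1 u2 <= r <= Num.max u1 u2 ->
     enorm (w1 r - w1 (Num.min u1 u2)) <= y) ->
  supnorm t T (fun r => w1 (Num.min r u1) - w2 (Num.min r u2)) <= x + y.
Proof.
move=> x0 y0 Hx Hy; apply: supnorm_le => [|r _]; first exact: addr_ge0.
rewrite (le_trans (enorm_triangle (w1 (Num.min r u2)) _ _))// addrC.
rewrite lerD// {Hx}.
have [u12|/ltW u21] := leP u1 u2; rewrite ?(min_l u12) ?(max_r u12) ?(min_r u21) ?(max_l u21) in Hy.
  have [ru|/ltW ur] := leP r u1.
    by rewrite min_l ?(le_trans ru)// subrr enorm0.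
  by rewrite enormB Hy// le_min ur u12 ge_min lexx orbT.
have [ru|/ltW ur] := leP r u2.
  by rewrite min_l ?(le_trans ru)// subrr enorm0.
by rewrite Hy// le_min ur u21 ge_min lexx orbT.
Qed.

Lemma tail_continuous t (w : Om t) a : continuous (fun r => w r - w a).
Proof.
by move=> r; apply: cvgB; [exact: path_continuous|exact: cvg_cst].
Qed.

Lemma path_osc_le t (w : Om t) zeta h r : t <= T -> 0 <= h -> t <= zeta <= T ->
  r <= zeta + h -> (r < zeta -> w r = w zeta) ->
  enorm (w r - w zeta)
    <= supnorm zeta (Num.min (zeta + h) T) (fun r => w r - w zeta).
Proof.
move=> tT h0 /andP[tz zT] rzh rz.
have zz : zeta <= Num.min (zeta + h) T by rewrite le_min lerDl h0.
have [/rz ->|zr] := ltP r zeta; first by rewrite subrr enorm0 supnorm_ge0.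
have [rT|/ltW Tr] := leP r T.
  apply: (@supnorm_ub _ _ _ _ (fun r => w r - w zeta)) => //; first exact: tail_continuous.
  by rewrite in_itv/= zr le_min rzh rT.
rewrite (path_eqT w Tr).
apply: (@supnorm_ub _ _ _ _ (fun r => w r - w zeta)) => //; first exact: tail_continuous.
by rewrite in_itv/= zT le_min lexx (le_trans Tr rzh).
Qed.

Lemma concat_osc_le s t (w : Om s) (wt : Om t) h e a r : s <= t <= T ->
  0 <= h -> a <= T ->
  (forall r r', `|r - r'| <= h -> enorm (w r - w r') <= e) ->
  a <= r <= a + h ->
  enorm (concat w wt r - concat w wt a) <= e +
    supnorm (Num.max a t) (Num.min (Num.max a t + h) T)
      (fun r => wt r - wt (Num.max a t)).
Proof.
move=> stT h0 aT He /andP[ar rah]; have /andP[st tT] := stT.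
rewrite !concat_min// opprD addrACA (le_trans (enormD _ _))// lerD//.
  apply: He; rewrite ler_norml.
  by case: (leP r t) => ?; case: (leP a t) => ?; apply/andP; split; lra.
have -> : wt a = wt (Num.max a t) by case: leP => // ?; rewrite !path_eq0.
apply: path_osc_le => //.
- by rewrite le_max lexx orbT ge_max aT tT.
- by rewrite (le_trans rah)// lerD2r le_max lexx.
- by rewrite lt_max ltNge ar/= => rt; rewrite !path_eq0 ?ge_max ?(le_trans ar) ?(ltW rt) ?lexx//.
Qed.

Lemma supnorm_mono (a b b' : R) (f : R -> 'rV[R]_d) : a <= b -> b <= b' -> continuous f ->
  supnorm a b f <= supnorm a b' f.
Proof.
move=> ab bb' cf; apply: supnorm_le => [|r]; first exact: supnorm_ge0.
rewrite in_itv/= => /andP[ar rb]; apply: supnorm_ub => //; first exact: le_trans bb'.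
by rewrite in_itv/= ar (le_trans rb).
Qed.

Lemma supnorm_diag t u (w : Om t) : supnorm t u (w \- w) = 0.
Proof.
apply/eqP; rewrite eq_le supnorm_ge0 andbT; apply: supnorm_le => // r _.
by rewrite /= subrr enorm0.
Qed.

Lemma supnorm_le_add t s (v v' : Om t) : t <= s ->
  supnorm t s v' <= supnorm t s v + supnorm t s (v' \- v).
Proof.
move=> ts; apply: supnorm_le => [|r rts]; first by rewrite addr_ge0// supnorm_ge0.
rewrite -[v' r](subrK (v r)) addrC (le_trans (enormD _ _))// lerD//.
  by apply: supnorm_ub => //; exact: path_continuous.
by apply: (@supnorm_ub _ _ _ _ (v' \- v)) => //; exact: path_subC.
Qed.

Lemma supnorm_concat_le t (w w' : Om 0) (v : Om t) : 0 <= t <= T ->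
  supnorm 0 T (concat w' v \- concat w v) <= supnorm 0 t (w' \- w).
Proof.
move=> tT; have /andP[t0 _] := tT; apply: supnorm_le => [|r _ /=]; first exact: supnorm_ge0.
rewrite !concat_min// opprD addrACA subrr addr0; apply: supnorm_path_le => //.
by rewrite ge_min lexx orbT.
Qed.

Lemma supnorm_concat_le2 t s (w : Om 0) (v v' : Om t) : 0 <= t -> t <= s <= T ->
  supnorm 0 s (concat w v' \- concat w v) <= supnorm t s (v' \- v).
Proof.
move=> t0 /andP[ts sT]; have tT : 0 <= t <= T by rewrite t0 (le_trans ts).
apply: supnorm_le => [|r]; first exact: supnorm_ge0.
rewrite in_itv/= => /andP[_ rs].
by rewrite !concat_min// opprD addrACA subrr add0r; exact: supnorm_path_le.
Qed.

End paths.

(** * Measurability of sets of paths *)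

Lemma rat_approx (R : realType) (x e : R) : 0 < e ->
  exists q : rat, `|x - ratr q| < e.
Proof.
move=> e0; have /rat_in_itvoo[q] : x - e < x + e by rewrite ltrD2l gtrN.
by rewrite in_itv/= => /andP[? ?]; exists q; rewrite ltr_norml; apply/andP; split; lra.
Qed.

Lemma rat_row_approx (R : realType) d (x : 'rV[R]_d) e : 0 < e ->
  exists q : 'rV[rat]_d, enorm (x - map_mx ratr q) <= e.
Proof.
move=> e0; have e1 : 0 < e / (d%:R + 1) by rewrite divr_gt0// ltr_wpDl.
have /choice[f fP] := fun i => rat_approx (x ord0 i) e1.
exists (\row_i f i); rewrite (le_trans (enorm_le_norm _))//.
have n0 : `|x - map_mx ratr (\row_i f i)| <= e / (d%:R + 1).
  rewrite [leLHS]/Num.norm /= mx_normrE; apply/bigmax_leP; split=> [|[i j] _] /=.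
    exact: ltW.
  by rewrite !mxE [i]ord1 ltW.
rewrite (le_trans (ler_wpM2l _ n0))// mulrCA ler_piMr ?(ltW e0)//.
by rewrite ler_pdivrMr ?ltr_wpDl// mul1r lerDl.
Qed.

Lemma countable_bigcap_measurable d (X : measurableType d) (I : countType)
  (F : I -> set X) : (forall i, measurable (F i)) -> measurable (\bigcap_i F i).
Proof.
move=> mF; rewrite -[X in measurable X]setCK setC_bigcap; apply: measurableC.
apply: countable_bigcupT_measurable => [|i]; first exact: countableP.
exact: measurableC.
Qed.

Section filtration_theory.
Context (R : realType) (d : nat) (T : R).
Local Notation Om t := (Omega d T t).

Lemma filtrationE t s : @filtration R d T t s =
  @measurable _ (g_sigma_algebraType (@cylinders R d T t s)).
Proof. by []. Qed.

Lemma filtration_mono t s u : s <= u ->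
  @filtration R d T t s `<=` @filtration R d T t u.
Proof.
move=> su; apply: sub_sigma_algebra2 => _ [r [U [/andP[tr rs] mU ->]]].
by exists r, U; split => //; rewrite tr (le_trans rs).
Qed.

Lemma filtration0 t s : @filtration R d T t s set0.
Proof. by rewrite filtrationE; exact: measurable0. Qed.

Lemma filtrationT t s : @filtration R d T t s setT.
Proof. by rewrite filtrationE; exact: measurableT. Qed.

Lemma filtrationC t s (A : set (Om t)) : filtration s A -> filtration s (~` A).
Proof. by rewrite filtrationE; exact: measurableC. Qed.

Lemma filtrationI t s (A B : set (Om t)) :
  filtration s A -> filtration s B -> filtration s (A `&` B).
Proof. by rewrite filtrationE; exact: measurableI. Qed.

Lemma filtrationU t s (A B : set (Om t)) :
  filtration s A -> filtration s B -> filtration s (A `|` B).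
Proof. by rewrite filtrationE; exact: measurableU. Qed.

Lemma filtrationD t s (A B : set (Om t)) :
  filtration s A -> filtration s B -> filtration s (A `\` B).
Proof. by rewrite filtrationE; exact: measurableD. Qed.

Lemma filtration_bigcup t s (I : countType) (F : I -> set (Om t)) :
  (forall i, filtration s (F i)) -> filtration s (\bigcup_i F i).
Proof.
move=> mF; apply: (@countable_bigcupT_measurable _
  (g_sigma_algebraType (@cylinders R d T t s))) mF.
exact: countableP.
Qed.

Lemma filtration_bigcap t s (I : countType) (F : I -> set (Om t)) :
  (forall i, filtration s (F i)) -> filtration s (\bigcap_i F i).
Proof.
exact: (@countable_bigcap_measurable _
  (g_sigma_algebraType (@cylinders R d T t s))).
Qed.

Lemma filtration_closed_ball t s r (c : 'rV[R]_d) e : t <= r <= s ->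
  filtration s [set w : Om t | enorm (w r - c) <= e].
Proof.
move=> trs; apply: sub_sigma_algebra.
exists r, [set x | enorm (x - c) <= e]; split => //.
rewrite -[X in <<s _ >> X]setCK; apply: sigma_algebraC.
by apply: sub_sigma_algebra; rewrite openC; exact: closed_enorm_ball.
Qed.

(** A countable dense set of times, which makes a tube a countable intersection of cylinders. The
    endpoint [u] is all that remains when [t = u] is irrational. *)
Definition tube_times (t u : R) : set R :=
  [set r | t <= r <= u /\ (r = u \/ exists q : rat, r = ratr q)].

Lemma tube_times_dense t u r h : t <= r <= u -> 0 < h ->
  exists2 r', tube_times t u r' & `|r - r'| <= h.
Proof.
move=> /andP[tr]; rewrite le_eqVlt => /predU1P[ru|ru h0].
  rewrite ru in tr *.
  move=> /ltW h0; exists u; last by rewrite subrr normr0.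
  by split; [rewrite tr lexx|left].
have : r < Num.min u (r + h) by rewrite lt_min ru ltrDl.
case/rat_in_itvoo => q; rewrite in_itv/= lt_min => /andP[rq /andP[qu qrh]].
exists (ratr q); first by split; [rewrite (le_trans tr) ltW|right; exists q].
by rewrite ler_norml; apply/andP; split; lra.
Qed.

(* A path in the tube stays within 1/(m+1) of a step function with rational
   values and mesh 1/n. Countably many tubes refine all uniform balls. *)
Definition tube (t u : R) (i : seq 'rV[rat]_d * (nat * nat)) : set (Om t) :=
  [set w | forall r, tube_times t u r ->
     enorm (w r - map_mx ratr (nth 0 i.1 (Num.truncn (r * i.2.1%:R))))
       <= i.2.2.+1%:R^-1].

Lemma filtration_tube t u i : t <= u -> filtration u (@tube t u i).
Proof.
(* [None] encodes the endpoint [u]. *)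
move=> tu; pose r (q : option rat) : R := if q is Some q then ratr q else u.
have -> : tube u i = \bigcap_q (if t <= r q <= u then
    [set w : Om t | enorm (w (r q) - map_mx ratr (nth 0 i.1 (Num.truncn (r q * i.2.1%:R))))
       <= i.2.2.+1%:R^-1] else setT).
  apply/seteqP; split=> [w Hw q _|w Hw r' [r'tu r'q]].
    case: ifPn => // rq; apply: Hw; split=> //.
    by case: q {rq} => [q|]; [right; exists q|left].
  case: r'q => [->|[q r'q]].
    by have := Hw None Logic.I; rewrite /= tu lexx.
  by have := Hw (Some q) Logic.I; rewrite /= -r'q r'tu.
apply: filtration_bigcap => q; case: ifPn => [rq|_]; last exact: filtrationT.
exact: filtration_closed_ball.
Qed.

(** Tubes replace separability of the path space: sampling a uniformly continuous path on a fine
    mesh, with values rounded to rationals, gives a tube around it that fits into a prescribed ball.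
    Since [0 <= t], natural numbers suffice to index the mesh cells. *)
Lemma tube_cover t u (w : Om t) e : 0 <= t <= u -> 0 < e ->
  exists i, tube u i w /\ forall w' : Om t, tube u i w' -> supnorm t u (w' \- w) < e.
Proof.
move=> /andP[t0 tu] e0.
have [m mP] : exists m : nat, m.+1%:R^-1 < e / 4.
  have e4 : 0 < e / 4 by rewrite divr_gt0.
  have [k _ kP] := @near_infty_natSinv_lt R (PosNum e4).
  by exists k; apply: (kP k) => /=.
set E := m.+1%:R^-1 in mP; have E0 : 0 < E by rewrite invr_gt0 ltr0n.
have E2 : 0 < E / 2 by rewrite divr_gt0.
have [h h0 hP] := path_unif_continuous w E2.
have [n nP] : exists n : nat, n.+1%:R^-1 < h.
  have [k _ kP] := @near_infty_natSinv_lt R (PosNum h0).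
  by exists k; apply: (kP k) => /=.
have /choice[f fP] := fun x : 'rV[R]_d => rat_row_approx x E2.
pose q := [seq f (w (i%:R / n.+1%:R)) | i <- iota 0 (Num.truncn (u * n.+1%:R)).+1].
have Hw : tube u (q, (n.+1, m)) w.
  move=> r [/andP[tr ru] _] /=.
  have r0 : 0 <= r * n.+1%:R by rewrite mulr_ge0// (le_trans t0).
  have /andP[i1 i2] := truncn_itv r0.
  set i := Num.truncn _ in i1 i2 *.
  rewrite (nth_map 0%N) ?size_iota; last first.
    by rewrite ltnS /i; apply: le_truncn; rewrite ler_wpM2r.
  rewrite nth_iota ?add0n; last first.
    by rewrite ltnS /i; apply: le_truncn; rewrite ler_wpM2r.
  rewrite (le_trans (enorm_triangle (w (i%:R / n.+1%:R)) _ _))//.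
  rewrite -/E (splitr E) lerD//; apply: hP.
  have n1 : 0 < n.+1%:R :> R by [].
  rewrite ler_norml; apply/andP; split.
    rewrite lerNl opprB (@le_trans _ _ 0) ?(ltW h0)// subr_le0.
    by rewrite ler_pdivrMr.
  rewrite (le_trans _ (ltW nP))// lerBlDr -[X in X + _]mul1r -mulrDl.
  by rewrite ler_pdivlMr// (addrC 1) natr1 ltW.
exists (q, (n.+1, m)); split=> // w' Hw'.
(* Less than [e / 2] comes from comparing both paths with the common step function at a tube time,
   and [e / 4] from moving both paths to that time. *)
apply: (@le_lt_trans _ _ (3 * (e / 4))); last lra.
apply: supnorm_le => [|r]; first by rewrite mulr_ge0// divr_ge0// ltW.
rewrite in_itv/= => rtu.
have e8 : 0 < e / 8 by rewrite divr_gt0.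
have [h1 h10 hP1] := path_unif_continuous w e8.
have [h2 h20 hP2] := path_unif_continuous w' e8.
have h120 : 0 < Num.min h1 h2 by rewrite lt_min h10.
have [r' r'C] := tube_times_dense rtu h120.
rewrite le_min => /andP[/hP1 A1 /hP2 A2].
have A3 := Hw _ r'C; have A4 := Hw' _ r'C; rewrite /= -/E in A3 A4.
set c := map_mx _ _ in A3 A4.
have B1 := enorm_triangle (w' r') (w' r) (w r).
have B2 := enorm_triangle c (w' r') (w r).
have B3 := enorm_triangle (w r') c (w r).
rewrite (enormB c (w r')) (enormB (w r') (w r)) in B3.
lra.
Qed.

(** Such a set is the union of the countably many tubes contained in it. This is the main source of
    measurability: whatever is continuous for the seminorm on [[t, u]] is known at time [u]. *)
Lemma filtration_open t u (V : set (Om t)) : 0 <= t <= u ->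
  (forall w, V w -> exists2 e, 0 < e &
     forall w' : Om t, supnorm t u (w' \- w) < e -> V w') -> filtration u V.
Proof.
move=> tu0 HV; have /andP[_ tu] := tu0.
have -> : V = \bigcup_i (if `[< tube u i `<=` V >] then tube u i else set0).
  apply/seteqP; split=> [w Vw|w [i _]]; last by case: asboolP => // + ?; exact.
  have [e e0 eP] := HV _ Vw.
  have [i [wi iP]] := tube_cover w tu0 e0.
  by exists i => //; rewrite asboolT// => w' /iP /eP.
apply: filtration_bigcup => i; case: ifPn => _; last exact: filtration0.
exact: filtration_tube.
Qed.

End filtration_theory.

(** * Expectations of bounded random variables *)

Lemma measure_full_restrict d (X : measurableType d) (R : realType)
    (m : {measure set X -> \bar R}) (A B : set X) :
  measurable A -> measurable B -> m setT = 1%E -> m B = 1%E -> m A = m (A `&` B).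
Proof.
move=> mA mB mT mB1; apply: (etrans (measureDI m mA mB)); rewrite -[RHS]add0e; congr (_ + _)%E.
have H : m (~` B) = 0%E.
  have E : m setT = (m (setT `\` B) + m (setT `&` B))%E by exact: measureDI.
  rewrite mT setTI mB1 setTD in E.
  have : m (~` B) \is a fin_num.
    rewrite ge0_fin_numE//; apply: (@le_lt_trans _ _ (m setT)); last by rewrite mT ltry.
    by apply: le_measure; rewrite ?inE//; exact: measurableC.
  move: E; case: (m (~` B)) => // r [] E _; congr _%:E; lra.
apply/eqP; rewrite eq_le measure_ge0 andbT -H; apply: le_measure; rewrite ?inE.
- exact: measurableD.
- exact: measurableC.
- by move=> x [].
Qed.

Section bounded_expectation.
Context d (X : measurableType d) (R : realType).
Implicit Types (f g : X -> R) (P : probability X R).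

(** Rewards and envelope are bounded, so expectations can be handled as real numbers with
    unrestricted linearity. *)
Definition bounded_rv f :=
  measurable_fun setT f /\ exists M : R, forall x, `|f x| <= M.

Definition Ex P f : R := \int[P]_x f x.

Lemma bounded_rv_measurable f : bounded_rv f -> measurable_fun setT f.
Proof. by case. Qed.

Lemma bounded_rv_integrable P f : bounded_rv f -> P.-integrable setT (EFin \o f).
Proof.
move=> [mf [M fM]]; apply: measurable_bounded_integrable => //.
  by apply: (le_lt_trans (probability_le1 P measurableT)); rewrite ltry.
exists M; split; first exact: num_real.
by move=> y My x _ /=; rewrite (le_trans (fM x))// ltW.
Qed.

Lemma Ex_EFin P f : bounded_rv f -> (\int[P]_x (f x)%:E = (Ex P f)%:E)%E.
Proof.
move=> bf; rewrite /Ex /Rintegral fineK//.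
exact: (integrable_fin_num _ (bounded_rv_integrable P bf)).
Qed.

Lemma bounded_rv_cst (c : R) : bounded_rv (fun=> c).
Proof. by split; [exact: measurable_cst|exists `|c|]. Qed.

Lemma bounded_rvD f g : bounded_rv f -> bounded_rv g -> bounded_rv (fun x => f x + g x).
Proof.
move=> [mf [M fM]] [mg [N gN]]; split; first exact: measurable_funD.
by exists (M + N) => x; rewrite (le_trans (ler_normD _ _))// lerD.
Qed.

Lemma bounded_rvN f : bounded_rv f -> bounded_rv (fun x => - f x).
Proof.
move=> [mf [M fM]]; split; first exact: measurableT_comp.
by exists M => x; rewrite normrN.
Qed.

Lemma bounded_rvB f g : bounded_rv f -> bounded_rv g -> bounded_rv (fun x => f x - g x).
Proof. by move=> bf bg; apply: bounded_rvD => //; exact: bounded_rvN. Qed.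

Lemma bounded_rvM f g : bounded_rv f -> bounded_rv g -> bounded_rv (fun x => f x * g x).
Proof.
move=> [mf [M fM]] [mg [N gN]]; split; first exact: measurable_funM.
by exists (M * N) => x; rewrite normrM ler_pM.
Qed.

Lemma bounded_rv_indic (A : set X) : measurable A -> bounded_rv (\1_A : X -> R).
Proof.
move=> mA; split=> //; exists 1 => x.
by rewrite indicE ger0_norm// lern1 leq_b1.
Qed.

Lemma bounded_rv_norm f : bounded_rv f -> bounded_rv (fun x => `|f x|).
Proof.
move=> [mf [M fM]]; split; first exact: measurableT_comp.
by exists M => x; rewrite normr_id.
Qed.

Lemma bounded_rv_sum (I : Type) (s : seq I) (F : I -> X -> R) :
  (forall i, bounded_rv (F i)) -> bounded_rv (fun x => \sum_(i <- s) F i x).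
Proof.
move=> bF; elim: s => [|i s IH].
  by under eq_fun do rewrite big_nil; exact: bounded_rv_cst.
by under eq_fun do rewrite big_cons; exact: bounded_rvD.
Qed.

Lemma ExD P f g : bounded_rv f -> bounded_rv g ->
  Ex P (fun x => f x + g x) = Ex P f + Ex P g.
Proof. by move=> bf bg; rewrite /Ex RintegralD//; exact: bounded_rv_integrable. Qed.

Lemma ExB P f g : bounded_rv f -> bounded_rv g ->
  Ex P (fun x => f x - g x) = Ex P f - Ex P g.
Proof. by move=> bf bg; rewrite /Ex RintegralB//; exact: bounded_rv_integrable. Qed.

Lemma ExZ P c f : bounded_rv f -> Ex P (fun x => c * f x) = c * Ex P f.
Proof. by move=> bf; rewrite /Ex RintegralZl//; exact: bounded_rv_integrable. Qed.

Lemma Ex_cst P c : Ex P (fun=> c) = c.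
Proof. by rewrite /Ex Rintegral_cst//= probability_setT mulr1. Qed.

Lemma Ex_sum P (I : Type) (s : seq I) (F : I -> X -> R) :
  (forall i, bounded_rv (F i)) ->
  Ex P (fun x => \sum_(i <- s) F i x) = \sum_(i <- s) Ex P (F i).
Proof.
move=> bF; elim: s => [|i s IH].
  by under eq_fun do rewrite big_nil; rewrite big_nil Ex_cst.
under eq_fun do rewrite big_cons; rewrite big_cons ExD ?IH//.
exact: bounded_rv_sum.
Qed.

Lemma Ex_le P f g : bounded_rv f -> bounded_rv g -> (forall x, f x <= g x) ->
  Ex P f <= Ex P g.
Proof. by move=> bf bg fg; apply: le_Rintegral => //; exact: bounded_rv_integrable. Qed.

Lemma Ex_indic P (A : set X) : measurable A -> Ex P \1_A = fine (P A).
Proof. by move=> mA; rewrite /Ex /Rintegral integral_indic// setIT. Qed.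

Lemma Ex_ge_cst P f c : bounded_rv f -> (forall x, c <= f x) -> c <= Ex P f.
Proof. by move=> bf cf; rewrite -(Ex_cst P c) Ex_le//; exact: bounded_rv_cst. Qed.

Lemma Ex_le_cst P f c : bounded_rv f -> (forall x, f x <= c) -> Ex P f <= c.
Proof. by move=> bf cf; rewrite -(Ex_cst P c) Ex_le//; exact: bounded_rv_cst. Qed.

Lemma Ex_norm_le P f c : bounded_rv f -> (forall x, `|f x| <= c) -> `|Ex P f| <= c.
Proof.
move=> bf fc; rewrite ler_norml; apply/andP; split.
  by apply: Ex_ge_cst => // x; have := fc x; rewrite ler_norml => /andP[].
by apply: Ex_le_cst => // x; have := fc x; rewrite ler_norml => /andP[].
Qed.

Lemma Ex_norm P f : bounded_rv f -> `|Ex P f| <= Ex P (fun x => `|f x|).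
Proof.
by move=> bf; apply: le_normr_Rintegral => //; exact: bounded_rv_integrable.
Qed.

Lemma Ex_restrict P (A : set X) f : measurable A -> bounded_rv f ->
  (\int[P]_(x in A) (f x)%:E = (Ex P (fun x => \1_A x * f x))%:E)%E.
Proof.
move=> mA bf; rewrite integral_mkcond -Ex_EFin; last first.
  by apply: bounded_rvM => //; exact: bounded_rv_indic.
apply: eq_integral => x _; rewrite patchE indicE.
by case: ifPn; rewrite ?mul1r ?mul0r.
Qed.

(* [h] need not be measurable: the library integral of a nonnegative function
   is a supremum over the simple functions below it. *)
Lemma Ex_norm_le_integral P f (h : X -> R) c : bounded_rv f ->
  (forall x, `|f x| <= h x) -> (\int[P]_x (h x)%:E <= c%:E)%E ->
  Ex P (fun x => `|f x|) <= c.
Proof.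
move=> bf fh hc; rewrite -lee_fin -Ex_EFin; last exact: bounded_rv_norm.
apply: le_trans hc; rewrite !ge0_integralTE//; last first.
  by move=> x; rewrite lee_fin (le_trans _ (fh x)).
apply: ereal_sup_le => _ [s sf <-]; exists s => // x /=.
by rewrite (le_trans (sf x))// lee_fin.
Qed.

Lemma Ex_cvg P (f_ : (X -> R)^nat) f M :
  (forall n, measurable_fun setT (f_ n)) -> (forall n x, `|f_ n x| <= M) ->
  (forall x, f_ ^~ x @ \oo --> f x) ->
  Ex P (f_ n) @[n --> \oo] --> Ex P f.
Proof.
move=> mf fM ff.
have mlim : measurable_fun setT f.
  by apply: (measurable_fun_cvg mf) => x _; exact: ff.
have fM' x : `|f x| <= M.
  have cn : Num.norm \o f_ ^~ x @ \oo --> `|f x| by apply: cvg_norm; exact: ff.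
  rewrite -(cvg_lim _ cn)//; apply: limr_le; first by apply/cvg_ex; exists `|f x|.
  by apply: nearW => n /=.
have bf n : bounded_rv (f_ n) by split=> //; exists M.
have bl : bounded_rv f by split=> //; exists M.
have := @dominated_cvg _ _ _ P setT measurableT (fun n => EFin \o f_ n)
  (EFin \o f) (cst M%:E).
move=> H.
have : (\int[P]_x (f_ n x)%:E @[n --> \oo] --> \int[P]_x (f x)%:E)%E.
  apply: H => //.
  - by move=> n; exact/measurable_EFinP.
  - by move=> x _; apply: cvg_EFin; [exact: nearW|exact: ff].
  - by apply: (@bounded_rv_integrable P (fun=> M)); exact: bounded_rv_cst.
  - by move=> n x _; rewrite lee_fin.
rewrite Ex_EFin//; under eq_fun do rewrite Ex_EFin//.
exact: fine_cvg.
Qed.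

Lemma measurable_fun_le_sets f :
  (forall c, measurable [set x | f x <= c]) -> measurable_fun setT f.
Proof.
move=> mf; apply: (measurability _ (RGenOInfty.measurableE R)).
move=> _ [_ [c ->] <-]; rewrite setTI.
rewrite (_ : _ @^-1` _ = ~` [set x | f x <= c]); first exact: measurableC.
by apply/seteqP; split=> x /=; rewrite in_itv/= andbT ltNge => /negP.
Qed.

Lemma measurable_le_set f c : measurable_fun setT f -> measurable [set x | f x <= c].
Proof.
move=> mf; rewrite (_ : [set x | _] = setT `&` f @^-1` `]-oo, c]%classic).
  exact: mf.
by rewrite setTI; apply/seteqP; split=> x /=; rewrite in_itv.
Qed.

Lemma measurable_ge_set f c : measurable_fun setT f -> measurable [set x | c <= f x].
Proof.
move=> mf; rewrite (_ : [set x | _] = setT `&` f @^-1` `[c, +oo[%classic).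
  exact: mf.
by rewrite setTI; apply/seteqP; split=> x /=; rewrite in_itv/= andbT.
Qed.

(** Rounding [g] up to a grid of mesh [1 / n.+1], capped at [b], turns the composite into a finite
    sum of products of measurable functions; continuity of [F] in its first argument passes
    measurability to the limit. This stands in for joint measurability of a process sampled at a
    random time. *)
Lemma measurable_fun_comp_grid (F : R -> X -> R) (g : X -> R) (a b : R) :
  a <= b -> (forall r, a <= r <= b -> measurable_fun setT (F r)) ->
  measurable_fun setT g -> (forall x, a <= g x <= b) ->
  (forall x r e, a <= r <= b -> 0 < e -> exists2 h, 0 < h &
    forall r', a <= r' <= b -> `|r - r'| < h -> `|F r x - F r' x| < e) ->
  measurable_fun setT (fun x => F (g x) x).
Proof.
move=> ab mF mg gab cF.
pose i n x := Num.truncn ((g x - a) * n.+1%:R).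
pose c n k : R := Num.min b (a + k.+1%:R / n.+1%:R).
have cab n k : a <= c n k <= b.
  by rewrite /c le_min ab ge_min lexx lerDl divr_ge0.
have ic n x : `|g x - c n (i n x)| <= n.+1%:R^-1.
  have /andP[ag gb] := gab x.
  have /truncn_itv /andP[] : 0 <= (g x - a) * n.+1%:R.
    by rewrite mulr_ge0// subr_ge0.
  have n1 : 0 < n.+1%:R :> R by [].
  rewrite -ltr_pdivlMr// -ler_pdivrMr// -/(i n x) => h1 h2.
  have n2 : 0 < n.+1%:R^-1 :> R by rewrite invr_gt0.
  have e1 : (i n x).+1%:R / n.+1%:R = (i n x)%:R / n.+1%:R + n.+1%:R^-1 :> R.
    by rewrite -natr1 mulrDl mul1r.
  have gc : g x <= c n (i n x) by rewrite /c le_min gb/= -lerBlDl ltW.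
  rewrite distrC ger0_norm ?subr_ge0//.
  rewrite lerBlDr ge_min; apply/orP; right; rewrite e1 addrA [leRHS]addrC lerD2r.
  by rewrite -lerBrDl.
apply: (@measurable_fun_cvg _ _ _ _
  (fun n x => F (c n (i n x)) x)) => [n|x _].
  have -> : (fun x => F (c n (i n x)) x) =
      (fun x => \sum_(k < (Num.truncn ((b - a) * n.+1%:R)).+1)
         \1_[set x | i n x = k] x * F (c n k) x).
    apply/funext => x.
    have ib : (i n x < (Num.truncn ((b - a) * n.+1%:R)).+1)%N.
      rewrite ltnS; apply: le_truncn; rewrite ler_wpM2r// lerD2r.
      by have /andP[] := gab x.
    rewrite (bigD1 (Ordinal ib))//= big1 ?addr0.
      by rewrite indicE mem_set ?mul1r.
    move=> k ki; rewrite indicE memNset ?mul0r//= => ik.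
    by move/negP : ki; apply; apply/eqP/val_inj.
  apply: measurable_sum => k; apply: measurable_funM; last exact: mF.
  apply: measurable_indic.
  rewrite (_ : [set x | i n x = k] =
    [set x | a + k%:R / n.+1%:R <= g x] `\` [set x | a + k.+1%:R / n.+1%:R <= g x]).
    by apply: measurableD; exact: measurable_ge_set.
  have E x (j : nat) :
      (a + j%:R / n.+1%:R <= g x) = (j%:R <= (g x - a) * n.+1%:R).
    by rewrite -lerBrDl ler_pdivrMr.
  apply/seteqP; split=> x /=; rewrite !E.
    have /truncn_itv /andP[h1 h2] : 0 <= (g x - a) * n.+1%:R.
      by have /andP[? _] := gab x; rewrite mulr_ge0// subr_ge0.
    by move=> <-; split; [exact: h1|rewrite leNgt => /negP; exact].
  by move=> [h1 /negP]; rewrite -ltNge => h2; apply: truncn_def; rewrite h1.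
apply/cvgrPdist_lt => e e0; have [h h0 H] := cF x (g x) e (gab x) e0.
near=> n; apply: H => //; apply: le_lt_trans (ic n x) _.
near: n; exact: near_infty_natSinv_lt (PosNum h0).
Unshelve. all: by end_near. Qed.

Lemma Ex_le_ae P f g :
  bounded_rv f -> bounded_rv g -> P [set x | f x <= g x] = 1%E -> Ex P f <= Ex P g.
Proof.
move=> bf bg fg.
pose N := ~` [set x | f x <= g x].
have mS : measurable [set x | f x <= g x].
  rewrite (_ : [set _ | _] = [set x | f x - g x <= 0]).
    by apply: measurable_le_set; case: (bounded_rvB bf bg).
  by apply/seteqP; split=> x /=; rewrite subr_le0.
have mN : measurable N by exact: measurableC.
have PN : P N = 0%E by rewrite probability_setC// fg subee.
have [_ [C HC]] := bounded_rvB bf bg.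
have b1 := bounded_rv_indic mN.
have bC : bounded_rv (fun x => C * \1_N x : R) by apply: bounded_rvM => //; exact: bounded_rv_cst.
apply: (@le_trans _ _ (Ex P (fun x => g x + C * \1_N x))).
  apply: Ex_le => //; first exact: bounded_rvD.
  move=> x; rewrite indicE; case: (boolP (x \in N)).
    by move=> _; rewrite mulr1 -lerBlDl (le_trans (ler_norm _)).
  by rewrite notin_setE /N /= mulr0 addr0 => /contrapT.
by rewrite ExD// ExZ// Ex_indic// PN /= mulr0 addr0.
Qed.

Lemma Ex_partition P n (A : nat -> set X) (B : set X) f :
  (forall j, (j < n)%N -> measurable (A j)) -> trivIset `I_n A ->
  \bigcup_(j < n) A j = setT -> measurable B -> bounded_rv f ->
  Ex P (fun x => \1_B x * f x) = \sum_(j < n) Ex P (fun x => \1_(B `&` A j) x * f x).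
Proof.
move=> mA tA cA mB bf.
rewrite -(Ex_sum P _ (F := fun (j : 'I_n) x => \1_(B `&` A j) x * f x)); last first.
  by move=> j; apply: bounded_rvM => //; apply: bounded_rv_indic; apply: measurableI => //; exact: mA.
congr (Ex P _); apply/funext => x.
have : setT x by []; rewrite -cA => -[j /= jn Ajx].
rewrite (bigD1 (Ordinal jn))//= big1 ?addr0.
  by rewrite indicI /= [\1_(A j) x]indicE mem_set// mulr1.
move=> k kj; rewrite indicI /= [\1_(A k) x]indicE memNset ?mulr0 ?mul0r//.
move=> Akx; move/negP : kj; apply; apply/eqP/val_inj => /=.
by apply: (tA (k : nat) j (ltn_ord k) jn); exists x.
Qed.

(** Here [s] is [p] rounded down to a multiple of [1 / K.+1], written as an average of level-set
    indicators. It transfers facts known for sets to functions with values in [0, 1]. *)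
Lemma layer_cake (p : R) K : 0 <= p <= 1 ->
  let s := K.+1%:R^-1 * \sum_(k < K.+1) (k.+1%:R / K.+1%:R <= p :> R)%:R in
  (s <= p <= s + K.+1%:R^-1) = true.
Proof.
move=> /andP[p0 p1] s.
have K0 : 0 < K.+1%:R :> R by [].
have /truncn_itv/andP[h1 h2] : 0 <= p * K.+1%:R by rewrite mulr_ge0.
set j := Num.truncn _ in h1 h2.
have -> : s = K.+1%:R^-1 * j%:R.
  congr (_ * _).
  have jK : (j <= K.+1)%N.
    rewrite -(ler_nat R) (le_trans h1)// ler_piMl//.
  rewrite -natr_sum; congr (_%:R).
  under eq_bigr => k _.
    have -> : (k.+1%:R / K.+1%:R <= p) = (k < j)%N.
      rewrite ler_pdivrMr//; apply/idP/idP => [kp|kj].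
        by rewrite -ltnS -(ltr_nat R) (le_lt_trans kp).
      by rewrite (le_trans _ h1)// ler_nat.
    over.
  rewrite -(big_mkord xpredT (fun k => (k < j)%N : nat)).
  rewrite (big_cat_nat (n := j))//= [X in (_ + X)%N]big1_seq ?addn0.
    rewrite (eq_big_nat _ _ (F2 := fun=> 1%N)).
      by rewrite sum_nat_const_nat subn0 muln1.
    by move=> k /andP[_ ->].
  by move=> k /=; rewrite mem_index_iota => /andP[jk _]; rewrite ltnNge jk.
rewrite mulrC ler_pdivrMr// h1/= -[X in _ + X]mul1r -mulrDl.
by rewrite ler_pdivlMr// natr1 ltW.
Qed.

End bounded_expectation.

(** * Adapted functions and stopping times *)

Section adapted_theory.
Context (R : realType) (d : nat) (T : R).
Local Notation Om t := (Omega d T t).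

(** It is enough to pull back generators, and for these open sets of a single coordinate; their
    preimages are open for the seminorm on [[a, u]]. Concatenation and tails are both instances. *)
Lemma filtration_preimage a b u v (phi : Om a -> Om b) (A : set (Om b)) :
  0 <= a <= u ->
  (forall r, b <= r <= v -> forall (w : Om a) e, 0 < e -> exists2 e', 0 < e' &
    forall w' : Om a, supnorm a u (w' \- w) < e' ->
      enorm (phi w' r - phi w r) < e) ->
  filtration v A -> filtration u (phi @^-1` A).
Proof.
move=> au cphi.
suff : @filtration R d T b v `<=` [set A | filtration u (phi @^-1` A)] by exact.
apply: smallest_sub.
  split=> [|B mB|B mB] /=.
  - by rewrite preimage_set0; exact: filtration0.
  - by rewrite setTD preimage_setC; exact: filtrationC.
  - by rewrite preimage_bigcup; exact: filtration_bigcup.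
move=> _ [r [U [rv mU ->]]] /=.
suff : <<s open >> `<=` [set U : set 'rV[R]_d | filtration u [set w | U (phi w r)]].
  by move/(_ U mU).
apply: smallest_sub.
  split=> [|B mB|B mB] /=.
  - exact: filtration0.
  - rewrite (_ : [set w | _] = ~` [set w | B (phi w r)]); first exact: filtrationC.
    by apply/seteqP; split=> w /=; [case|split].
  - rewrite (_ : [set w | _] = \bigcup_i [set w | B i (phi w r)]).
      exact: filtration_bigcup.
    by apply/seteqP; split=> w /= [i _ Biw]; exists i.
move=> {mU}U oU /=; apply: filtration_open => // w /= Uw.
have [e e0 eU] := open_enorm oU Uw.
have [e' e'0 H] := cphi r rv w e e0.
by exists e' => // w' /H /eU.
Qed.

Lemma filtration_concat t s u (w : Om t) (A : set (Om t)) :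
  0 <= t -> t <= s <= T -> s <= u -> filtration u A ->
  @filtration R d T s u (concat w @^-1` A).
Proof.
move=> t0 tsT su; have /andP[ts sT] := tsT.
apply: filtration_preimage => [|r /andP[tr ru] w1 e e0].
  by rewrite (le_trans t0).
exists e => // w2 w12; apply: le_lt_trans w12.
by rewrite !concat_min// opprD addrACA subrr add0r supnorm_path_le.
Qed.

Lemma filtration_tail t s u (A : set (Om s)) :
  0 <= t -> t <= s <= T -> s <= u -> filtration u A ->
  @filtration R d T t u (tail_path s @^-1` A).
Proof.
move=> t0 /andP[ts sT] su.
have tu : t <= u := le_trans ts su.
apply: filtration_preimage => [|r /andP[sr ru] w1 e e0]; first by rewrite t0.
exists (e / 2) => [|w2 w12]; first by rewrite divr_gt0.
rewrite !tail_pathE (_ : _ - _ = (w2 (Num.max r s) - w1 (Num.max r s)) - (w2 s - w1 s)).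
  rewrite (le_lt_trans (enormD _ _))// enormN [X in _ < X]splitr ltrD//.
    by apply: le_lt_trans w12; apply: supnorm_path_le; rewrite // ge_max ru.
  by apply: le_lt_trans w12; exact: supnorm_path_le.
by rewrite !opprB addrACA [RHS]addrACA; congr (_ + _); rewrite addrC.
Qed.

(** The sets that do not separate [w] from [w'] form a sigma-algebra containing the generators of
    F_s. *)
Lemma galmarino t s (A : set (Om t)) (w w' : Om t) : filtration s A ->
  (forall r, r <= s -> w r = w' r) -> A w <-> A w'.
Proof.
move=> + ww'.
suff : @filtration R d T t s `<=` [set A | A w <-> A w'] by exact.
apply: smallest_sub.
  split=> [//|B /= [H1 H2]|B mB] /=.
    by split=> -[_ H]; split=> //; tauto.
  by split=> -[i _ Bi]; exists i => //; apply/(mB i).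
by move=> _ [r [U [/andP[_ rs] _ ->]]] /=; rewrite ww'.
Qed.

(** Measurability of one random variable for F_u. It is stated through sublevel sets since the type
    [Om t] itself carries F_T; the next two lemmas pass to the type that carries F_u. *)
Definition adapted t (u : R) (f : Om t -> R) : Prop :=
  forall c, filtration u [set w | f w <= c].

Lemma adapted_measurable t u (f : Om t -> R) : adapted u f ->
  measurable_fun setT (f : g_sigma_algebraType (@cylinders R d T t u) -> R).
Proof. by move=> af; apply: measurable_fun_le_sets. Qed.

Lemma measurable_adapted t u (f : Om t -> R) :
  measurable_fun setT (f : g_sigma_algebraType (@cylinders R d T t u) -> R) ->
  adapted u f.
Proof. by move=> mf c; exact: (measurable_le_set _ mf). Qed.

Lemma adapted_mono t u v (f : Om t -> R) : u <= v -> adapted u f -> adapted v f.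
Proof. by move=> uv af c; exact: filtration_mono uv _ (af c). Qed.

Lemma adapted_measurableT t u (f : Om t -> R) : u <= T -> adapted u f ->
  measurable_fun setT f.
Proof. by move=> uT /(adapted_mono uT)/adapted_measurable. Qed.

Lemma filtration_measurable t u (A : set (Om t)) : u <= T -> filtration u A ->
  measurable A.
Proof. by move=> uT /(filtration_mono uT). Qed.

Lemma continuous_adapted t u (f : Om t -> R) : 0 <= t <= u ->
  (forall (w : Om t) e, 0 < e -> exists2 h, 0 < h &
    forall w' : Om t, supnorm t u (w' \- w) < h -> `|f w' - f w| < e) ->
  adapted u f.
Proof.
move=> tu cf c.
rewrite (_ : [set w | _] = ~` [set w | c < f w]); last first.
  by apply/seteqP; split=> w /=; rewrite leNgt => /negP.
apply: filtrationC; apply: filtration_open => // w /= cw.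
have [|h h0 H] := cf w (f w - c); first by rewrite subr_gt0.
by exists h => // w' /H; rewrite ltr_norml => /andP[+ _]; lra.
Qed.

Lemma adapted_comp_concat t s u (f : Om t -> R) (w : Om t) :
  0 <= t -> t <= s <= T -> s <= u -> adapted u f ->
  adapted u (fun w' : Om s => f (concat w w')).
Proof. by move=> t0 tsT su af c; apply: (filtration_concat w t0 tsT su (af c)). Qed.

Lemma stopping_le t (g : Om t -> R) c s : stopping g -> c <= s ->
  filtration s [set w | g w <= c].
Proof.
move=> [gT mg] cs; have [tc|ct] := leP t c; last first.
  rewrite (_ : [set _ | _] = set0); first exact: filtration0.
  apply/seteqP; split=> w //=; have /andP[tg _] := gT w.
  by move=> /(le_trans tg); rewrite leNgt ct.
have [cT|Tc] := leP c T.
  by apply: (filtration_mono cs); apply: mg; rewrite tc.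
rewrite (_ : [set _ | _] = setT); first exact: filtrationT.
apply/seteqP; split=> w //= _; have /andP[_ gTw] := gT w.
by rewrite (le_trans gTw)// ltW.
Qed.

Lemma stopping_adapted t (g : Om t -> R) : stopping g -> adapted T g.
Proof.
move=> sg c; have [cT|/ltW Tc] := leP c T; first exact: stopping_le.
rewrite (_ : [set _ | _] = setT); first exact: filtrationT.
apply/seteqP; split=> w //= _; have /andP[_ gTw] := sg.1 w.
by rewrite (le_trans gTw).
Qed.

Lemma stopping_measurable t (g : Om t -> R) : stopping g -> measurable_fun setT g.
Proof. by move/stopping_adapted/(adapted_measurableT (lexx _)). Qed.

Lemma stopping_cst t c : t <= c <= T -> @stopping R d T t (fun=> c).
Proof.
move=> tcT; split=> // s _; case: (boolP (c <= s)) => _.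
  by rewrite (_ : [set _ | _] = setT); [exact: filtrationT|exact/seteqP].
rewrite (_ : [set _ | _] = set0); first exact: filtration0.
by apply/seteqP; split.
Qed.

Lemma stopping_min t (g g' : Om t -> R) : stopping g -> stopping g' ->
  stopping (fun w => Num.min (g w) (g' w)).
Proof.
move=> [gT mg] [g'T mg']; split=> [w|s st].
  by rewrite le_min ge_min; have /andP[-> ->] := gT w; have /andP[-> _] := g'T w.
rewrite (_ : [set _ | _] = [set w | g w <= s] `|` [set w | g' w <= s]).
  by apply: filtrationU; [exact: mg|exact: mg'].
by apply/seteqP; split=> w /=; rewrite ge_min => /orP.
Qed.

Lemma stopping_max t (g g' : Om t -> R) : stopping g -> stopping g' ->
  stopping (fun w => Num.max (g w) (g' w)).
Proof.
move=> [gT mg] [g'T mg']; split=> [w|s st].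
  by rewrite le_max ge_max; have /andP[-> ->] := gT w; have /andP[_ ->] := g'T w.
rewrite (_ : [set _ | _] = [set w | g w <= s] `&` [set w | g' w <= s]).
  by apply: filtrationI; [exact: mg|exact: mg'].
by apply/seteqP; split=> w /=; rewrite ge_max => /andP.
Qed.

Lemma stopping_concat_max t s (g : Om t -> R) (w : Om t) :
  0 <= t -> t <= s <= T -> stopping g ->
  stopping (fun w' : Om s => Num.max (g (concat w w')) s).
Proof.
move=> t0 tsT sg; have /andP[ts sT] := tsT; split=> [w'|u /andP[su uT]].
  by rewrite le_max lexx orbT ge_max sT; have /andP[_ ->] := sg.1 (concat w w').
rewrite (_ : [set _ | _] = concat w @^-1` [set w' | g w' <= u]).
  by apply: filtration_concat => //; exact: stopping_le.
by apply/seteqP; split=> w' /=; rewrite ge_max su andbT.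
Qed.

Lemma stopping_concat t s (g : Om t -> R) (w : Om t) :
  0 <= t -> t <= s <= T -> stopping g -> (forall w', s <= g w') ->
  stopping (fun w' : Om s => g (concat w w')).
Proof.
move=> t0 tsT sg gs; have := stopping_concat_max w t0 tsT sg.
by under eq_fun do rewrite max_l//.
Qed.

Lemma stopping_tail t s (g : Om s -> R) : 0 <= t -> t <= s <= T ->
  stopping g -> stopping (g \o tail_path s : Om t -> R).
Proof.
move=> t0 tsT [gT mg]; have /andP[ts sT] := tsT.
split=> [w /=|u /andP[tu uT]].
  by have /andP[sg ->] := gT (tail_path s w); rewrite (le_trans ts).
have [su|us] := leP s u.
  rewrite (_ : [set _ | _] = tail_path s @^-1` [set w | g w <= u]) //.
  by apply: filtration_tail => //; apply: mg; rewrite su.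
rewrite (_ : [set _ | _] = set0); first exact: filtration0.
apply/seteqP; split=> w //=.
have /andP[sg _] := gT (tail_path s w).
by move=> /(le_trans sg); rewrite leNgt us.
Qed.

(* By Galmarino's test a stopping time cannot look past the time [s]. *)
Lemma stopping_min_eq t (g : Om t -> R) s (w w' : Om t) : stopping g ->
  (forall r, r <= s -> w r = w' r) -> Num.min (g w) s = Num.min (g w') s.
Proof.
move=> sg; suff H (w1 w2 : Om t) : (forall r, r <= s -> w1 r = w2 r) ->
    Num.min (g w1) s <= Num.min (g w2) s.
  by move=> ww'; apply/eqP; rewrite eq_le !H// => r rs; rewrite ww'.
move=> w12; rewrite le_min !ge_min lexx orbT andbT.
have [|gs] := leP s (g w2); rewrite ?orbT// orbF.
have agree r : r <= g w2 -> w1 r = w2 r by move=> rg; rewrite w12// (le_trans rg)// ltW.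
have [_ H] := galmarino (stopping_le sg (lexx (g w2))) agree.
exact: (H (lexx (g w2))).
Qed.

(** The range consists of the paths at seminorm distance 0 from [w] on [[t, s]], and a positive
    distance is an open condition. It allows a conditional law to be restricted to the continuations
    of [w]. *)
Lemma filtration_range t s (w : Om t) : 0 <= t -> t <= s <= T ->
  measurable (concat w @` [set: Om s]).
Proof.
move=> t0 tsT; have /andP[ts sT] := tsT.
rewrite concat_range//; apply: (filtration_measurable sT).
rewrite (_ : [set w1 : Om t | _] = ~` [set w1 : Om t | 0 < supnorm t s (w1 \- w)]); last first.
  apply/seteqP; split=> w1 /= H.
    apply/negP; rewrite -leNgt; apply: supnorm_le => // r.
    by rewrite in_itv/= => /andP[_ rs]; rewrite H// subrr enorm0.
  move=> r rs; apply/eqP; rewrite -subr_eq0; apply/eqP/enorm_eq0/eqP.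
  rewrite eq_le enorm_ge0 andbT; apply: le_trans (supnorm_path_le w1 w ts rs) _.
  by rewrite leNgt; exact/negP.
apply: filtrationC; apply: filtration_open; first by rewrite t0.
move=> w1 /= w10; exists (supnorm t s (w1 \- w)) => // w2 w12.
rewrite ltNge; apply/negP => w20.
move: w12; apply/negP; rewrite -leNgt; apply: supnorm_le; first exact: supnorm_ge0.
move=> r; rewrite in_itv/= => /andP[_ rs].
suff -> : w1 r - w r = w1 r - w2 r by rewrite enormB supnorm_path_le.
congr (_ - _); apply/esym/eqP; rewrite -subr_eq0; apply/eqP/enorm_eq0/eqP.
by rewrite eq_le enorm_ge0 andbT; apply: le_trans (supnorm_path_le w2 w ts rs) _.
Qed.

(** Switching between controls along the partition respects the filtration because none of them
    stops before [s]: below level [s] the event is empty, and from [s] on the cell is already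
    known. *)
Lemma stopping_paste t s n (A : nat -> set (Om t)) (G : nat -> Om t -> R) :
  0 <= t -> t <= s <= T ->
  (forall j, (j < n)%N -> filtration s (A j)) -> trivIset `I_n A ->
  \bigcup_(j < n) A j = setT ->
  (forall j, (j < n)%N -> stopping (G j)) -> (forall j v, (j < n)%N -> s <= G j v) ->
  exists g : Om t -> R, [/\ stopping g, forall v, s <= g v &
    forall j v, (j < n)%N -> A j v -> g v = G j v].
Proof.
move=> t0 /andP[ts sT] FA tA cA sG Gs.
have /choice[J JP] : forall v : Om t, exists j, (j < n)%N /\ A j v.
  by move=> v; have : setT v by []; rewrite -cA => -[j /= jn Ajv]; exists j.
have JE j v : (j < n)%N -> A j v -> J v = j.
  move=> jn Ajv; have [Jn AJ] := JP v.
  by apply: (tA (J v) j Jn jn); exists v.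
exists (fun v => G (J v) v); split.
- split=> [v|u /andP[tu uT]]; first by have [Jn _] := JP v; exact: (sG _ Jn).1.
  have [su|us] := leP s u; last first.
    rewrite (_ : [set _ | _] = set0); first exact: filtration0.
    apply/seteqP; split=> v //=; have [Jn _] := JP v.
    by move=> /(le_trans (Gs _ v Jn)); rewrite leNgt us.
  rewrite (_ : [set _ | _] = \bigcup_j (if (j < n)%N then
      A j `&` [set v | G j v <= u] else set0)).
    apply: filtration_bigcup => j; case: ifPn => jn; last exact: filtration0.
    apply: filtrationI; first by apply: (filtration_mono su); exact: FA.
    by apply: (sG _ jn).2; rewrite tu.
  apply/seteqP; split=> [v /= H|v [j _]].
    by have [Jn AJ] := JP v; exists (J v) => //; rewrite Jn.
  by case: ifPn => // jn [Ajv /=]; rewrite (JE j).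
- by move=> v; have [Jn _] := JP v; exact: Gs.
- by move=> j v jn Ajv; rewrite (JE j).
Qed.

Lemma adapted_rv t s (f : Om t -> R) c : s <= T -> adapted s f ->
  (forall v, `|f v| <= c) -> bounded_rv f.
Proof. by move=> sT af fc; split; [exact: adapted_measurableT af|exists c]. Qed.

(** Pushed forward by the identity to the path space equipped with F_s, both laws become the same
    measure. *)
Lemma Ex_sub_filtration t s (P Q : probability (Om t) R) (f : Om t -> R) :
  s <= T -> (forall A, filtration s A -> P A = Q A) -> bounded_rv f -> adapted s f ->
  Ex P f = Ex Q f.
Proof.
move=> sT PQ bf af; rewrite /Ex /Rintegral; congr fine.
pose S := g_sigma_algebraType (@cylinders R d T t s).
have mid : measurable_fun setT (idfun : Om t -> S).
  by move=> _ A mA; rewrite setTI; exact: filtration_measurable mA.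
have mf : measurable_fun setT (EFin \o f : S -> \bar R).
  by apply/measurable_EFinP; exact: adapted_measurable.
have E (P0 : probability (Om t) R) :
    (\int[P0]_x (f x)%:E = \int[pushforward P0 (idfun : Om t -> S)]_x (f x)%:E)%E.
  rewrite (integral_pushforward mid mf)//.
  exact: (bounded_rv_integrable P0 bf).
rewrite !E; apply: eq_measure_integral => A mA _; exact: PQ.
Qed.

Lemma supnorm_min_rv t s c : 0 <= t -> t <= s <= T -> 0 <= c ->
  bounded_rv (fun v : Om t => Num.min (supnorm t s v) c).
Proof.
move=> t0 /andP[ts sT] c0; apply: (@adapted_rv _ s _ c) => //; last first.
  by move=> v; rewrite ger0_norm ?le_min ?supnorm_ge0 ?c0// ge_min lexx orbT.
apply: continuous_adapted; first by rewrite t0.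
move=> v e e0; exists e => // v' vv'.
have H1 := supnorm_le_add v v' ts; have H2 := supnorm_le_add v' v ts.
have E : supnorm t s (v \- v') = supnorm t s (v' \- v).
  by congr sup; apply: eq_imagel => r _ /=; rewrite enormB.
rewrite E in H2; apply: min_dist_lt => //.
  by apply: le_lt_trans H1 _; rewrite ltrD2l.
by apply: le_lt_trans H2 _; rewrite ltrD2l.
Qed.

End adapted_theory.

(** * Moduli of continuity *)

Section modulus_theory.
Context (R : realType).

Lemma modulus_small (rho : R -> R) e : modulus rho -> 0 < e ->
  exists2 del, 0 < del & rho del <= e.
Proof.
move=> [rho_ge0 _ rho_cvg] e0.
have : \forall x \near 0^'+, `|0 - rho x| < e by move/cvgrPdist_lt: rho_cvg; exact.
move=> H; have [del [del0 Hdel]] : exists del : R, 0 < del /\ `|0 - rho del| < e.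
  near (0 : R)^'+ => del; exists del; split; first by near: del; exact: nbhs_right_gt.
  by near: del.
by exists del => //; move: Hdel; rewrite sub0r normrN => /ltW /(le_trans (ler_norm _)).
Unshelve. all: by end_near. Qed.

Lemma modulus_le (rho : R -> R) x y : modulus rho -> 0 <= x -> x <= y -> rho x <= rho y.
Proof. by case=> _ + _; exact. Qed.

(** For the identity, (P2) bounds the mean oscillation itself, which supports a Markov-type estimate
    of [z] at a random position. *)
Lemma power_modulus_id : power_modulus (@idfun R).
Proof.
split; first split=> //; first exact: cvg_at_right_filter.
exists 1, 1, 1; split=> // x x0; rewrite mul1r maxxx powRr1//.
Qed.

End modulus_theory.

(** * Continuous real functions and discrete telescoping *)

Section real_continuity.
Context (R : realType) (X : topologicalType).
Implicit Types f g : X -> R.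

Lemma continuous_rcst (c : R) : continuous (fun _ : X => c).
Proof. by move=> x; exact: cvg_cst. Qed.

Lemma continuous_rD f g : continuous f -> continuous g -> continuous (fun x => f x + g x).
Proof. by move=> cf cg x; apply: cvgD; [exact: cf|exact: cg]. Qed.

Lemma continuous_rB f g : continuous f -> continuous g -> continuous (fun x => f x - g x).
Proof. by move=> cf cg x; apply: cvgB; [exact: cf|exact: cg]. Qed.

Lemma continuous_rM f g : continuous f -> continuous g -> continuous (fun x => f x * g x).
Proof. by move=> cf cg x; apply: cvgM; [exact: cf|exact: cg]. Qed.

Lemma continuous_rmax f g : continuous f -> continuous g ->
  continuous (fun x => Num.max (f x) (g x)).
Proof. by move=> cf cg x; apply: continuous_max; [exact: cf|exact: cg]. Qed.

Lemma continuous_rmin f g : continuous f -> continuous g ->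
  continuous (fun x => Num.min (f x) (g x)).
Proof. by move=> cf cg x; apply: continuous_min; [exact: cf|exact: cg]. Qed.

Lemma continuous_rsum (I : Type) (l : seq I) (F : I -> X -> R) :
  (forall i, continuous (F i)) -> continuous (fun x => \sum_(i <- l) F i x).
Proof.
move=> cF; elim: l => [|i l IH].
  by under eq_fun do rewrite big_nil; exact: continuous_rcst.
by under eq_fun do rewrite big_cons; exact: continuous_rD.
Qed.

End real_continuity.

Lemma continuous_ballP (R : realType) (X : pseudoMetricType R) (f : X -> R) :
  (forall x e, 0 < e -> exists2 h, 0 < h & forall y, ball x h y -> `|f x - f y| <= e) ->
  continuous f.
Proof.
move=> H x; apply/cvgrPdist_le => e e0; have [h h0 Hh] := H x e e0.
by near=> y; apply: Hh; near: y; exact: nbhsx_ballx.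
Unshelve. all: by end_near. Qed.

(** Antitone flags hold exactly on an initial segment of indices, and the sum over it telescopes:
    the discrete form of stopping at index [k]. *)
Lemma telescope_antitone (V : zmodType) (a : nat -> V) (b : nat -> bool) m :
  (forall i, b i.+1 -> b i) ->
  exists k, [/\ (k <= m)%N, forall i, (i < m)%N -> b i = (i < k)%N &
    \sum_(i < m) (a i.+1 - a i) *+ b i = a k - a 0%N].
Proof.
move=> bS; elim: m => [|m [k [km bk sk]]].
  by exists 0%N; rewrite big_ord0 subrr.
rewrite big_ord_recr/= sk; have [bm|nbm] := boolP (b m).
  have kE : k = m.
    apply/eqP; rewrite eqn_leq km leqNgt; apply/negP => kltm.
    have : b k.
      have H j : b (k + j)%N -> b k by elim: j => [|j IH]; rewrite ?addn0// addnS => /bS.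
      by apply: (H (m - k)%N); rewrite subnKC// ltnW.
    by rewrite bk// ltnn.
  exists m.+1; split=> //; last by rewrite kE mulr1n addrC addrA subrK.
  move=> i im1; have := im1; rewrite ltnS leq_eqVlt => /predU1P[->|im].
    by rewrite bm eqxx.
  by rewrite bk// kE im orbT.
exists k; split; [exact: leqW| |by rewrite mulr0n addr0].
move=> i; rewrite ltnS leq_eqVlt => /predU1P[->|im]; last exact: bk.
by rewrite (negbTE nbm) ltnNge km.
Qed.

Lemma evaluation_continuous (R : realType) (S : Type) (f : S) (g : {ptws S -> R}) :
  (fun g' : {ptws S -> R} => g' f) x @[x --> g] --> g f.
Proof.
have /cvg_sup/(_ f)/cvg_image : g --> g by apply: cvg_id.
move=> h; apply: cvg_trans (h _) => {h}.
  by move=> Q /= [W nbdW <-]; apply: filterS nbdW; exact: preimage_image.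
by rewrite eqEsubset; split => y //; exists (fun=> y).
Qed.

(** * Arithmetic of the error terms *)

Section epsilon_arithmetic.
Context (F : realFieldType).
Implicit Types (a b c e g p q r x y : F).

Lemma eps_thirds a b x y e : a <= b + e / 3 -> x - e / 3 <= y -> y - e / 3 < a ->
  x - e <= b.
Proof. lra. Qed.

Lemma eps_quarters x g r e : x - e / 4 <= g -> r <= e / 4 -> x - e / 2 <= g - r.
Proof. lra. Qed.

Lemma eps_remainder m p q a b e : 0 <= m -> - m * p <= a -> b <= m * p -> p <= q ->
  2 * m * q < e -> b - e <= a.
Proof. nra. Qed.

Lemma eps_paste a b c x y e : 0 < e / 4 -> c - e / 2 <= b + x -> b - e / 4 <= a ->
  x <= y -> c - e <= a + y.
Proof. lra. Qed.

(** The hypotheses force [del * p <= 2 * eta], so the total loss is at most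
    [2 * eta + 2 * m * (2 * eta / del)]. The value of [eta] makes this equal to [e]. *)
Lemma eps_optimal m del e eta z0 a p y : 0 <= m -> 0 < del -> 0 <= p ->
  eta = e / (2 * (1 + 2 * m / del)) ->
  z0 - eta - eta <= y -> y <= a - del * p -> a <= z0 -> z0 - e <= a - 2 * m * p.
Proof.
move=> m0 del0 p0 etaE h1 h2 h3.
have k1 : 0 <= 2 * m / del by rewrite divr_ge0 ?mulr_ge0// ltW.
have k0 : 0 < 1 + 2 * m / del by lra.
have eE : e = 2 * eta * (1 + 2 * m / del).
  by rewrite etaE; move: (1 + _) k0 => k k0; field; rewrite gt_eqF.
have pE : 2 * m * p = 2 * m / del * (del * p).
  by rewrite mulrA divfK// gt_eqF.
have dp : del * p <= 2 * eta by lra.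
have := ler_wpM2l k1 dp; have : 0 <= del * p by rewrite mulr_ge0// ltW.
rewrite pE eE; move: (del * p) => q; move: (2 * m / del) k1 => k k1; nra.
Qed.

End epsilon_arithmetic.

(** * Regularity of the reward and of the Snell envelope *)

Section snell_theory.
Context (R : realType) (d : nat) (T : R).
Local Notation Om t := (Omega d T t).
Context (PP : forall t : R, set (probability (Om t) R)).
Context (Y : R -> Om 0 -> R) (wp : Om 0 -> R) (M kappa : R) (rho : R -> R).
Context (T_gt0 : 0 < T).
Context (PP_neq0 : forall t, 0 <= t <= T -> @PP t !=set0).
Context (osc_boundP : forall rho, power_modulus rho ->
  exists2 rhohat, power_modulus rhohat & osc_bound PP rho rhohat).
Context (YM : forall t w, 0 <= t <= T -> `|Y t w| <= M).
Context (rhoP : power_modulus rho).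
Context (Yrho : uniformly_continuous Y rho).
Context (wpP : stopping wp).
Context (kappa_gt0 : 0 < kappa).
Context (wp_lip : forall w w' : Om 0, `|wp w - wp w'| <= kappa * supnorm 0 T (w \- w')).

Let yh := Yhat Y wp.
Let rho_mod : modulus rho := rhoP.1.
Let T_ge0 : 0 <= T := ltW T_gt0.

Lemma Y_le_modulus (w1 w2 : Om 0) u1 u2 x y : 0 <= u1 <= T -> 0 <= u2 <= T ->
  0 <= x -> 0 <= y ->
  (forall r, enorm (w1 r - w2 r) <= x) ->
  (forall r, Num.min u1 u2 <= r <= Num.max u1 u2 ->
     enorm (w1 r - w1 (Num.min u1 u2)) <= y) ->
  `|Y u1 w1 - Y u2 w2| <= rho (`|u1 - u2| + (x + y)).
Proof.
move=> u1T u2T x0 y0 Hx Hy; apply: le_trans (Yrho w1 w2 u1T u2T) _.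
apply: modulus_le => //; first by rewrite addr_ge0// supnorm_ge0.
by rewrite lerD2l; exact: supnorm_stopped_le.
Qed.

Lemma wp_min_itv w t : 0 <= t <= T -> 0 <= Num.min (wp w) t <= T.
Proof.
move=> /andP[t0 tT]; have /andP[w0 _] := wpP.1 w.
by rewrite le_min w0 t0 ge_min tT orbT.
Qed.

Lemma Yhat_le t w : 0 <= t <= T -> `|yh t w| <= M.
Proof. by move=> tT; apply: YM; exact: wp_min_itv. Qed.

(** Galmarino's test fixes [Num.min (wp w) t], and the modulus of [Y] sees the paths only up to that
    time. *)
Lemma Yhat_local t (w w' : Om 0) : 0 <= t <= T -> (forall r, r <= t -> w r = w' r) ->
  yh t w = yh t w'.
Proof.
move=> tT ww'; have E := stopping_min_eq wpP ww'.
apply/eqP; rewrite -subr_eq0 -normr_le0; apply/ler_addgt0Pl => e e0; rewrite addr0.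
have [del del0] := modulus_small rho_mod e0; apply: le_trans.
rewrite /yh /Yhat E.
apply: le_trans (Yrho _ _ _ _) _; try exact: wp_min_itv.
rewrite subrr normr0 add0r; apply: modulus_le => //; first exact: supnorm_ge0.
apply: supnorm_le => [|r _]; first exact: ltW.
rewrite ww' ?subrr ?enorm0 ?(ltW del0)//.
by rewrite ge_min; apply/orP; right; rewrite ge_min lexx orbT.
Qed.

Lemma Yhat_continuous (w : Om 0) e : 0 < e -> exists2 h, 0 < h &
  forall (w' : Om 0) t t', 0 <= t <= T -> 0 <= t' <= T ->
    supnorm 0 T (w' \- w) <= h -> `|t - t'| <= h -> `|yh t w - yh t' w'| <= e.
Proof.
move=> e0; have [del del0 rdel] := modulus_small rho_mod e0.
have del4 : 0 < del / 4 by rewrite divr_gt0.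
have [h1 h10 osc] := path_unif_continuous w del4.
(* [kappa * h] bounds the change of [wp] and [h] that of [t]; together they are the largest time
   shift that the oscillation of [w] and the modulus tolerate. *)
pose h := Num.min h1 (del / 4) / (kappa + 1).
have k1 : 0 < kappa + 1 by rewrite addr_gt0.
have m0 : 0 < Num.min h1 (del / 4) by rewrite lt_min h10.
have h0 : 0 < h by rewrite divr_gt0.
have hk : kappa * h + h = Num.min h1 (del / 4).
  by rewrite /h -[X in _ + X]mul1r -mulrDl mulrC divfK// gt_eqF.
exists h => // w' t t' tT t'T ww' tt'.
set u1 := Num.min (wp w) t; set u2 := Num.min (wp w') t'.
have wsym r : enorm (w r - w' r) <= h.
  rewrite enormB; have [rT|/ltW Tr] := leP r T.
    exact: le_trans (supnorm_path_le w' w T_ge0 rT) ww'.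
  rewrite (path_eqT w Tr) (path_eqT w' Tr).
  exact: le_trans (supnorm_path_le w' w T_ge0 (lexx _)) ww'.
have u12 : `|u1 - u2| <= Num.min h1 (del / 4).
  rewrite -hk; apply: min_dist_le => //; [|by rewrite mulr_ge0 ?ltW|exact: ltW].
  by rewrite distrC (le_trans (wp_lip w' w))// ler_wpM2l// ltW.
have hdel : h <= del / 4.
  rewrite /h ler_pdivrMr// (le_trans (_ : _ <= del / 4)) ?ge_min ?lexx ?orbT//.
  by rewrite ler_peMr ?(ltW del4)// lerDr ltW.
apply: le_trans rdel.
apply: le_trans (@Y_le_modulus w w' u1 u2 h (del / 4) _ _ _ _ _ _) _ => //.
- exact: wp_min_itv.
- exact: wp_min_itv.
- exact: ltW.
- exact: ltW.
- move=> r /dist_min_max r12; apply: osc; apply: le_trans r12 (le_trans u12 _).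
  by rewrite ge_min lexx.
have : `|u1 - u2| <= del / 4 by move: u12; rewrite le_min => /andP[].
move=> u12'; apply: modulus_le => //; last lra.
by rewrite !addr_ge0// ltW.
Qed.

Lemma Yhat_adapted t : 0 <= t <= T -> adapted t (yh t).
Proof.
move=> tT; have /andP[t0 tT'] := tT; apply: continuous_adapted; first by rewrite lexx t0.
move=> w e e0; have e2 : 0 < e / 2 by rewrite divr_gt0.
(* Freezing the paths after [t] does not alter [yh t], and it reduces the distance on [[0, T]] to
   the distance on [[0, t]]. *)
have [h h0 H] := Yhat_continuous (concat w (point : Om t)) e2.
exists h => // w' w'w.
have E w1 : yh t w1 = yh t (concat w1 (point : Om t)).
  by apply: Yhat_local => // r rt; rewrite concat_le.
rewrite distrC E (E w'); apply: (@le_lt_trans _ _ (e / 2)); last by lra.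
apply: H => //; last by rewrite subrr normr0 ltW.
exact: le_trans (supnorm_concat_le _ _ _ tT) (ltW w'w).
Qed.

Lemma Yhat_stopped_measurable t (w : Om 0) (g : Om t -> R) : 0 <= t <= T -> stopping g ->
  bounded_rv (fun v : Om t => yh (g v) (concat w v)).
Proof.
move=> tT sg; have /andP[t0 tT'] := tT; split; last first.
  by exists M => v; apply: Yhat_le; have /andP[/(le_trans t0) -> ->] := sg.1 v.
apply: (@measurable_fun_comp_grid _ _ _ (fun r v => yh r (concat w v)) g t T) => //.
- move=> r /andP[tr rT]; apply: (@adapted_measurableT _ _ _ _ r) => //.
  by apply: adapted_comp_concat => //; apply: Yhat_adapted; rewrite (le_trans t0).
- exact: stopping_measurable.
- exact: sg.1.
- move=> v r e /andP[tr rT] e0; have e2 : 0 < e / 2 by rewrite divr_gt0.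
  have [h h0 H] := Yhat_continuous (concat w v) e2; exists h => // r' /andP[tr' r'T] rr'.
  apply: (@le_lt_trans _ _ (e / 2)); last by lra.
  apply: H; rewrite ?(le_trans t0)//; last exact: ltW.
  by rewrite supnorm_diag ltW.
Qed.

(* The case t = T is not covered by the oscillation bound, but Omega^T is a
   singleton. *)
Lemma Ex_osc_small (rho' : R -> R) e : power_modulus rho' -> 0 < e ->
  exists2 del, 0 < del & forall t (P : probability (Om t) R) (zeta f : Om t -> R),
    0 <= t <= T -> PP P -> stopping zeta -> bounded_rv f ->
    (forall v, `|f v| <= rho' (del + supnorm (zeta v) (Num.min (zeta v + del) T)
                                   (fun r => v r - v (zeta v)))) ->
    Ex P (fun v => `|f v|) <= e.
Proof.
move=> rho'P e0; have [rhohat rhohatP Hosc] := osc_boundP rho'P.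
have [d1 d10 rd1] := modulus_small rhohatP.1 e0.
have [d2 d20 rd2] := modulus_small rho'P.1 e0.
exists (Num.min d1 d2); first by rewrite lt_min d10.
have m0 : 0 < Num.min d1 d2 by rewrite lt_min d10.
move=> t P zeta f /andP[t0]; rewrite le_eqVlt => /predU1P[tT|tT] PPP szeta bf Hf.
  apply: Ex_le_cst; first exact: bounded_rv_norm.
  move=> v; apply: le_trans (Hf v) _; apply: le_trans rd2.
  apply: modulus_le; [exact: rho'P.1|by rewrite addr_ge0 ?supnorm_ge0 ?ltW|].
  apply: (@le_trans _ _ (Num.min d1 d2)); last by rewrite ge_min lexx orbT.
  rewrite gerDl; apply: supnorm_le => // r _.
  suff vz r' : v r' = 0 by rewrite !vz subrr enorm0.
  have [r'T|/ltW Tr'] := leP r' T; first by rewrite path_eq0// tT.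
  by rewrite (path_eqT v Tr') path_eq0// tT.
apply: (Ex_norm_le_integral bf Hf).
have := Hosc t (Num.min d1 d2); rewrite t0 tT => /(_ isT m0).
move=> H.
have HP : ('E_P[fun v : Om t => (rho' (Num.min d1 d2 + supnorm (zeta v)
    (Num.min (zeta v + Num.min d1 d2) T) (fun r => v r - v (zeta v))))%R]
    <= (rhohat (Num.min d1 d2))%:E)%E.
  by apply: le_trans H; apply: ereal_sup_ubound; exists P => //; exists zeta.
rewrite unlock in HP; apply: le_trans HP _.
rewrite lee_fin (le_trans _ rd1)//; apply: modulus_le; [exact: rhohatP.1|exact: ltW|].
by rewrite ge_min lexx.
Qed.

Definition gain t (w : Om 0) (P : probability (Om t) R) (g : Om t -> R) : R :=
  Ex P (fun v => yh (g v) (concat w v)).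

(** The radius depends on [w] alone, not on [t], the law or the stopping times, so suprema over laws
    and controls inherit the estimate. The oscillation of the past is controlled by uniform
    continuity of [w], that of the random future by (P2). *)
Lemma gain_equicontinuous (w : Om 0) e : 0 < e -> exists2 h, 0 < h &
  forall (w' : Om 0) t (P : probability (Om t) R) (g1 g2 : Om t -> R),
    0 <= t <= T -> PP P -> stopping g1 -> stopping g2 ->
    supnorm 0 t (w' \- w) <= h -> (forall v, `|g1 v - g2 v| <= h) ->
    `|gain w P g1 - gain w' P g2| <= e.
Proof.
move=> e0; have [del del0 HEx] := Ex_osc_small rhoP e0.
have del4 : 0 < del / 4 by rewrite divr_gt0.
have [h1 h10 osc] := path_unif_continuous w del4.
pose h2 := Num.min h1 (del / 4).
pose h := h2 / (kappa + 1).
have k1 : 0 < kappa + 1 by rewrite addr_gt0.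
have m0 : 0 < h2 by rewrite lt_min h10.
have h0 : 0 < h by rewrite divr_gt0.
have hk : kappa * h + h = h2.
  by rewrite /h -[X in _ + X]mul1r -mulrDl mulrC divfK// gt_eqF.
have h2del : h2 <= del / 4 by rewrite ge_min lexx orbT.
have hdel : h <= del / 4.
  rewrite /h ler_pdivrMr// (le_trans h2del)//.
  by rewrite ler_peMr ?(ltW del4)// lerDr ltW.
exists h => // w' t P g1 g2 tT PPP sg1 sg2 ww' g12.
have /andP[t0 tT'] := tT.
pose u1 v := Num.min (wp (concat w v)) (g1 v).
pose u2 v := Num.min (wp (concat w' v)) (g2 v).
(* The earlier of the two evaluation times, raised to [t], since before [t] the path is the
   deterministic [w]. *)
pose zeta v := Num.max (Num.min (u1 v) (u2 v)) t.
have b1 := Yhat_stopped_measurable w tT sg1.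
have b2 := Yhat_stopped_measurable w' tT sg2.
have szeta : stopping zeta.
  pose a1 (v : Om t) := Num.max (wp (concat w v)) t.
  pose a2 (v : Om t) := Num.max (wp (concat w' v)) t.
  (* As [g1] and [g2] are at least [t], the maximum with [t] only affects the shifted [wp], which
     might otherwise fall before [t]. *)
  have -> : zeta = fun v => Num.min (Num.min (a1 v) (g1 v)) (Num.min (a2 v) (g2 v)).
    apply/funext => v; rewrite /zeta /u1 /u2 /a1 /a2.
    have /andP[tg1 _] := sg1.1 v; have /andP[tg2 _] := sg2.1 v.
    by rewrite !max_minl (max_l tg1) (max_l tg2).
  by do 2 apply: stopping_min => //; apply: stopping_concat_max.
rewrite /gain -ExB//; apply: le_trans (Ex_norm _ (bounded_rvB b1 b2)) _.
apply: (HEx t P zeta) => //; first exact: bounded_rvB.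
move=> v; set s := supnorm _ _ _.
have u1T : 0 <= u1 v <= T.
  by apply: wp_min_itv; have /andP[/(le_trans t0) -> ->] := sg1.1 v.
have u2T : 0 <= u2 v <= T.
  by apply: wp_min_itv; have /andP[/(le_trans t0) -> ->] := sg2.1 v.
have cw r : enorm (concat w v r - concat w' v r) <= h.
  rewrite !concat_min// opprD addrACA subrr addr0 enormB.
  by apply: le_trans ww'; apply: supnorm_path_le => //; rewrite ge_min lexx orbT.
have u12 : `|u1 v - u2 v| <= h2.
  rewrite -hk; apply: min_dist_le => //; [|by rewrite mulr_ge0 ?ltW|exact: ltW].
  rewrite distrC; apply: le_trans (wp_lip _ _) _; apply: ler_wpM2l; first exact: ltW.
  by apply: le_trans ww'; exact: supnorm_concat_le.
have s0 : 0 <= s by exact: supnorm_ge0.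
apply: le_trans (@Y_le_modulus (concat w v) (concat w' v) (u1 v) (u2 v) h (del / 4 + s) _ _ _ _ _ _) _ => //.
- exact: ltW.
- by rewrite addr_ge0// ltW.
- move=> r r12; have rd := le_trans (dist_min_max r12) u12.
  have /andP[r1 r2] := r12.
  have aT : Num.min (u1 v) (u2 v) <= T by rewrite ge_min; have /andP[_ ->] := u1T.
  have osc2 r1' r2' : `|r1' - r2'| <= h2 -> enorm (w r1' - w r2') <= del / 4.
    by move=> hr; apply: osc; apply: le_trans hr _; rewrite ge_min lexx.
  apply: le_trans (@concat_osc_le _ _ _ 0 t w v h2 (del / 4) (Num.min (u1 v) (u2 v)) r tT _ aT osc2 _) _.
  + exact: ltW.
  + by rewrite r1/= -lerBlDl; move: rd; rewrite ger0_norm// subr_ge0.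
  + rewrite lerD2l; apply: supnorm_mono; last exact: tail_continuous.
      by rewrite le_min lerDl (ltW m0)/= ge_max aT.
    rewrite le_min; apply/andP; split; last by rewrite ge_min lexx orbT.
    rewrite ge_min lerD2l; apply/orP; left; apply: le_trans h2del _.
    by rewrite ler_pdivrMr// ler_peMr ?ler1n// ltW.
apply: modulus_le => //; first by rewrite !addr_ge0// ltW.
lra.
Qed.

(* The Snell envelope as a real number; [snell] is finite on [0, T]. *)
Definition z t (w : Om 0) : R := fine (snell PP Y wp t w).

Lemma gainE t (w : Om 0) (P : probability (Om t) R) (g : Om t -> R) : 0 <= t <= T ->
  stopping g -> ('E_P[sample (shift_process (Yhat Y wp) w) g] = (gain w P g)%:E)%E.
Proof.
move=> tT sg; rewrite unlock /gain -Ex_EFin//; exact: Yhat_stopped_measurable.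
Qed.

Lemma gain_le t (w : Om 0) (P : probability (Om t) R) (g : Om t -> R) : 0 <= t <= T ->
  stopping g -> `|gain w P g| <= M.
Proof.
move=> tT sg; apply: Ex_norm_le; first exact: Yhat_stopped_measurable.
move=> v; apply: Yhat_le; have /andP[t0 _] := tT.
by have /andP[/(le_trans t0) -> ->] := sg.1 v.
Qed.

Lemma snellE t w : 0 <= t <= T -> snell PP Y wp t w = (z t w)%:E.
Proof.
move=> tT; rewrite /z fineK// fin_numElt; apply/andP; split.
  have [P PPP] := PP_neq0 tT; have /andP[t0 tT'] := tT.
  have sg : @stopping R d T t (fun=> T) by apply: stopping_cst; rewrite tT' lexx.
  apply: (@lt_le_trans _ _ (gain w P (fun=> T))%:E); first exact: ltNyr.
  by rewrite -gainE//; apply: ereal_sup_ubound; exists P => //; exists (fun=> T).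
apply: (@le_lt_trans _ _ M%:E); last exact: ltry.
apply: ge_ereal_sup => _ [P PPP [g sg <-]]; rewrite gainE// lee_fin.
exact: le_trans (ler_norm _) (gain_le _ _ _ _).
Qed.

Lemma gain_le_z t w (P : probability (Om t) R) (g : Om t -> R) : 0 <= t <= T ->
  PP P -> stopping g -> gain w P g <= z t w.
Proof.
move=> tT PPP sg; rewrite -lee_fin -gainE// -snellE//.
by apply: ereal_sup_ubound; exists P => //; exists g.
Qed.

Lemma z_approx t w e : 0 <= t <= T -> 0 < e ->
  exists P, exists g : Om t -> R, [/\ PP P, stopping g & z t w - e < gain w P g].
Proof.
move=> tT e0; have /ereal_sup_gt : ((z t w - e)%:E < snell PP Y wp t w)%E.
  by rewrite snellE// lte_fin ltrBlDr ltrDl.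
case=> _ [P PPP [g sg <-]]; rewrite gainE// lte_fin => H.
by exists P, g.
Qed.

Lemma z_ub t w c : 0 <= t <= T ->
  (forall P (g : Om t -> R), PP P -> stopping g -> gain w P g <= c) -> z t w <= c.
Proof.
move=> tT H; apply/ler_addgt0Pl => e e0.
have [P [g [PPP sg zg]]] := z_approx w tT e0.
by have := H P g PPP sg; lra.
Qed.

Lemma z_le t w : 0 <= t <= T -> `|z t w| <= M.
Proof.
move=> tT; rewrite ler_norml; apply/andP; split.
  have [P PPP] := PP_neq0 tT; have /andP[t0 tT'] := tT.
  have sg : @stopping R d T t (fun=> T) by apply: stopping_cst; rewrite tT' lexx.
  apply: le_trans (gain_le_z w tT PPP sg).
  by have := gain_le w P tT sg; rewrite ler_norml => /andP[].
apply: z_ub => // P g PPP sg.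
exact: le_trans (ler_norm _) (gain_le _ _ _ _).
Qed.

Lemma z_equicontinuous (w : Om 0) e : 0 < e -> exists2 h, 0 < h &
  forall (w' : Om 0) t, 0 <= t <= T -> supnorm 0 t (w' \- w) <= h ->
    `|z t w - z t w'| <= e.
Proof.
move=> e0; have [h h0 H] := gain_equicontinuous w e0.
exists h => // w' t tT ww'.
have Hg P (g : Om t -> R) : PP P -> stopping g -> `|gain w P g - gain w' P g| <= e.
  by move=> PPP sg; apply: H => // v; rewrite subrr normr0 ltW.
have H1 : z t w <= z t w' + e.
  apply: z_ub => // P g PPP sg; have := gain_le_z w' tT PPP sg.
  have := Hg P g PPP sg; rewrite ler_distl => /andP[_ Hd] Hz.
  by apply: le_trans Hd _; rewrite lerD2r.
have H2 : z t w' <= z t w + e.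
  apply: z_ub => // P g PPP sg; have := gain_le_z w tT PPP sg.
  have := Hg P g PPP sg; rewrite distrC ler_distl => /andP[_ Hd] Hz.
  by apply: le_trans Hd _; rewrite lerD2r.
by rewrite ler_distl H1 lerBlDr H2.
Qed.

Lemma z_local t (w w' : Om 0) : 0 <= t <= T -> (forall r, r <= t -> w r = w' r) ->
  z t w = z t w'.
Proof.
move=> tT ww'; apply/eqP; rewrite -subr_eq0 -normr_le0; apply/ler_addgt0Pl => e e0.
rewrite addr0; have [h h0 H] := z_equicontinuous w e0; apply: H => //.
apply: supnorm_le => [|r]; first exact: ltW.
by rewrite in_itv/= => /andP[_ rt]; rewrite ww'// subrr enorm0 ltW.
Qed.

Lemma z_adapted t : 0 <= t <= T -> adapted t (z t).
Proof.
move=> tT; have /andP[t0 tT'] := tT; apply: continuous_adapted; first by rewrite lexx t0.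
move=> w e e0; have e2 : 0 < e / 2 by rewrite divr_gt0.
have [h h0 H] := z_equicontinuous w e2; exists h => // w' w'w.
rewrite distrC; apply: (@le_lt_trans _ _ (e / 2)); last by lra.
by apply: H => //; exact: ltW.
Qed.

Lemma z_concat_rv t s (w : Om 0) : 0 <= t -> t <= s <= T ->
  bounded_rv (fun v : Om t => z s (concat w v)).
Proof.
move=> t0 tsT; have /andP[ts sT] := tsT; have sT' : 0 <= s <= T by rewrite sT (le_trans t0).
split; last by exists M => v; exact: z_le.
apply: (@adapted_measurableT _ _ _ _ s) => //.
apply: adapted_comp_concat => //; last exact: z_adapted.
by rewrite t0 (le_trans ts).
Qed.

Lemma gain_cst t (w : Om 0) (P : probability (Om t) R) : 0 <= t <= T -> gain w P (fun=> t) = yh t w.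
Proof.
move=> tT; rewrite /gain -[RHS](Ex_cst P); congr (Ex P _); apply/funext => v.
by apply: Yhat_local => // r rt; rewrite concat_le.
Qed.

Lemma Yhat_le_z t w : 0 <= t <= T -> yh t w <= z t w.
Proof.
move=> tT; have [P PPP] := PP_neq0 tT; have /andP[t0 tT'] := tT.
rewrite -(gain_cst w P tT); apply: gain_le_z => //.
by apply: stopping_cst; rewrite lexx.
Qed.

Lemma z_T w : z T w = yh T w.
Proof.
have TT : 0 <= T <= T by rewrite T_ge0 lexx.
apply/eqP; rewrite eq_le Yhat_le_z// andbT; apply: z_ub => // P g PPP sg.
suff -> : g = fun=> T by rewrite gain_cst.
by apply/funext => v; apply/eqP; rewrite eq_le andbC; exact: sg.1.
Qed.

(** * Dynamic programming *)

Context (P3 : condP3 PP).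

(* The layer cake formula reduces the disintegration of [P], which is given on
   sets, to finite sums. *)
Lemma snell_upper t s (P : probability (Om t) R) (w : Om 0) (g : Om t -> R) (A : set (Om t)) :
  0 <= t -> t < s -> s <= T -> PP P -> stopping g -> (forall v, s <= g v) ->
  filtration s A ->
  Ex P (fun v => \1_A v * yh (g v) (concat w v))
    <= Ex P (fun v => \1_A v * z s (concat w v)).
Proof.
move=> t0 ts sT PPP sg gs FA; have tsT : t <= s <= T by rewrite ltW.
have tT : 0 <= t <= T by rewrite t0 (le_trans (ltW ts)).
have sT0 : 0 <= s <= T by rewrite (le_trans t0 (ltW ts)).
have mA : measurable A by exact: filtration_measurable FA.
have b1A := bounded_rv_indic R mA.
have [kap [rc rr] [F' [P' [Om' [_ [FF' PP'] FOm' POm' H]]]]] := P3 t0 ts sT PPP.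
have bxi := Yhat_stopped_measurable w tT sg.
have bz := z_concat_rv w t0 tsT.
(* The affine map [sc] below sends [[- M1, M1]] onto [[0, 1]], the range required by [layer_cake];
   the added 1 keeps its denominator positive. *)
pose M1 := `|M| + 1.
have M1_gt0 : 0 < M1 by rewrite ltr_wpDl.
have M1_ge : M <= M1 by rewrite (le_trans (ler_norm _))// lerDl.
pose sc (x : R) := (x + M1) / (2 * M1).
have sc_bound x : `|x| <= M -> 0 <= sc x <= 1.
  move=> /le_trans/(_ M1_ge); rewrite ler_norml => /andP[x1 x2].
  apply/andP; split; first by rewrite divr_ge0 ?mulr_ge0 ?(ltW M1_gt0)//; lra.
  rewrite /sc ler_pdivrMr ?mulr_gt0// mul1r; lra.
have sc_le x y : (sc x <= sc y) = (x <= y).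
  by rewrite /sc ler_pM2r ?invr_gt0 ?mulr_gt0// lerD2r.
have bsc (dd : measure_display) (X : measurableType dd) (f : X -> R) :
    bounded_rv f -> bounded_rv (fun x => sc (f x)).
  move=> bf; apply: bounded_rvM; last exact: bounded_rv_cst.
  by apply: bounded_rvD => //; exact: bounded_rv_cst.
have Esc (dd : measure_display) (X : measurableType dd) (Q : probability X R) (f : X -> R) :
    bounded_rv f -> Ex Q (fun x => sc (f x)) = sc (Ex Q f).
  move=> bf; transitivity (Ex Q (fun x => (2 * M1)^-1 * (f x + M1))).
    by congr (Ex Q _); apply/funext => x; rewrite /sc mulrC.
  rewrite ExZ; last by apply: bounded_rvD => //; exact: bounded_rv_cst.
  by rewrite ExD ?Ex_cst 1?mulrC//; exact: bounded_rv_cst.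
pose xi v := sc (yh (g v) (concat w v)).
have yM v : `|yh (g v) (concat w v)| <= M.
  by apply: Yhat_le; have /andP[/(le_trans t0) -> ->] := sg.1 v.
suff main : Ex P (fun v => \1_A v * xi v) <= Ex P (fun v => \1_A v * sc (z s (concat w v))).
  have E f : bounded_rv f -> Ex P (fun v => \1_A v * sc (f v)) =
      (2 * M1)^-1 * Ex P (fun v => \1_A v * f v) + (2 * M1)^-1 * M1 * Ex P \1_A.
    move=> bf; rewrite -!ExZ//; last exact: bounded_rvM.
    rewrite -ExD//; last 2 first.
    - by apply: bounded_rvM; [exact: bounded_rv_cst|exact: bounded_rvM].
    - by apply: bounded_rvM => //; exact: bounded_rv_cst.
    by congr (Ex P _); apply/funext => v; rewrite /sc; ring.
  move: main; rewrite /xi !E// lerD2r ler_pM2l// invr_gt0 mulr_gt0//.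
apply/ler_addgt0Pl => e e0.
have [K KP] : exists K : nat, K.+1%:R^-1 < e.
  have [k _ kP] := @near_infty_natSinv_lt R (PosNum e0).
  by exists k; apply: (kP k) => /=.
pose B (k : 'I_K.+1) := [set v | k.+1%:R / K.+1%:R <= xi v].
have mB k : measurable (B k) by apply: measurable_ge_set; case: (bsc _ _ _ bxi).
pose S (x : R) := K.+1%:R^-1 * \sum_(k < K.+1) (k.+1%:R / K.+1%:R <= x :> R)%:R : R.
have SB v : S (xi v) = K.+1%:R^-1 * \sum_(k < K.+1) \1_(B k) v.
  rewrite /S; congr (_ * _); apply: eq_bigr => k _; rewrite indicE /B.
  by congr ((nat_of_bool _)%:R); apply/idP/idP; rewrite inE.
(* [kap v] charges only continuations of [v], so [B k] can be replaced by its trace on them, where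
   [Q] and [kap v] are related. *)
have kappa_le k v : Om' v -> forall Q : probability (Om s) R,
    (forall A, measurable A -> Q A = kap v (concat v @` A)) ->
    kap v (B k) = Q (concat v @^-1` B k).
  move=> Ov Q HQ; have mR := filtration_range v t0 tsT.
  rewrite (measure_full_restrict (mB k) mR) ?prob_kernel//.
  rewrite HQ; last first.
    apply: (filtration_concat v t0 tsT sT).
    exact: mB.
  congr (kap v _); apply/seteqP; split=> [v1 [Bv1 [v2 _ v12]]|v1 [v2 Bv2 <-]].
    by exists v2 => //=; rewrite v12.
  by split=> //; exists v2.
pose phi k (v : Om t) := fine (kap v (B k)).
have kap01 (v : Om t) C : measurable C -> (0 <= kap v C <= 1)%E.
  move=> mC; rewrite measure_ge0/= -(@prob_kernel _ _ _ _ _ kap v).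
  by apply: le_measure; rewrite ?inE.
have bphi k : bounded_rv (phi k).
  split; last first.
    exists 1 => v; have /andP[k0 k1] := kap01 v _ (mB k).
    rewrite /phi ger0_norm ?fine_ge0//.
    by rewrite -lee_fin fineK// ge0_fin_numE// (le_lt_trans k1)// ltry.
  apply: (adapted_measurableT sT); apply: measurable_adapted.
  apply: (measurableT_comp (fine_measurable measurableT)).
  exact: (measurable_kernel kap).
have Ephi k : Ex P (fun v => \1_A v * phi k v) = fine (P (A `&` B k)).
  rewrite -[LHS]/(fine (Ex P (fun v => \1_A v * phi k v))%:E) -Ex_restrict//.
  congr fine; rewrite setIC -(rc _ _ (mB k) FA); apply: eq_integral => v _.
  have /andP[k0 k1] := kap01 v _ (mB k).
  by rewrite /phi fineK// ge0_fin_numE// (le_lt_trans k1)// ltry.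
have b1B k : bounded_rv (\1_(B k) : Om t -> R) by apply: bounded_rv_indic.
have bSphi : bounded_rv (fun v => K.+1%:R^-1 * \sum_(k < K.+1) phi k v).
  by apply: bounded_rvM; [exact: bounded_rv_cst|exact: bounded_rv_sum].
have bSB : bounded_rv (fun v => K.+1%:R^-1 * \sum_(k < K.+1) \1_(B k) v : R).
  by apply: bounded_rvM; [exact: bounded_rv_cst|exact: bounded_rv_sum].
have step1 : Ex P (fun v => \1_A v * xi v) <=
    K.+1%:R^-1 + Ex P (fun v => \1_A v * (K.+1%:R^-1 * \sum_(k < K.+1) \1_(B k) v)).
  rewrite -{1}(Ex_cst P K.+1%:R^-1) -ExD; [|exact: bounded_rv_cst|exact: bounded_rvM].
  apply: Ex_le; [by apply: bounded_rvM => //; exact: bsc| |].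
    by apply: bounded_rvD; [exact: bounded_rv_cst|exact: bounded_rvM].
  move=> v; rewrite -SB; have /andP[_ +] := layer_cake K (sc_bound _ (yM v)).
  rewrite -/(S _) -/(xi v) indicE; case: (v \in A); rewrite ?mul1r ?mul0r ?addr0//.
  by rewrite addrC.
have step2 : Ex P (fun v => \1_A v * (K.+1%:R^-1 * \sum_(k < K.+1) \1_(B k) v)) =
    Ex P (fun v => \1_A v * (K.+1%:R^-1 * \sum_(k < K.+1) phi k v)).
  have E (f : 'I_K.+1 -> Om t -> R) : (forall k, bounded_rv (f k)) ->
      Ex P (fun v => \1_A v * (K.+1%:R^-1 * \sum_(k < K.+1) f k v)) =
      K.+1%:R^-1 * \sum_(k < K.+1) Ex P (fun v => \1_A v * f k v).
    move=> bf; rewrite -Ex_sum; last by move=> k; exact: bounded_rvM.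
    rewrite -ExZ; last by apply: bounded_rv_sum => k; exact: bounded_rvM.
    by congr (Ex P _); apply/funext => v; rewrite mulrCA mulr_sumr.
  rewrite !E//; congr (_ * _); apply: eq_bigr => k _.
  rewrite Ephi -Ex_indic; last exact: measurableI.
  by congr (Ex P _); apply/funext => v; rewrite indicI.
have step3 : Ex P (fun v => \1_A v * (K.+1%:R^-1 * \sum_(k < K.+1) phi k v)) <=
    Ex P (fun v => \1_A v * sc (z s (concat w v))).
  apply: Ex_le_ae; [exact: bounded_rvM|by apply: bounded_rvM => //; exact: bsc|].
  set C := [set v | _].
  have mC : measurable C.
    rewrite /C (_ : [set _ | _] = [set v | \1_A v * (K.+1%:R^-1 * \sum_(k < K.+1) phi k v)
       - \1_A v * sc (z s (concat w v)) <= 0]); last first.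
      by apply/seteqP; split=> v /=; rewrite subr_le0.
    apply: measurable_le_set; apply: (bounded_rv_measurable (bounded_rvB _ _)).
      exact: bounded_rvM.
    by apply: bounded_rvM => //; exact: bsc.
  (* [Om'] is measurable only in the extension. The set [C], which lies in F_T, contains it, so full
     mass passes from [Om'] under [P'] to [C] under [P]. *)
  apply/eqP; rewrite eq_le probability_le1//= -(PP' _ mC) -POm'.
  have FC : F' C by exact: FF'.
  apply: le_measure; rewrite ?inE//; try by apply: sub_sigma_algebra.
  move=> v Ov; rewrite /C /= indicE; case: (v \in A); rewrite ?mul1r ?mul0r//.
  have [Q PQ HQ] := H v Ov.
  have sgv : stopping (fun v' : Om s => g (concat v v')) by exact: stopping_concat.
  have bc (f : Om t -> R) : bounded_rv f -> bounded_rv (fun v' : Om s => f (concat v v')).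
    move=> [mf [C1 fC1]]; split; last by exists C1.
    apply: (adapted_measurableT (lexx T)); apply: adapted_comp_concat => //.
    exact: measurable_adapted mf.
  have -> : K.+1%:R^-1 * \sum_(k < K.+1) phi k v = Ex Q (fun v' => S (xi (concat v v'))).
    under [in RHS]eq_fun do rewrite SB.
    rewrite ExZ; last by apply: bounded_rv_sum => k; exact: (bc (\1_(B k))).
    rewrite (Ex_sum _ _ (fun k => bc _ (b1B k))); congr (_ * _); apply: eq_bigr => k _.
    rewrite /phi (kappa_le k v Ov Q HQ) -Ex_indic.
      by congr (Ex Q _); apply/funext => v'; rewrite !indicE; congr ((nat_of_bool _)%:R); apply/idP/idP; rewrite !inE.
    apply: (filtration_concat v t0 tsT sT); exact: mB.
  apply: (@le_trans _ _ (Ex Q (fun v' => xi (concat v v')))).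
    apply: Ex_le; [|exact: (bc xi (bsc _ _ _ bxi))|].
      by under eq_fun do rewrite SB; exact: (bc _ bSB).
    by move=> v'; have /andP[+ _] := layer_cake K (sc_bound _ (yM (concat v v'))).
  have gb := Yhat_stopped_measurable (concat w v) sT0 sgv.
  have -> : Ex Q (fun v' => xi (concat v v')) = sc (gain (concat w v) Q (fun v' => g (concat v v'))).
    rewrite /gain -Esc//; congr (Ex Q _); apply/funext => v'.
    by rewrite /xi concatA// ltW.
  by rewrite sc_le; apply: gain_le_z.
rewrite (le_trans step1)// step2 lerD// ltW//.
Qed.

Context (P4 : condP4 PP) (Ywp : frakS Y wp).

Lemma gain_adapted s (Q : probability (Om s) R) (g : Om s -> R) :
  0 <= s <= T -> PP Q -> stopping g -> adapted s (fun w : Om 0 => gain w Q g).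
Proof.
move=> sT PQ sg; have /andP[s0 sT'] := sT.
apply: continuous_adapted; first by rewrite lexx s0.
move=> w e e0; have e2 : 0 < e / 2 by rewrite divr_gt0.
have [h h0 H] := gain_equicontinuous w e2; exists h => // w' w'w.
rewrite distrC; apply: (@le_lt_trans _ _ (e / 2)); last by rewrite ltr_pdivrMr// ltr_pMr// ltr1n.
by apply: H => //; [exact: ltW|move=> v; rewrite subrr normr0 ltW].
Qed.

(* Near-optimal controls on a countable cover by balls small enough for
   equicontinuity. The radius depends on the centre, since the modulus of [gain] at
   [w] depends on the oscillation of [w]. *)
Lemma countable_good_tubes t s (w : Om 0) e del : 0 <= t -> t <= s <= T -> 0 < e -> 0 < del ->
  exists (B : nat -> set (Om t)) (q : nat -> rat) (c : nat -> Om t)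
    (Q : nat -> probability (Om s) R) (gam : nat -> Om s -> R),
  [/\ forall n, filtration s (B n), \bigcup_n B n = setT,
      forall n, 0 < (ratr (q n) : R) <= del,
      forall n, B n `<=` near_path s (ratr (q n)) (c n) &
      forall n, [/\ PP (Q n), stopping (gam n) & forall v, B n v ->
        z s (concat w v) - e <= gain (concat w v) (Q n) (gam n)]].
Proof.
move=> t0 tsT e0 del0; have /andP[ts sT] := tsT.
have sT0 : 0 <= s <= T by rewrite (le_trans t0 ts).
have e3 : 0 < e / 3 by rewrite divr_gt0.
have /choice[qQ HqQ] : forall v : Om t, exists x : rat * probability (Om s) R * (Om s -> R),
    [/\ 0 < (ratr x.1.1 : R) <= del, PP x.1.2, stopping x.2 &
    forall v', near_path s (ratr x.1.1) v v' ->
      z s (concat w v') - e <= gain (concat w v') x.1.2 x.2].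
  move=> v; have [Q [g [PQ sg zg]]] := z_approx (concat w v) sT0 e3.
  have [h1 h10 H1] := gain_equicontinuous (concat w v) e3.
  have [h2 h20 H2] := z_equicontinuous (concat w v) e3.
  have : 0 < Num.min del (Num.min h1 h2) by rewrite !lt_min del0 h10.
  move=> /rat_in_itvoo[q]; rewrite in_itv/= !lt_min => /andP[q0 /and3P[qd q1 q2]].
  exists (q, Q, g); split; [by rewrite q0 ltW|exact: PQ|exact: sg|].
  move=> v' vv'; have Hs := le_trans (supnorm_concat_le2 w v v' t0 tsT) (ltW vv').
  have := H2 (concat w v') s sT0 (le_trans Hs (ltW q2)).
  have := H1 (concat w v') s Q g g sT0 PQ sg sg (le_trans Hs (ltW q1)).
  have diag u : `|g u - g u| <= h1 by rewrite subrr normr0 ltW.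
  move=> /(_ diag); rewrite !ler_distl => /andP[_ A1] /andP[A2 A3].
  exact: eps_thirds A1 A2 zg.
(* A good tube fits into the ball selected at some centre, and [c] picks such a centre. Bad tubes
   get an arbitrary one and are later replaced by the empty set; the cover survives because every
   path lies in a good tube. *)
pose good i := exists v : Om t, tube s i `<=` near_path s (ratr (qQ v).1.1) v.
have /choice[c Hc] : forall i, exists v, good i -> tube s i `<=` near_path s (ratr (qQ v).1.1) v.
  move=> i; have [[v Hv]|ng] := pselect (good i); first by exists v.
  by exists point => /ng.
(* Numbers that encode no tube are decoded as [i0]; this merely repeats a cell. *)
pose i0 : seq 'rV[rat]_d * (nat * nat) := ([::], (0%N, 0%N)).
pose f n := odflt i0 (unpickle n).
exists (fun n => if `[< good (f n) >] then tube s (f n) else set0).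
exists (fun n => (qQ (c (f n))).1.1), (fun n => c (f n)), (fun n => (qQ (c (f n))).1.2),
  (fun n => (qQ (c (f n))).2).
have Bsub n : (if `[< good (f n) >] then tube s (f n) else set0) `<=`
    near_path s (ratr (qQ (c (f n))).1.1) (c (f n)).
  by case: asboolP => [gn|_]; [exact: Hc|exact: sub0set].
split=> //.
- by move=> n; case: ifPn => _; [exact: filtration_tube|exact: filtration0].
- apply/seteqP; split=> // v _.
  have [/andP[q0 _] _ _ _] := HqQ v.
  have ts0 : 0 <= t <= s by rewrite t0.
  have [i [vi iP]] := tube_cover v ts0 q0.
  exists (pickle i) => //; rewrite /f pickleK/=.
  by case: asboolP => // ng; exfalso; apply: ng; exists v => v' /iP.
- by move=> n; have [] := HqQ (c (f n)).
- move=> n; have [_ PQ sg H] := HqQ (c (f n)); split=> // v /Bsub; exact: H.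
Qed.

(** One law and one stopping time serve all [A] in F_s at once. They come from pasting near-optimal
    controls on finitely many disjoint cells and keeping [P] on the remainder; agreement of [Phat]
    with [P] on F_s allows a later return to [P]. *)
Lemma paste_approx t s (P : probability (Om t) R) (w : Om 0) e :
  0 <= t -> t < s -> s <= T -> PP P -> 0 < e ->
  exists2 Phat, PP Phat & (forall B, filtration s B -> Phat B = P B) /\
  exists2 g : Om t -> R, stopping g /\ (forall v, s <= g v) &
    forall A, filtration s A ->
      Ex P (fun v => \1_A v * z s (concat w v)) - e
        <= Ex Phat (fun v => \1_A v * yh (g v) (concat w v)).
Proof.
move=> t0 ts sT PPP e0; have tsT : t <= s <= T by rewrite ltW.
have sT0 : 0 <= s <= T by rewrite (le_trans t0 (ltW ts)).
have tT : 0 <= t <= T by rewrite t0 (le_trans (ltW ts)).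
have [rhobar rhobarP HP4] := P4 Ywp.
have e4 : 0 < e / 4 by rewrite divr_gt0.
have [del del0 delP] := modulus_small rhobarP e4.
have [dq] : exists dq : rat, ratr dq \in `]0, del[ by apply: rat_in_itvoo.
rewrite in_itv/= => /andP[dq0 dqdel].
have rdq : rhobar (ratr dq) <= e / 4.
  by apply: le_trans delP; apply: modulus_le => //; exact: ltW.
have [B [q [c [Q [gam [FB cB q0 Bq HQ]]]]]] := countable_good_tubes w t0 tsT e4 dq0.
have PQ k : PP (Q k) by have [] := HQ k.
have sgam k : stopping (gam k) by have [] := HQ k.
have Bz k v : B k v -> z s (concat w v) - e / 4 <= gain (concat w v) (Q k) (gam k).
  by have [_ _] := HQ k; exact.
have M0 : 0 <= M.
  by apply: le_trans (Yhat_le (w : Om 0) tT); exact: normr_ge0.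
pose U n := \bigcup_(i < n) B i.
have FU n : filtration s (U n).
  rewrite /U bigcup_mkcond; apply: filtration_bigcup => i.
  by case: ifPn => _; [exact: FB|exact: filtration0].
have mU n : measurable (U n) by exact: filtration_measurable (FU n).
(* The uncovered part is made so improbable that the crude bounds by [M] there cost less than
   [e / 4]. (P4) asks for at least one pasted cell, hence [0 < n]. *)
have [n [n0 nP]] : exists n, (0 < n)%N /\ 2 * M * fine (P (~` U n)) < e / 4.
  have cvgU : fine (P (U n)) @[n --> \oo] --> (1 : R).
    apply: fine_cvg; have -> : 1%:E = P (\bigcup_n U n).
      rewrite (_ : \bigcup_n U n = setT) ?probability_setT//.
      apply/seteqP; split=> // v _; have : setT v by []; rewrite -cB => -[k _ Bkv].
      by exists k.+1 => //; exists k => /=.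
    apply: nondecreasing_cvg_mu => //.
      by apply: (filtration_measurable sT); exact: filtration_bigcup.
    move=> i j ij; apply/subsetPset => v [k /= ki Bkv]; exists k => //=.
    exact: leq_trans ij.
  have e8 : 0 < e / 4 / (2 * M + 1) by rewrite divr_gt0// ltr_wpDl// mulr_ge0.
  have /cvgrPdist_lt /(_ _ e8) [N _ HN] := cvgU.
  exists N.+1; split=> //; have := HN N.+1 (leqnSn N).
  rewrite /= probability_setC// fineB//; last by rewrite fin_num_measure.
  have P1 : fine (P (U N.+1)) <= 1.
    by rewrite -lee_fin fineK ?probability_le1// fin_num_measure.
  rewrite ger0_norm ?subr_ge0// ltr_pdivlMr ?ltr_wpDl ?mulr_ge0//.
  apply: le_lt_trans; rewrite mulrC ler_wpM2l ?subr_ge0//.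
  by rewrite lerDl.
(* Cell 0 is the uncovered remainder, where (P4) preserves the law; cell [j.+1] is [B j] made
   disjoint. The same shift appears in [Q'] below. *)
pose A j := if j is j'.+1 then seqDU B j' else ~` U n.
have FA j : filtration s (A j).
  case: j => [|j] /=; first exact: filtrationC.
  rewrite /seqDU; apply: filtrationD; first exact: FB.
  rewrite -bigcup_mkord; exact: FU.
have mA j : measurable (A j) by exact: filtration_measurable (FA j).
have UE : U n = \bigcup_(i < n) seqDU B i.
  by rewrite /U !bigcup_mkord bigsetU_seqDU.
have tA : trivIset `I_n.+1 A.
  have tS := trivIset_seqDU B.
  have H i v : (i < n)%N -> seqDU B i v -> U n v.
    by move=> ilt Biv; rewrite UE; exists i.
  move=> [|i] [|j] //= iln jln [v [Aiv Ajv]].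
  - by exfalso; apply: Aiv; apply: H Ajv.
  - by exfalso; apply: Ajv; apply: H Aiv.
  - by congr S; apply: (tS i j) => //; exists v.
have cA : \bigcup_(j < n.+1) A j = setT.
  apply/seteqP; split=> // v _; have [Uv|nUv] := pselect (U n v); last by exists 0%N.
  by move: Uv; rewrite UE => -[i /= iln Biv]; exists i.+1.
have AB j v : A j.+1 v -> B j v by apply: subset_seqDU.
pose Q' j := Q j.-1.
have HA4 : forall j, (0 < j <= n)%N -> exists (deltaj : R) (wj : Om t),
    ((0 < deltaj <= ratr dq)%R /\ (exists q : rat, deltaj = ratr q)
       \/ deltaj = ratr dq) /\ A j `<=` near_path s deltaj wj.
  move=> [|j] //= _; exists (ratr (q j)), (c j); split.
    by left; split; [exact: q0|exists (q j)].
  by move=> v /AB /Bq.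
have dq0' : 0 < dq by rewrite -(ltr0q R).
have [|j jn|Phat PPhat [HP0 HPj]] := HP4 t s w P t0 ts sT PPP dq n A dq0' n0 _ tA cA HA4 Q' _.
- by move=> j _; exact: FA.
- exact: PQ.
have PhatA j C : (j < n.+1)%N -> filtration s C -> Phat (C `&` A j) = P (C `&` A j).
  case: j => [|j] jn FC; first by apply: HP0; exact: filtration_mono FC.
  by have [] := HPj j.+1 jn C FC.
have PhatP C : filtration s C -> Phat C = P C.
  move=> FC; have mC : measurable C by exact: filtration_measurable FC.
  have E (P0 : probability (Om t) R) : P0 C = (\sum_(j < n.+1) fine (P0 (C `&` A j)))%:E.
    rewrite -[LHS]fineK ?fin_num_measure//; congr _%:E.
    rewrite -Ex_indic//; have := Ex_partition P0 (fun j _ => mA j) tA cA mC (bounded_rv_cst _ 1).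
    under eq_fun do rewrite mulr1; move=> ->; apply: eq_bigr => j _.
    by under eq_fun do rewrite mulr1; rewrite Ex_indic//; exact: measurableI.
  rewrite !E; congr _%:E; apply: eq_bigr => j _; congr fine; exact: PhatA.
(* On cell 0 any time from [s] on would do, as only the bound [M] on the reward is used there. *)
pose G j := if j is j'.+1 then gam j' \o tail_path s : Om t -> R else fun=> T.
have sG j : (j < n.+1)%N -> stopping (G j).
  case: j => [|j] _ /=; last exact: stopping_tail.
  by apply: stopping_cst; rewrite lexx andbT; have /andP[] := tT.
have Gs j v : (j < n.+1)%N -> s <= G j v.
  by case: j => [|j] _ //=; have /andP[] := (sgam j).1 (tail_path s v).
have [g [sg gs gG]] := stopping_paste t0 tsT (fun j _ => FA j) tA cA sG Gs.
exists Phat => //; split=> //; exists g => // C FC.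
have mC : measurable C by exact: filtration_measurable FC.
have bz := z_concat_rv w t0 tsT.
have by_ g' (sg' : stopping g') := Yhat_stopped_measurable w tT sg'.
have bCA j : bounded_rv (\1_(C `&` A j) : Om t -> R).
  by apply: bounded_rv_indic; exact: measurableI.
rewrite (Ex_partition Phat (fun j _ => mA j) tA cA mC (by_ _ sg)).
(* The [e / 2] covers near-optimality of the controls and [rhobar], each at most [e / 4]. *)
have bze : bounded_rv (fun v : Om t => z s (concat w v) - e / 2).
  by apply: bounded_rvB => //; exact: bounded_rv_cst.
have step j : (0 < j < n.+1)%N ->
    Ex P (fun v => \1_(C `&` A j) v * (z s (concat w v) - e / 2)) <=
    Ex Phat (fun v => \1_(C `&` A j) v * yh (g v) (concat w v)).
  case: j => // j /= jn; have [_ H] := HPj j.+1 jn C FC.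
  have {H} := H (gam j) (sgam j).
  have bg : bounded_rv (fun v : Om t => gain (concat w v) (Q j) (gam j)).
    split; last by exists M => v; exact: gain_le.
    apply: (adapted_measurableT sT).
    apply: (@adapted_comp_concat _ _ _ 0 t s (fun w1 => gain w1 (Q j) (gam j)) w) => //.
      exact: ltW.
    exact: gain_adapted.
  have bgr : bounded_rv (fun v : Om t => gain (concat w v) (Q j) (gam j) - rhobar (ratr dq)).
    by apply: bounded_rvB => //; exact: bounded_rv_cst.
  have -> : (\int[P]_(w' in C `&` A j.+1)
     ('E_(Q' j.+1)[sample (shift_process (Yhat Y wp) (concat w w')) (gam j)] - (rhobar (ratr dq))%:E)
     = (Ex P (fun v => \1_(C `&` A j.+1) v * (gain (concat w v) (Q j) (gam j) - rhobar (ratr dq))))%:E)%E.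
    rewrite -Ex_restrict//; last exact: measurableI.
    by apply: eq_integral => v _; rewrite gainE.
  rewrite [X in (_ <= X)%E -> _](_ : _ = (Ex Phat (fun v => \1_(C `&` A j.+1) v *
      yh (gam j (tail_path s v)) (concat w v)))%:E); last first.
    rewrite -Ex_restrict//; first exact: measurableI.
    exact: (by_ _ (sG j.+1 jn)).
  rewrite lee_fin => H.
  have -> : Ex Phat (fun v => \1_(C `&` A j.+1) v * yh (g v) (concat w v)) =
    Ex Phat (fun v => \1_(C `&` A j.+1) v * yh (gam j (tail_path s v)) (concat w v)).
    congr (Ex Phat _); apply/funext => v; rewrite indicE.
    case: (boolP (v \in _)); rewrite ?mul0r// inE => -[_ Av].
    by rewrite (gG j.+1 v jn Av).
  apply: le_trans H; apply: Ex_le.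
  - exact: (bounded_rvM (bCA j.+1) bze).
  - exact: (bounded_rvM (bCA j.+1) bgr).
  - move=> v; rewrite indicE; case: (boolP (v \in _)); rewrite ?mul0r ?mul1r// inE.
    by move=> [_ Av]; exact: eps_quarters (Bz j v (AB j v Av)) rdq.
have step0 : Ex P (fun v => \1_(C `&` A 0%N) v * (z s (concat w v) - e / 2)) - e / 4 <=
    Ex Phat (fun v => \1_(C `&` A 0%N) v * yh (g v) (concat w v)).
  have PA0 : fine (P (C `&` A 0%N)) <= fine (P (~` U n)).
    apply: fine_le; rewrite ?fin_num_measure//; [exact: measurableI|exact: (mA 0%N)|].
    by apply: le_measure; rewrite ?inE; [exact: measurableI|exact: (mA 0%N)|move=> v []].
  have H1 : - M * fine (P (C `&` A 0%N)) <=
      Ex Phat (fun v => \1_(C `&` A 0%N) v * yh (g v) (concat w v)).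
    rewrite -(PhatA 0%N)// -Ex_indic; last exact: measurableI.
    rewrite -ExZ//; apply: Ex_le.
    - by apply: bounded_rvM => //; exact: bounded_rv_cst.
    - by apply: bounded_rvM => //; exact: by_.
    - move=> v; rewrite mulrC ler_wpM2l//.
      have gT : 0 <= g v <= T by have /andP[/(le_trans t0) -> ->] := sg.1 v.
      by have := Yhat_le (concat w v) gT; rewrite ler_norml => /andP[].
  have H2 : Ex P (fun v => \1_(C `&` A 0%N) v * (z s (concat w v) - e / 2)) <=
      M * fine (P (C `&` A 0%N)).
    rewrite -Ex_indic; last exact: measurableI.
    rewrite -ExZ//; apply: Ex_le.
    - exact: bounded_rvM.
    - by apply: bounded_rvM => //; exact: bounded_rv_cst.
    - move=> v; rewrite [leRHS]mulrC ler_wpM2l//.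
      have := z_le (concat w v) sT0; rewrite ler_norml => /andP[_ zM].
      by rewrite lerBlDr (le_trans zM)// lerDl divr_ge0// ltW.
  exact: eps_remainder M0 H1 H2 PA0 nP.
have lhs : Ex P (fun v => \1_C v * z s (concat w v)) - e / 2 <=
    Ex P (fun v => \1_C v * (z s (concat w v) - e / 2)).
  have bC := bounded_rv_indic R mC.
  rewrite -{1}(Ex_cst P (e / 2)) -ExB; [|exact: bounded_rvM|exact: bounded_rv_cst].
  apply: Ex_le; [|exact: bounded_rvM|].
    by apply: bounded_rvB; [exact: bounded_rvM|exact: bounded_rv_cst].
  move=> v; rewrite mulrBr lerD2l lerN2; apply: ler_piMl; first by rewrite divr_ge0// ltW.
  by rewrite indicE; case: (v \in C).
rewrite (Ex_partition P (fun j _ => mA j) tA cA mC bze) in lhs.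
move: lhs; rewrite !big_ord_recl /= => lhs.
have sumle : \sum_(i < n) Ex P (fun x => \1_(C `&` A (bump 0 i)) x * (z s (concat w x) - e / 2)) <=
  \sum_(i < n) Ex Phat (fun x => \1_(C `&` A (bump 0 i)) x * yh (g x) (concat w x)).
  by apply: ler_sum => i _; apply: step; rewrite /bump /= add1n ltnS.
exact: eps_paste e4 lhs step0 sumle.
Qed.

Lemma concat_0 (w v : Om 0) : concat w v = v.
Proof. exact: concat0. Qed.

(** Pasting over the whole space realizes the left side, up to [e], as the gain of a single
    admissible pair started at [t]. *)
Lemma z_supermean t s (P : probability (Om t) R) (w : Om 0) :
  0 <= t -> t < s -> s <= T -> PP P -> Ex P (fun v => z s (concat w v)) <= z t w.
Proof.
move=> t0 ts sT PPP; apply/ler_addgt0Pl => e e0; rewrite addrC -lerBlDr.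
have tT : 0 <= t <= T by rewrite t0 (le_trans (ltW ts)).
have [Q PQ [_ [g [sg gs] H]]] := paste_approx w t0 ts sT PPP e0.
have := H setT (@filtrationT _ _ _ t s); rewrite indicT.
under eq_fun do rewrite mul1r; under [in leRHS]eq_fun do rewrite mul1r.
by move=> /le_trans; apply; exact: gain_le_z.
Qed.

Lemma z_rv s : 0 <= s <= T -> bounded_rv (z s).
Proof.
move=> sT; split; last by exists M => v; exact: z_le.
by have /andP[_ sT'] := sT; apply: (adapted_measurableT sT'); exact: z_adapted.
Qed.

(** No conditional expectation of [z r] under [P] is formed. Pasting at [r] gives a law [Q] and a
    stopping time after [r] whose reward nearly attains [z r]; disintegrating [Q] at the earlier
    time [s] bounds that reward by [z s], and [Q] agrees with [P] on F_s. *)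
Lemma z_supermartingale_set s r (P : probability (Om 0) R) (A : set (Om 0)) :
  0 <= s -> s <= r -> r <= T -> PP P -> filtration s A ->
  Ex P (fun v => \1_A v * z r v) <= Ex P (fun v => \1_A v * z s v).
Proof.
move=> s0; rewrite le_eqVlt => /predU1P[<-//|sr] rT PPP FA.
have sT : s <= T by rewrite (le_trans (ltW sr)).
have mA : measurable A by exact: filtration_measurable FA.
have r0 : 0 < r by exact: le_lt_trans sr.
(* The disintegration from time 0 requires [0 < s]. At [s = 0] all paths agree, so by Galmarino's
   test [A] is empty or everything. *)
have [s0'|sn0] := eqVneq s 0.
  have [[v0 Av0]|nA] := pselect (A !=set0); last first.
    have A0 : A = set0 by apply/seteqP; split=> v // Av; apply: nA; exists v.
    by rewrite A0 indic0; under eq_fun do rewrite mul0r; under [in leRHS]eq_fun do rewrite mul0r.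
  have -> : A = setT.
    apply/seteqP; split=> // v _; apply: (galmarino FA _).1 Av0.
    by move=> u; rewrite s0' => u0; rewrite !path_eq0.
  rewrite indicT; under eq_fun do rewrite mul1r; under [in leRHS]eq_fun do rewrite mul1r.
  have := z_supermean v0 (lexx 0) r0 rT PPP.
  under eq_fun do rewrite concat_0.
  move=> /le_trans; apply; rewrite s0'; apply: Ex_ge_cst.
    by apply: z_rv; rewrite lexx.
  move=> v; rewrite (z_local (w := v0) (w' := v))//; first by rewrite lexx.
  by move=> u u0; rewrite !path_eq0.
have s_gt0 : 0 < s by rewrite lt_neqAle eq_sym sn0.
have sT0 : 0 <= s <= T by rewrite s0.
apply/ler_addgt0Pl => e e0; rewrite addrC -lerBlDr.
have [Q PQ [QP [g [sg gr] H]]] := paste_approx (point : Om 0) (lexx 0) r0 rT PPP e0.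
have := H A (filtration_mono (ltW sr) FA).
under eq_fun do rewrite concat_0; move/le_trans; apply.
apply: (@le_trans _ _ (Ex Q (fun v => \1_A v * z s v))).
  have gs v : s <= g v by rewrite (le_trans (ltW sr)).
  have := snell_upper (point : Om 0) (lexx 0) s_gt0 sT PQ sg gs FA.
  rewrite (_ : (fun v => \1_A v * z s (concat point v)) = (fun v => \1_A v * z s v))//.
  by apply/funext => v; rewrite concat_0.
have b : bounded_rv (fun v => \1_A v * z s v).
  by apply: bounded_rvM; [exact: bounded_rv_indic|exact: z_rv].
rewrite (Ex_sub_filtration (P := Q) (Q := P) (s := s))//.
  by move=> B FB; apply: QP; exact: filtration_mono (ltW sr) _ FB.
apply: measurable_adapted; apply: measurable_funM.
  exact: measurable_indic.
by apply: adapted_measurable; exact: z_adapted.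
Qed.

Lemma M_ge0 : 0 <= M.
Proof.
by apply: le_trans (YM (t := 0) (point : Om 0) _); rewrite ?lexx.
Qed.

(** Rounding the weight to an average of indicators reduces the claim to sets in F_s; the rounding
    error is multiplied by an increment of size at most [2 * M]. *)
Lemma z_supermartingale s r (P : probability (Om 0) R) (phi : Om 0 -> R) :
  0 <= s -> s <= r -> r <= T -> PP P -> adapted s phi -> (forall v, 0 <= phi v <= 1) ->
  Ex P (fun v => phi v * (z r v - z s v)) <= 0.
Proof.
move=> s0 sr rT PPP aphi phi01; have sT := le_trans sr rT.
have sT0 : 0 <= s <= T by rewrite s0.
have rT0 : 0 <= r <= T by rewrite (le_trans s0).
have bphi : bounded_rv phi.
  by apply: (adapted_rv (c := 1) sT aphi) => v; have /andP[? ?] := phi01 v; rewrite ger0_norm.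
have bz : bounded_rv (fun v => z r v - z s v) by apply: bounded_rvB; exact: z_rv.
apply/ler_addgt0Pl => e e0; rewrite addr0.
have M1 : 0 < 2 * M + 1 by rewrite ltr_wpDl// mulr_ge0// M_ge0.
have [K KP] : exists K : nat, K.+1%:R^-1 < e / (2 * M + 1).
  have e1 : 0 < e / (2 * M + 1) by rewrite divr_gt0.
  have [k _ kP] := @near_infty_natSinv_lt R (PosNum e1).
  by exists k; apply: (kP k) => /=.
pose B (k : 'I_K.+1) := [set v | k.+1%:R / K.+1%:R <= phi v].
have FB k : filtration s (B k).
  have := measurable_ge_set (k.+1%:R / K.+1%:R) (adapted_measurable aphi).
  by [].
have mB k : measurable (B k) by exact: filtration_measurable (FB k).
have b1 k : bounded_rv (fun v => \1_(B k) v * (z r v - z s v)).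
  by apply: bounded_rvM => //; exact: bounded_rv_indic.
have H k : Ex P (fun v => \1_(B k) v * (z r v - z s v)) <= 0.
  under eq_fun do rewrite mulrBr; rewrite ExB ?subr_le0.
  - exact: z_supermartingale_set.
  - by apply: bounded_rvM; [exact: bounded_rv_indic|exact: z_rv].
  - by apply: bounded_rvM; [exact: bounded_rv_indic|exact: z_rv].
have HK : K.+1%:R^-1 * (2 * M) <= e.
  rewrite (le_trans (ler_wpM2r _ (ltW KP))) ?mulr_ge0 ?M_ge0//.
  by rewrite mulrAC ler_pdivrMr// ler_pM2l// lerDl.
have bS : bounded_rv (fun v => K.+1%:R^-1 * \sum_(k < K.+1) \1_(B k) v * (z r v - z s v)).
  by apply: bounded_rvM; [exact: bounded_rv_cst|exact: bounded_rv_sum].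
apply: (@le_trans _ _ (Ex P (fun v => e + K.+1%:R^-1 * \sum_(k < K.+1) \1_(B k) v * (z r v - z s v)))).
  apply: Ex_le; [exact: bounded_rvM|by apply: bounded_rvD => //; exact: bounded_rv_cst|].
  move=> v; have := layer_cake K (phi01 v); set S := K.+1%:R^-1 * _.
  move=> /andP[S1 S2].
  have -> : K.+1%:R^-1 * \sum_(k < K.+1) \1_(B k) v * (z r v - z s v) = S * (z r v - z s v).
    rewrite -mulr_suml mulrA /S; congr (_ * _ * _); apply: eq_bigr => k _.
    by rewrite indicE /B; congr ((nat_of_bool _)%:R); apply/idP/idP; rewrite inE.
  rewrite -lerBlDr -mulrBl; apply: le_trans HK.
  have zz : `|z r v - z s v| <= 2 * M.
    by rewrite (le_trans (ler_normB _ _))// mulr_natl mulr2n lerD// z_le.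
  apply: (le_trans (ler_norm _)); rewrite normrM ler_pM//.
  by rewrite ger0_norm ?subr_ge0// lerBlDl.
rewrite ExD//; last exact: bounded_rv_cst.
rewrite Ex_cst gerDl ExZ; last exact: bounded_rv_sum.
rewrite Ex_sum//; apply: mulr_ge0_le0; first by rewrite invr_ge0.
by apply: sumr_le0 => k _; exact: H.
Qed.

(** When the future moves by at most [h1 / 2] on [[t, s]], equicontinuity of [z] applies, the other
    [h1 / 2] being reserved for the oscillation of [w] itself. Otherwise the crude bound [2 * M]
    equals [C * (h1 / 2)], so it is dominated by [C] times the truncated oscillation, whose mean is
    small by (P2). *)
Lemma z_spatial_shift (w : Om 0) e : 0 < e -> exists2 h, 0 < h &
  forall t s (P : probability (Om t) R), 0 <= t -> t <= s <= T -> s - t <= h -> PP P ->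
    `|Ex P (fun v => z s (concat w v)) - z s w| <= e.
Proof.
move=> e0; have e2 : 0 < e / 2 by rewrite divr_gt0.
have [h1 h10 Hz] := z_equicontinuous w e2.
have h12 : 0 < h1 / 2 by rewrite divr_gt0.
have [h2 h20 osc] := path_unif_continuous w h12.
pose C := 2 * M / (h1 / 2).
have C0 : 0 <= C by rewrite divr_ge0 ?mulr_ge0 ?M_ge0// ltW.
have C1 : 0 < C + 1 by rewrite ltr_wpDl.
have e' : 0 < e / 2 / (C + 1) by rewrite divr_gt0.
have [del del0 Hosc] := Ex_osc_small (power_modulus_id R) e'.
exists (Num.min h2 del); first by rewrite lt_min h20.
move=> t s P t0 tsT; rewrite le_min => /andP[st2 std] PPP.
have /andP[ts sT] := tsT; have tT : 0 <= t <= T by rewrite t0 (le_trans ts).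
have sT0 : 0 <= s <= T by rewrite (le_trans t0).
have bz := z_concat_rv w t0 tsT.
pose f (v : Om t) := Num.min (supnorm t s v) (h1 / 2).
have bf : bounded_rv f by apply: supnorm_min_rv => //; exact: ltW.
have f0 v : 0 <= f v by rewrite /f le_min supnorm_ge0 ltW.
have pt v : `|z s (concat w v) - z s w| <= e / 2 + C * f v.
  have [vh|hv] := leP (supnorm t s v) (h1 / 2).
    rewrite distrC; apply: (@le_trans _ _ (e / 2)); last by rewrite lerDl; exact: mulr_ge0 C0 (f0 v).
    apply: Hz => //; apply: supnorm_le => [|r]; first exact: ltW.
    rewrite in_itv/= => /andP[r0 rs]; rewrite concat_min ?t0 ?(le_trans ts)//.
    rewrite addrAC (le_trans (enormD _ _))// (splitr h1) lerD//.
      apply: osc; case: (leP r t) => rt; first by rewrite subrr normr0 ltW.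
      by rewrite distrC gtr0_norm ?subr_gt0// (le_trans _ st2)// lerD2r.
    apply: le_trans vh; have [rt|/ltW tr] := leP r t.
      by rewrite path_eq0// enorm0 supnorm_ge0.
    by apply: supnorm_ub => //; [exact: path_continuous|rewrite in_itv/= tr].
  apply: (@le_trans _ _ (2 * M)).
    by rewrite (le_trans (ler_normB _ _))// mulr_natl mulr2n lerD// z_le.
  by rewrite /f min_r ?(ltW hv)// /C divfK ?gt_eqF// lerDr ltW.
have Ef : Ex P f <= e / 2 / (C + 1).
  rewrite (_ : f = fun v => `|f v|); last by apply/funext => v; rewrite ger0_norm.
  apply: (Hosc t P (fun=> t)) => //.
    by apply: stopping_cst; rewrite lexx; have /andP[] := tT.
  move=> v; rewrite /= ger0_norm// /f (@le_trans _ _ (supnorm t s v)) ?ge_min ?lexx//.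
  rewrite (@le_trans _ _ (supnorm t (Num.min (t + del) T) (fun r => v r - v t))) ?lerDr ?(ltW del0)//.
  apply: supnorm_le => [|r]; first exact: supnorm_ge0.
  rewrite in_itv/= => /andP[tr rs].
  have -> : v r = v r - v t by rewrite [v t]path_eq0// subr0.
  apply: (@supnorm_ub _ _ _ _ (fun r => v r - v t)); last 1 first.
  - by rewrite in_itv/= tr le_min (le_trans rs sT) andbT (le_trans rs)// -lerBlDl.
  - by rewrite le_min lerDl (ltW del0)/=; have /andP[] := tT.
  - exact: tail_continuous.
have bC : bounded_rv (fun v => C * f v) by apply: bounded_rvM => //; exact: bounded_rv_cst.
rewrite -{1}(Ex_cst P (z s w)) -ExB//; last exact: bounded_rv_cst.
have bd : bounded_rv (fun v : Om t => z s (concat w v) - z s w).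
  by apply: bounded_rvB => //; exact: bounded_rv_cst.
apply: le_trans (Ex_norm _ bd) _.
apply: (@le_trans _ _ (Ex P (fun v => e / 2 + C * f v))).
  apply: Ex_le => //; first exact: bounded_rv_norm.
  by apply: bounded_rvD => //; exact: bounded_rv_cst.
rewrite ExD//; last exact: bounded_rv_cst.
rewrite Ex_cst ExZ// [leRHS](splitr e) lerD2l (le_trans (ler_wpM2l C0 Ef))//.
by rewrite mulrCA ler_piMr ?(ltW e2)// ler_pdivrMr// mul1r lerDl.
Qed.

(** In one direction the supermartingale inequality suffices. In the other, postponing a control to
    [Num.max (g v) s] costs little by equicontinuity of the gain, and from [s] on the reward is
    dominated by [z s] along the random path, which is close to [z s w] on average. *)
Lemma z_time_continuous (w : Om 0) e : 0 < e -> exists2 h, 0 < h &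
  forall t s, 0 <= t <= T -> 0 <= s <= T -> `|t - s| <= h -> `|z t w - z s w| <= e.
Proof.
move=> e0; have e2 : 0 < e / 2 by rewrite divr_gt0.
have [h1 h10 H1] := z_spatial_shift w e2.
have [h2 h20 H2] := gain_equicontinuous w e2.
exists (Num.min h1 h2); first by rewrite lt_min h10.
suff main t s : 0 <= t -> t < s -> s <= T -> s - t <= Num.min h1 h2 -> `|z t w - z s w| <= e.
  move=> t s /andP[t0 tT] /andP[s0 sT] tsh.
  have [ts|st|<-] := ltgtP t s; last by rewrite subrr normr0 ltW.
    by apply: main => //; rewrite (le_trans _ tsh)// distrC ler_norm.
  by rewrite distrC; apply: main => //; rewrite (le_trans _ tsh)// ler_norm.
move=> t0 ts sT; rewrite le_min => /andP[st1 st2].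
have tsT : t <= s <= T by rewrite ltW.
have tT : 0 <= t <= T by rewrite t0 (le_trans (ltW ts)).
have sT0 : 0 <= s <= T by rewrite (le_trans t0 (ltW ts)).
rewrite ler_distl; apply/andP; split.
  have [P PPP] := PP_neq0 tT.
  have := H1 t s P t0 tsT st1 PPP; rewrite ler_distl => /andP[A _].
  apply: le_trans (z_supermean w t0 ts sT PPP); apply: le_trans A.
  by rewrite lerD2l lerN2 ler_pdivrMr// ler_pMr// ler1n.
apply: z_ub => // P g PPP sg.
have smax : stopping (fun v => Num.max (g v) s).
  by apply: stopping_max => //; apply: stopping_cst.
have gmax v : `|g v - Num.max (g v) s| <= h2.
  have /andP[tg gT] := sg.1 v.
  case: (leP (g v) s) => gs; last by rewrite subrr normr0 ltW.
  by rewrite distrC ger0_norm ?subr_ge0// (le_trans _ st2)// lerD2l lerN2.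
have diag : supnorm 0 t (w \- w) <= h2 by rewrite supnorm_diag ltW.
have := H2 w t P g _ tT PPP sg smax diag gmax; rewrite ler_distl => /andP[_ B].
apply: le_trans B _.
have -> : z s w + e = z s w + e / 2 + e / 2 by rewrite -addrA -splitr.
rewrite lerD2r.
have := H1 t s P t0 tsT st1 PPP; rewrite ler_distl => /andP[_]; apply: le_trans.
have gs v : s <= Num.max (g v) s by rewrite le_max lexx orbT.
have := snell_upper w t0 ts sT PPP smax gs (@filtrationT _ _ _ t s).
rewrite indicT.
by under eq_fun do rewrite mul1r; under [in leRHS]eq_fun do rewrite mul1r.
Qed.

(** * Grid sums and optional sampling *)

Definition grid n (i : nat) : R := i%:R * (T / n.+1%:R).

Lemma grid0 n : grid n 0 = 0. Proof. by rewrite /grid mul0r. Qed.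

Lemma gridT n : grid n n.+1 = T.
Proof. by rewrite /grid mulrCA divff ?mulr1// pnatr_eq0. Qed.

Lemma gridS n i : grid n i.+1 = grid n i + T / n.+1%:R.
Proof. by rewrite /grid -natr1 mulrDl mul1r. Qed.

Lemma grid_mono n i j : (i <= j)%N -> grid n i <= grid n j.
Proof. by move=> ij; rewrite ler_wpM2r ?ler_nat// divr_ge0. Qed.

Lemma grid_itv n i : (i <= n.+1)%N -> 0 <= grid n i <= T.
Proof. move=> iN; apply/andP; split; first by rewrite -(grid0 n); exact: grid_mono.
by rewrite -[leRHS](gridT n); exact: grid_mono. Qed.

Lemma grid_index n x : 0 <= x <= T -> exists k,
  [/\ (k <= n.+1)%N, x <= grid n k, grid n k <= x + T / n.+1%:R &
      forall i, (grid n i < x) = (i < k)%N].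
Proof.
move=> /andP[x0 xT]; have exk : exists k, x <= grid n k by exists n.+1; rewrite gridT.
case: (ex_minnP exk) => k xk kmin; exists k; split=> //.
- by apply: kmin; rewrite gridT.
- case: k xk kmin => [|k] xk kmin; first by rewrite grid0 addr_ge0// divr_ge0.
  rewrite gridS lerD2r leNgt; apply/negP => /ltW /kmin.
  by rewrite ltnn.
- move=> i; apply/idP/idP => [ix|ik].
    rewrite ltnNge; apply/negP => ki.
    by have := le_trans xk (grid_mono n ki); rewrite leNgt ix.
  by rewrite ltNge; apply/negP => /kmin; rewrite leqNgt ik.
Qed.

Lemma mesh_small e : 0 < e -> exists N : nat, forall n, (N <= n)%N -> T / n.+1%:R <= e.
Proof.
move=> e0; have eT : 0 < e / T by rewrite divr_gt0.
have [N _ HN] := @near_infty_natSinv_lt R (PosNum eT).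
exists N => n Nn; have := HN n Nn; rewrite /= ltr_pdivlMr// mulrC => /ltW.
by [].
Qed.

Implicit Types (v w : Om 0).

(** * The gap between envelope and reward *)

Definition gap (t : R) (v : Om 0) : R := z t v - yh t v.

Lemma gap_ge0 t v : 0 <= t <= T -> 0 <= gap t v.
Proof. by move=> tT; rewrite subr_ge0; exact: Yhat_le_z. Qed.

Lemma gap_T v : gap T v = 0. Proof. by rewrite /gap z_T subrr. Qed.

Lemma Yhat_time_continuous v e : 0 < e -> exists2 h, 0 < h &
  forall t s, 0 <= t <= T -> 0 <= s <= T -> `|t - s| <= h -> `|yh t v - yh s v| <= e.
Proof.
move=> e0; have [h h0 H] := Yhat_continuous v e0; exists h => // t s tT sT ts.
by apply: H => //; rewrite supnorm_diag ltW.
Qed.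

Lemma gap_time_continuous v e : 0 < e -> exists2 h, 0 < h &
  forall t s, 0 <= t <= T -> 0 <= s <= T -> `|t - s| <= h -> `|gap t v - gap s v| <= e.
Proof.
move=> e0; have e2 : 0 < e / 2 by rewrite divr_gt0.
have [h1 h10 H1] := z_time_continuous v e2.
have [h2 h20 H2] := Yhat_time_continuous v e2.
exists (Num.min h1 h2); first by rewrite lt_min h10.
move=> t s tT sT; rewrite le_min => /andP[ts1 ts2].
have -> : gap t v - gap s v = (z t v - z s v) - (yh t v - yh s v).
  by rewrite /gap; ring.
rewrite (splitr e).
by rewrite (le_trans (ler_normB _ _))// lerD ?H1 ?H2.
Qed.

Lemma gap_adapted t : 0 <= t <= T -> adapted t (gap t).
Proof.
move=> tT; apply: measurable_adapted; apply: measurable_funB; apply: adapted_measurable.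
  exact: z_adapted.
exact: Yhat_adapted.
Qed.

Lemma gap_min v t : 0 <= t <= T -> exists2 c, 0 <= c <= t &
  forall s, 0 <= s <= t -> gap c v <= gap s v.
Proof.
(* Clamping to [[0, T]], where [gap] is known to be continuous, produces a function continuous on
   the whole line. *)
move=> /andP[t0 tT]; pose cl x : R := Num.max 0 (Num.min x T).
have clT x : 0 <= cl x <= T.
  by rewrite /cl le_max lexx/= ge_max T_ge0 ge_min lexx orbT.
have clE x : 0 <= x <= t -> cl x = x.
  by move=> /andP[x0 xt]; rewrite /cl min_l ?(le_trans xt)// max_r.
have cf : continuous (fun x => gap (cl x) v).
  move=> x; apply/cvgrPdist_le => e e0; have [h h0 H] := gap_time_continuous v e0.
  have ccl : {for x, continuous cl}.
    apply: continuous_max; first exact: cvg_cst.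
    by apply: continuous_min; [exact: cvg_id|exact: cvg_cst].
  have /cvgrPdist_le/(_ h h0) := ccl.
  by apply: filterS => y; exact: H.
have [c cI cmin] := EVT_min t0 (continuous_subspaceT cf).
move: (cI); rewrite in_itv/= => c0t; exists c => // s s0t.
by have := cmin s; rewrite in_itv/= => /(_ s0t); rewrite !clE.
Qed.

(** * The contact time *)

Let nu := nuhat PP Y wp.

Let contact v := [set t | (0 <= t <= T)%R /\ snell PP Y wp t v = (Yhat Y wp t v)%:E].

Lemma contactE v t : contact v t <-> 0 <= t <= T /\ gap t v = 0.
Proof.
split=> -[tT]; rewrite ?snellE//.
  by move=> [zy]; split=> //; rewrite /gap zy subrr.
by move=> /eqP; rewrite subr_eq0 => /eqP zy; split=> //; rewrite snellE// zy.
Qed.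

Lemma contact_inf v : has_inf (contact v).
Proof.
split; first by exists T; apply/contactE; rewrite T_ge0 lexx gap_T.
by exists 0 => t /contactE[/andP[]].
Qed.

Lemma nuhat_le v t : 0 <= t <= T -> gap t v = 0 -> nu v <= t.
Proof.
by move=> tT g0; apply: ge_inf; [have [] := contact_inf v|apply/contactE].
Qed.

Lemma nuhat_itv v : 0 <= nu v <= T.
Proof.
apply/andP; split; last by apply: nuhat_le; rewrite ?T_ge0 ?lexx ?gap_T.
by apply: lb_le_inf; [have [] := contact_inf v|move=> t /contactE[/andP[]]].
Qed.

(** Time continuity of the gap makes the contact set closed, so its infimum is attained. *)
Lemma gap_nuhat v : gap (nu v) v = 0.
Proof.
apply/eqP; rewrite eq_le gap_ge0 ?nuhat_itv// andbT; apply/ler_addgt0Pl => e e0.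
rewrite addr0; have [h h0 H] := gap_time_continuous v e0.
have [t /contactE[tT g0] tnu] := inf_adherent h0 (contact_inf v).
have := H (nu v) t (nuhat_itv v) tT; rewrite g0 subr0 => /(_ _)/(le_trans (ler_norm _)).
apply; rewrite distrC ger0_norm; first by rewrite lerBlDl ltW.
by rewrite subr_ge0; exact: nuhat_le.
Qed.

Lemma gap_gt0 v t : 0 <= t -> t < nu v -> 0 < gap t v.
Proof.
move=> t0 tn; have tT : 0 <= t <= T.
  by rewrite t0 (le_trans (ltW tn))//; have /andP[] := nuhat_itv v.
rewrite lt_neqAle gap_ge0// andbT eq_sym; apply/eqP => /(nuhat_le tT).
by rewrite leNgt tn.
Qed.

(** Contact by time [s] means that the gap gets arbitrarily small at rational times of [[0, s]] or
    at [s]: otherwise its minimum over [[0, s]], which is attained, would be positive. This writes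
    the event with countably many members of the raw F_s. *)
Lemma nuhat_stopping : stopping nu.
Proof.
split=> [v|s /andP[s0 sT]]; first exact: nuhat_itv.
pose r (q : option rat) : R := if q is Some q then ratr q else s.
rewrite (_ : [set _ | _] = \bigcap_n \bigcup_q
  (if 0 <= r q <= s then [set v | gap (r q) v <= n.+1%:R^-1] else set0)).
  apply: filtration_bigcap => n; apply: filtration_bigcup => q.
  case: ifPn => [/andP[r0 rs]|_]; last exact: filtration0.
  by apply: (filtration_mono rs); apply: gap_adapted; rewrite r0 (le_trans rs).
apply/seteqP; split=> v /=.
  move=> nus n _; have n0 : 0 < n.+1%:R^-1 :> R by rewrite invr_gt0.
  have [h h0 H] := gap_time_continuous v n0.
  have /andP[nu0 nuT] := nuhat_itv v.
  have nus' : 0 <= nu v <= s by rewrite nu0.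
  have [r' [r'0s r'q] nur'] := tube_times_dense nus' h0.
  have r'T : 0 <= r' <= T by have /andP[-> /le_trans ->] := r'0s.
  have g' : gap r' v <= n.+1%:R^-1.
    have := H r' (nu v) r'T (nuhat_itv v); rewrite distrC gap_nuhat subr0 => /(_ nur').
    exact: le_trans (ler_norm _).
  case: r'q => [r's|[q r'q]].
    by exists None => //=; rewrite s0 lexx /= -r's.
  by exists (Some q) => //=; rewrite -r'q r'0s.
move=> H; rewrite leNgt; apply/negP => snu.
have sT0 : 0 <= s <= T by rewrite s0.
have [c /andP[c0 cs] cmin] := gap_min v sT0.
have gc : 0 < gap c v by apply: gap_gt0 => //; exact: le_lt_trans snu.
have [N _ HN] := @near_infty_natSinv_lt R (PosNum gc).
have [q _] := H N Logic.I; case: ifPn => // rs /= gr.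
have := cmin _ rs; rewrite leNgt => /negP; apply; apply: le_lt_trans gr _.
exact: (HN N (leqnn N)).
Qed.

(* By Abel summation, for the weights [i < k] the grid sum below is the value of
   [z] at the [k]-th grid point. As [z] is a supermartingale, the expectation is
   antitone in the weights, which contains optional sampling. *)
Definition weight n (phi : nat -> Om 0 -> R) : Prop := forall i, (i <= n)%N ->
  adapted (grid n i) (phi i) /\ forall v, 0 <= phi i v <= 1.

Definition grid_sum n (phi : nat -> Om 0 -> R) (v : Om 0) : R :=
  z 0 v + \sum_(i < n.+1) phi i v * (z (grid n i.+1) v - z (grid n i) v).

Lemma grid_sum_rv n phi : weight n phi -> bounded_rv (grid_sum n phi).
Proof.
move=> wphi; apply: bounded_rvD; first by apply: z_rv; rewrite lexx.
apply: bounded_rv_sum => i; have iN : (i <= n)%N by rewrite -ltnS.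
have [aphi phi01] := wphi i iN.
have /andP[g0 gT] := grid_itv (leqW iN).
apply: bounded_rvM.
  by apply: (adapted_rv (c := 1) gT aphi) => v; have /andP[? ?] := phi01 v; rewrite ger0_norm.
by apply: bounded_rvB; apply: z_rv; apply: grid_itv => //; exact: leqW.
Qed.

(** The difference of the two weights is again adapted with values in [0, 1], so each of its
    increments has nonpositive mean. *)
Lemma grid_sum_mono n phi psi P : weight n phi -> weight n psi -> PP P ->
  (forall i v, (i <= n)%N -> phi i v <= psi i v) ->
  Ex P (grid_sum n psi) <= Ex P (grid_sum n phi).
Proof.
move=> wphi wpsi PPP pp; rewrite -subr_le0 -ExB; [|exact: grid_sum_rv|exact: grid_sum_rv].
have -> : (fun v => grid_sum n psi v - grid_sum n phi v) = (fun v =>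
    \sum_(i < n.+1) (psi i v - phi i v) * (z (grid n i.+1) v - z (grid n i) v)).
  apply/funext => v; rewrite /grid_sum opprD addrACA subrr add0r -sumrB.
  by apply: eq_bigr => i _; rewrite mulrBl.
have bw i : (i <= n)%N -> adapted (grid n i) (fun v => psi i v - phi i v) /\
    forall v, 0 <= psi i v - phi i v <= 1.
  move=> iN; have [ap p01] := wphi i iN; have [aq q01] := wpsi i iN; split.
    by apply: measurable_adapted; apply: measurable_funB; exact: adapted_measurable.
  move=> v; have /andP[p0 _] := p01 v; have /andP[_ q1] := q01 v.
  by rewrite subr_ge0 pp//= lerBlDr (le_trans q1)// lerDl.
rewrite Ex_sum; last first.
  move=> i; have iN : (i <= n)%N by rewrite -ltnS.
  have [ai i01] := bw i iN; have /andP[g0 gT] := grid_itv (leqW iN).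
  apply: bounded_rvM.
    by apply: (adapted_rv (c := 1) gT ai) => v; have /andP[? ?] := i01 v; rewrite ger0_norm.
  by apply: bounded_rvB; apply: z_rv; apply: grid_itv => //; exact: leqW.
apply: sumr_le0 => i _; have iN : (i <= n)%N by rewrite -ltnS.
have [ai i01] := bw i iN; have /andP[g0 gT] := grid_itv (leqW iN).
apply: (z_supermartingale (s := grid n i)) => //; first exact: grid_mono.
by have /andP[] := @grid_itv n i.+1 iN.
Qed.

Lemma weight_bool n (b : nat -> Om 0 -> bool) :
  (forall i, (i <= n)%N -> filtration (grid n i) [set v | b i v]) ->
  weight n (fun i v => (b i v)%:R).
Proof.
move=> Fb i iN; split=> [|v]; last by case: (b i v); rewrite ?lexx ?ler01.
have -> : (fun v => (b i v)%:R) = \1_[set v | b i v] :> (Om 0 -> R).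
  apply/funext => v; rewrite indicE; congr ((nat_of_bool _)%:R).
  by apply/idP/idP; rewrite inE.
by apply: measurable_adapted; apply: measurable_indic; exact: Fb.
Qed.

Lemma grid_sum_bool n (b : nat -> Om 0 -> bool) v : (forall i, b i.+1 v -> b i v) ->
  exists k, [/\ (k <= n.+1)%N, forall i, (i < n.+1)%N -> b i v = (i < k)%N &
    grid_sum n (fun i v => (b i v)%:R) v = z (grid n k) v].
Proof.
move=> bS; have [k [kn bk sk]] := telescope_antitone (fun i => z (grid n i) v) n.+1 bS.
exists k; split=> //; rewrite /grid_sum.
under eq_bigr do rewrite mulr_natl; rewrite sk grid0.
by rewrite addrC subrK.
Qed.

Lemma weight_before n (tau : Om 0 -> R) : stopping tau ->
  weight n (fun i v => (grid n i < tau v)%R%:R).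
Proof.
move=> st; apply: weight_bool => i _.
rewrite (_ : [set v | _] = ~` [set v | tau v <= grid n i]).
  by apply: filtrationC; exact: stopping_le.
by apply/seteqP; split=> v /=; rewrite ltNge => /negP.
Qed.

Lemma grid_sum_before n (tau : Om 0 -> R) v : 0 <= tau v <= T -> exists k,
  [/\ (k <= n.+1)%N, tau v <= grid n k <= tau v + T / n.+1%:R,
      forall i, (grid n i < tau v) = (i < k)%N &
      grid_sum n (fun i v => (grid n i < tau v)%R%:R) v = z (grid n k) v].
Proof.
move=> tT; have [k [kn tk kt kE]] := grid_index n tT.
have [|k' [k'n k'E Sk']] := @grid_sum_bool n (fun i v => grid n i < tau v) v.
  by move=> i; rewrite !kE => /ltnW.
suff kk' : k' = k by exists k; rewrite tk kt Sk' kk'.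
apply/eqP; rewrite eqn_leq; apply/andP; split; rewrite leqNgt; apply/negP => lt.
  by have := k'E k (leq_trans lt k'n); rewrite kE ltnn lt.
by have := k'E k' (leq_trans lt kn); rewrite kE lt ltnn.
Qed.

Lemma z_stopped_rv (tau : Om 0 -> R) : stopping tau -> bounded_rv (fun v => z (tau v) v).
Proof.
move=> st; split; last by exists M => v; apply: z_le; exact: st.1.
apply: (@measurable_fun_comp_grid _ _ _ z tau 0 T) => //.
- by move=> r rT; case: (z_rv rT).
- exact: stopping_measurable.
- exact: st.1.
- move=> v r e rT e0; have e2 : 0 < e / 2 by rewrite divr_gt0.
  have [h h0 H] := z_time_continuous v e2; exists h => // r' r'T rr'.
  apply: (@le_lt_trans _ _ (e / 2)); first by apply: H => //; exact: ltW.
  by rewrite ltr_pdivrMr// ltr_pMr// ltr1n.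
Qed.

(** For these weights the sum is [z] at [tau] rounded up to the grid; time continuity and the bound
    [M] give the limit. *)
Lemma grid_sum_before_cvg P (tau : Om 0 -> R) : stopping tau ->
  Ex P (grid_sum n (fun i v => (grid n i < tau v)%R%:R)) @[n --> \oo] -->
  Ex P (fun v => z (tau v) v).
Proof.
move=> st; apply: (@Ex_cvg _ _ _ _ _ _ M).
- by move=> n; case: (grid_sum_rv (@weight_before n _ st)).
- move=> n v; have [k [kn _ _ ->]] := grid_sum_before n (st.1 v).
  by apply: z_le; exact: grid_itv.
- move=> v; apply/cvgrPdist_le => e e0.
  have [h h0 H] := z_time_continuous v e0; have [N HN] := mesh_small h0.
  exists N => // n Nn; have [k [kn /andP[tk kt] _ ->]] := grid_sum_before n (st.1 v).
  apply: H; [exact: st.1|exact: grid_itv|].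
  by rewrite distrC ger0_norm ?subr_ge0// lerBlDl (le_trans kt)// lerD2l HN.
Qed.

Lemma z_optional_sampling P (sigma tau : Om 0 -> R) : PP P -> stopping sigma ->
  stopping tau -> (forall v, sigma v <= tau v) ->
  Ex P (fun v => z (tau v) v) <= Ex P (fun v => z (sigma v) v).
Proof.
move=> PPP ss st stau.
apply: (ler_cvg_to (@grid_sum_before_cvg P _ st) (@grid_sum_before_cvg P _ ss)).
apply: nearW => n; apply: grid_sum_mono => //; [exact: weight_before|exact: weight_before|].
move=> i v _; rewrite ler_nat; case: (boolP (grid n i < sigma v)) => // h.
by rewrite (lt_le_trans h).
Qed.

Lemma z0_const v w : z 0 v = z 0 w.
Proof. by apply: z_local; [rewrite lexx|move=> r r0; rewrite !path_eq0]. Qed.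

Lemma z_stopped_le P (tau : Om 0 -> R) w : PP P -> stopping tau ->
  Ex P (fun v => z (tau v) v) <= z 0 w.
Proof.
move=> PPP st; have s0 : @stopping R d T 0 (fun=> 0) by apply: stopping_cst; rewrite lexx.
apply: le_trans (z_optional_sampling PPP s0 st _) _; first by move=> v; have /andP[] := st.1 v.
by apply: Ex_le_cst => [|v]; [apply: z_rv; rewrite lexx|rewrite (z0_const v w)].
Qed.

Lemma grid_stopping n (tau : Om 0 -> R) (k : Om 0 -> nat) : stopping tau ->
  (forall v, (k v <= n.+1)%N) ->
  (forall v i, (grid n i < tau v) = (i < k v)%N) -> stopping (fun v => grid n (k v)).
Proof.
move=> st kn kE; split=> [v|s _]; first exact: grid_itv.
rewrite (_ : [set _ | _] = \bigcup_i (if grid n i <= s then [set v | tau v <= grid n i] else set0)).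
  apply: filtration_bigcup => i; case: ifPn => is_; last exact: filtration0.
  exact: stopping_le.
apply/seteqP; split=> v /=.
  by move=> ks; exists (k v) => //; rewrite ks /= leNgt kE ltnn.
case=> i _; case: ifPn => //= is_; rewrite leNgt kE -leqNgt => ki.
exact: le_trans (grid_mono n ki) is_.
Qed.

(** * Passage flags and their continuous approximation *)

Definition above n (c : R) i (v : Om 0) : bool :=
  [forall j : 'I_i.+1, c < gap (grid n j) v].

Lemma aboveP n c i v : reflect (forall j, (j <= i)%N -> c < gap (grid n j) v) (above n c i v).
Proof.
apply: (iffP forallP) => H j; last by apply: H; rewrite -ltnS.
by rewrite -ltnS => ji; exact: (H (Ordinal ji)).
Qed.

Lemma aboveS n c i v : above n c i.+1 v -> above n c i v.
Proof. by move/aboveP => H; apply/aboveP => j ji; apply: H; exact: leqW. Qed.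

Lemma filtration_above n c i : (i <= n.+1)%N ->
  filtration (grid n i) [set v | above n c i v].
Proof.
move=> iN; rewrite (_ : [set v | _] = \bigcap_(j in setT) ~` [set v | gap (grid n (j : 'I_i.+1)) v <= c]).
  apply: filtration_bigcap => j; apply: filtrationC.
  have ji : (j <= i)%N by rewrite -ltnS.
  apply: (filtration_mono (grid_mono n ji)); apply: gap_adapted.
  by apply: grid_itv; exact: leq_trans iN.
apply/seteqP; split=> v /= H.
  by move=> j _ /=; apply/negP; rewrite -ltNge; move/forallP: H; exact.
by apply/forallP => j; rewrite ltNge; apply/negP; exact: H.
Qed.

Lemma weight_above n c : weight n (fun i v => (above n c i v)%:R).
Proof. by apply: weight_bool => i iN; apply: filtration_above; exact: leqW. Qed.

Lemma weight_above_before n c (tau : Om 0 -> R) : stopping tau ->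
  weight n (fun i v => (above n c i v && (grid n i < tau v))%:R).
Proof.
move=> st; apply: weight_bool => i iN.
rewrite (_ : [set v | _] = [set v | above n c i v] `&` ~` [set v | tau v <= grid n i]).
  apply: filtrationI; first by apply: filtration_above; exact: leqW.
  by apply: filtrationC; exact: stopping_le.
apply/seteqP; split=> v /=.
  by move=> /andP[-> h]; split=> //; apply/negP; rewrite -ltNge.
by move=> [-> /negP]; rewrite -ltNge.
Qed.

Definition clip (x : R) : R := Num.max 0 (Num.min x 1).

Lemma clip01 x : 0 <= clip x <= 1.
Proof. by rewrite /clip le_max lexx/= ge_max ler01 ge_min lexx orbT. Qed.

(* Path-continuous weights, squeezed between [above n (2 * del)] and
   [above n del]. *)
Fixpoint soft n (del : R) i (v : Om 0) : R :=
  clip ((gap (grid n i) v - del) / del) * (if i is j.+1 then soft n del j v else 1).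

Lemma soft01 n del i v : 0 <= soft n del i v <= 1.
Proof.
elim: i => [|i /andP[s0 s1]] /=; first by rewrite mulr1 clip01.
have /andP[c0 c1] := clip01 ((gap (grid n i.+1) v - del) / del).
by rewrite mulr_ge0// mulr_ile1.
Qed.

Lemma soft_le_above n del i v : 0 < del -> soft n del i v <= (above n del i v)%:R.
Proof.
move=> del0; case: (boolP (above n del i v)) => [_|]; first by have /andP[] := soft01 n del i v.
suff : ~ above n del i v -> soft n del i v = 0 by move=> H /negP /H ->.
have c0 j : gap (grid n j) v <= del -> clip ((gap (grid n j) v - del) / del) = 0.
  move=> H; rewrite /clip max_l// ge_min; apply/orP; left.
  by rewrite ler_pdivrMr// mul0r subr_le0.
elim: i => [|i IH] H /=.
  rewrite c0 ?mul0r// leNgt; apply/negP => h; apply: H; apply/aboveP => j.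
  by rewrite leqn0 => /eqP ->.
have [h|h] := leP (gap (grid n i.+1) v) del; first by rewrite c0 ?mul0r.
rewrite IH ?mulr0// => /aboveP Hi; apply: H; apply/aboveP => j.
by rewrite leq_eqVlt => /predU1P[->//|]; rewrite ltnS; exact: Hi.
Qed.

Lemma above_le_soft n del i v : 0 < del -> (above n (2 * del) i v)%:R <= soft n del i v.
Proof.
move=> del0; case: (boolP (above _ _ _ _)) => [|_]; last by have /andP[] := soft01 n del i v.
have c1 j : 2 * del < gap (grid n j) v -> clip ((gap (grid n j) v - del) / del) = 1.
  move=> H; rewrite /clip min_r ?max_r//.
  by rewrite ler_pdivlMr// mul1r lerBrDr -mulr2n -mulr_natl ltW.
elim: i => [|i IH] H /=.
  by rewrite c1 ?mulr1//; move/aboveP: H; exact.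
rewrite c1 ?mul1r; first exact: IH (aboveS H).
by move/aboveP: H; exact.
Qed.

Lemma clip_gap_adapted n del i : (i <= n.+1)%N ->
  adapted (grid n i) (fun v => clip ((gap (grid n i) v - del) / del)).
Proof.
move=> iN; apply: measurable_adapted; apply: measurable_maxr; first exact: measurable_cst.
apply: measurable_minr; last exact: measurable_cst.
apply: measurable_funM; last exact: measurable_cst.
apply: measurable_funB; last exact: measurable_cst.
by apply: adapted_measurable; apply: gap_adapted; exact: grid_itv.
Qed.

Lemma weight_soft n del : weight n (soft n del).
Proof.
move=> i iN; split=> [|v]; last exact: soft01.
elim: i iN => [|i IH] iN /=.
  by under eq_fun do rewrite mulr1; exact: clip_gap_adapted.
apply: measurable_adapted; apply: measurable_funM.
  by apply: adapted_measurable; apply: clip_gap_adapted; exact: leqW.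
apply: adapted_measurable; apply: (@adapted_mono _ _ _ _ (grid n i)); first exact: grid_mono.
by apply: IH; exact: ltnW.
Qed.

Lemma continuous_pathP (f : Om 0 -> R) :
  (forall w e, 0 < e -> exists2 h, 0 < h &
    forall w' : Om 0, supnorm 0 T (w' \- w) <= h -> `|f w - f w'| <= e) -> continuous f.
Proof.
move=> H; apply: continuous_ballP => w e e0; have [h h0 Hh] := H w e e0.
exists h => // w'; rewrite ballEmdist /= mdist_pathE => ww'; apply: Hh.
rewrite (_ : supnorm _ _ _ = supnorm 0 T (w \- w')); first exact: ltW.
by congr sup; apply: eq_imagel => r _ /=; rewrite enormB.
Qed.

Lemma z_path_continuous t : 0 <= t <= T -> continuous (z t).
Proof.
move=> tT; have /andP[t0 tT'] := tT; apply: continuous_pathP => w e e0.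
have [h h0 H] := z_equicontinuous w e0; exists h => // w' ww'; apply: H => //.
by apply: le_trans ww'; apply: supnorm_mono => //; exact: path_subC.
Qed.

Lemma Yhat_path_continuous t : 0 <= t <= T -> continuous (yh t).
Proof.
move=> tT; apply: continuous_pathP => w e e0.
have [h h0 H] := Yhat_continuous w e0; exists h => // w' ww'; apply: H => //.
by rewrite subrr normr0 ltW.
Qed.

Lemma soft_continuous n del i : (i <= n.+1)%N -> continuous (soft n del i).
Proof.
have cc j : (j <= n.+1)%N -> continuous (fun v => clip ((gap (grid n j) v - del) / del)).
  move=> jn; apply: continuous_rmax; first exact: continuous_rcst.
  apply: continuous_rmin; last exact: continuous_rcst.
  apply: continuous_rM; last exact: continuous_rcst.
  apply: continuous_rB; last exact: continuous_rcst.
  by apply: continuous_rB; [apply: z_path_continuous|apply: Yhat_path_continuous]; exact: grid_itv.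
elim: i => [|i IH] iN; apply: continuous_rM.
- exact: cc.
- exact: continuous_rcst.
- exact: cc.
- by apply: IH; exact: ltnW.
Qed.

Lemma grid_sum_continuous n del : continuous (grid_sum n (soft n del)).
Proof.
apply: continuous_rD; first by apply: z_path_continuous; rewrite lexx.
apply: continuous_rsum => i; have iN : (i <= n)%N by rewrite -ltnS.
apply: continuous_rM; first by apply: soft_continuous; exact: leqW.
by apply: continuous_rB; apply: z_path_continuous; apply: grid_itv => //; exact: leqW.
Qed.

Lemma grid_sum_bool_le n (b : nat -> Om 0 -> bool) v :
  (forall i, b i.+1 v -> b i v) -> `|grid_sum n (fun i v => (b i v)%:R) v| <= M.
Proof.
move=> bS; have [k [kn _ ->]] := grid_sum_bool n bS.
by apply: z_le; exact: grid_itv.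
Qed.

(** * Existence of an optimal probability *)

(* Off [G], stopping at [tau'] or at the first passage of [gap] below [del],
   whichever comes first, differs from stopping at the passage. There [tau']
   collects at least [del] less than [z], so by near-optimality of [tau] the
   complement of [G] is improbable. *)
Lemma soft_lower_bound del e : 0 < del -> 0 < e ->
  exists N : nat, exists2 eps, 0 < eps & forall n (P : probability (Om 0) R) (tau : Om 0 -> R),
    (N <= n)%N -> PP P -> stopping tau ->
    z 0 point - eps < gain point P tau ->
    z 0 point - e <= Ex P (grid_sum n (soft n del)).
Proof.
move=> del0 e0; pose eta := e / (2 * (1 + 2 * M / del)).
have M0 := M_ge0.
have eta0 : 0 < eta.
  by rewrite divr_gt0// mulr_gt0// ltr_wpDr// divr_ge0 ?mulr_ge0// ltW.
have [h h0 H] := gain_equicontinuous (point : Om 0) eta0.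
have [N HN] := mesh_small h0; exists N, eta => // n P tau Nn PPP st tau_opt.
have /choice[k kP] : forall v, exists k, [/\ (k <= n.+1)%N,
    tau v <= grid n k <= tau v + T / n.+1%:R, forall i, (grid n i < tau v) = (i < k)%N &
    grid_sum n (fun i v => (grid n i < tau v)%R%:R) v = z (grid n k) v].
  by move=> v; apply: grid_sum_before; exact: st.1.
pose tau' v := grid n (k v).
have st' : stopping tau'.
  by apply: (grid_stopping st) => v; have [] := kP v.
pose psi i v : R := (above n del i v)%:R.
pose b i v : R := (above n del i v && (grid n i < tau v))%:R.
have wpsi : weight n psi by exact: weight_above.
have wb : weight n b by exact: weight_above_before.
pose Spsi := grid_sum n psi; pose Sb := grid_sum n b.
have bSpsi : bounded_rv Spsi by exact: grid_sum_rv.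
have bSb : bounded_rv Sb by exact: grid_sum_rv.
(* The event that the two sums agree, split into inequalities whose measurability is immediate. *)
pose G := [set v | Spsi v - Sb v <= 0] `&` [set v | Sb v - Spsi v <= 0].
have mG : measurable (~` G).
  apply: measurableC; apply: measurableI; apply: measurable_le_set.
    by case: (bounded_rvB bSpsi bSb).
  by case: (bounded_rvB bSb bSpsi).
have GE v : Spsi v = Sb v -> G v by move=> E; rewrite /G /= E subrr lexx.
(* If the gap at [tau'] is at most [del], every flag from index [k v] on is already off, so the cap
   at [tau] changes nothing and the sums agree. *)
have notG v : (~` G) v -> del < gap (tau' v) v.
  move=> nG; rewrite ltNge; apply/negP => gdel; apply: nG; apply: GE.
  rewrite /Spsi /Sb /grid_sum; congr (_ + _); apply: eq_bigr => i _; congr (_ * _).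
  rewrite /psi /b; case: (boolP (above n del i v)) => //= /aboveP Ha.
  have [_ _ kE _] := kP v; rewrite kE.
  case: ltnP => // ki; have := Ha _ ki; rewrite ltNge.
  by rewrite gdel.
have b1 := bounded_rv_indic R mG.
pose p := Ex P (\1_(~` G)).
have p0 : 0 <= p by apply: Ex_ge_cst.
have cb (c : R) : bounded_rv (fun v => c * \1_(~` G) v) by apply: bounded_rvM => //; exact: bounded_rv_cst.
have gainE' : gain point P tau' = Ex P (fun v => yh (tau' v) v).
  by rewrite /gain; congr (Ex P _); apply/funext => v; rewrite concat_0.
have by' : bounded_rv (fun v => yh (tau' v) v).
  have := @Yhat_stopped_measurable 0 point tau' _ st'; rewrite lexx T_ge0 => /(_ isT).
  by under eq_fun do rewrite concat_0.
have bz' := z_stopped_rv st'.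
(* One [eta] is paid for near-optimality of [tau], the other for rounding it up to the grid. *)
have g1 : z 0 point - eta - eta <= gain point P tau'.
  have T0 : 0 <= (0 : R) <= T by rewrite lexx.
  have diag : supnorm 0 0 ((point : Om 0) \- (point : Om 0)) <= h by rewrite supnorm_diag ltW.
  have tt v : `|tau v - tau' v| <= h.
    have [_ /andP[t1 t2] _ _] := kP v; rewrite /tau' distrC ger0_norm ?subr_ge0// lerBlDl.
    by rewrite (le_trans t2)// lerD2l HN.
  have := H point 0 P tau tau' T0 PPP st st' diag tt; rewrite ler_distl => /andP[_ A].
  by rewrite lerBlDr (le_trans (ltW tau_opt)).
have g2 : gain point P tau' <= Ex P Sb - del * p.
  rewrite gainE'; apply: (@le_trans _ _ (Ex P (fun v => z (tau' v) v) - del * p)).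
    rewrite /p -ExZ// -ExB//; apply: Ex_le => //; first exact: bounded_rvB.
    move=> v; rewrite lerBrDr; rewrite indicE; case: (boolP (v \in ~` G)).
      by rewrite inE => /notG; rewrite /gap mulr1 ltrBrDr addrC => /ltW.
    by rewrite mulr0 addr0 => _; apply: Yhat_le_z; exact: st'.1.
  rewrite lerD2r (_ : (fun v => z (tau' v) v) = grid_sum n (fun i v => (grid n i < tau v)%R%:R)).
    apply: grid_sum_mono => //; first exact: weight_before.
    by move=> i v _; rewrite /b ler_nat; case: (above _ _ _ _).
  by apply/funext => v; have [_ _ _ ->] := kP v.
have g3 : Ex P Sb <= z 0 point.
  have w0 : weight n (fun _ _ => 0).
    by move=> i _; split=> [|v]; [apply: measurable_adapted; exact: measurable_cst|rewrite lexx ler01].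
  apply: le_trans (@grid_sum_mono n (fun _ _ => 0) b P w0 wb PPP _) _.
    by move=> i v _; rewrite /b ler0n.
  apply: Ex_le_cst; first exact: grid_sum_rv.
  move=> v; rewrite /grid_sum big1 ?addr0; last by move=> i _; rewrite mul0r.
  by rewrite (z0_const v point).
have g4 : Ex P Sb - 2 * M * p <= Ex P Spsi.
  rewrite /p -ExZ// -ExB//; apply: Ex_le => //; first exact: bounded_rvB.
  move=> v; rewrite indicE; case: (boolP (v \in ~` G)).
    move=> _; rewrite mulr1 lerBlDr -lerBlDl.
    have A1 : `|Sb v| <= M.
      apply: grid_sum_bool_le => i /andP[/aboveS -> /=].
      by apply: le_lt_trans; exact: grid_mono.
    have A2 : `|Spsi v| <= M by apply: grid_sum_bool_le => i /aboveS.
    by rewrite (le_trans (ler_norm _))// (le_trans (ler_normB _ _))// mulr_natl mulr2n lerD.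
  by rewrite notin_setE /= => /contrapT[/= _]; rewrite mulr0 subr0 subr_le0.
apply: le_trans (eps_optimal M0 del0 p0 (erefl eta) g1 g2 g3) _.
apply: le_trans g4 _; apply: grid_sum_mono => //; first exact: weight_soft.
by move=> i v _; exact: soft_le_above.
Qed.

Context (P1 : condP1 PP).

(** Compactness is used through a cluster point, with no convergent subsequence: each single
    functional has arbitrarily late indices with a close expectation. *)
Lemma weak_cluster_point (Q : nat -> probability (Om 0) R) : (forall m, PP (Q m)) ->
  exists2 Phat, PP Phat & forall (f : Om 0 -> R), continuous f -> (exists C : R, forall w, `|f w| <= C) ->
    forall e N, 0 < e -> exists2 m, (N <= m)%N & `|Ex Phat f - Ex (Q m) f| < e.
Proof.
move=> PQ; have [] := P1 (F := Q @ \oo).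
  by exists 0%N => // m _; exact: PQ.
move=> Phat [PPhat clP]; exists Phat => // f cf bf e N e0.
pose f' : bounded_continuous d T 0 := exist _ f (conj cf bf).
pose W := initial_topology (@weak_eval R d T 0).
have nA : (Q @ \oo) (Q @` [set m | (N <= m)%N]) by exists N => // m Nm; exists m.
have ce : (weak_eval P' f' : R) @[P' --> (Phat : W)] --> (weak_eval Phat f' : R).
  apply: (@cvg_comp _ _ _ (@weak_eval R d T 0) (fun g : {ptws bounded_continuous d T 0 -> R} => g f') _
    (nbhs (weak_eval Phat : {ptws bounded_continuous d T 0 -> R}))).
    exact: initial_continuous.
  exact: evaluation_continuous.
have nB : nbhs (Phat : W) [set P' : W | `|Ex Phat f - Ex P' f| < e].
  by have := ce _ (nbhsx_ballx (weak_eval Phat f' : R) e e0).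
by have [Q' [[m Nm <-] H]] := clP _ _ nA nB; exists m.
Qed.

(* The grid passage times below [2 * del m] might overshoot the contact time when
   [gap] is small only between grid points; hence the cap [grid (n m) i < nu v]. *)
Lemma optimal_probability : exists2 Phat, PP Phat &
  z 0 point <= Ex Phat (fun v => z (nu v) v).
Proof.
have T0 : 0 <= (0 : R) <= T by rewrite lexx.
have /choice[Qg QgP] : forall m : nat, exists x : probability (Om 0) R * (Om 0 -> R),
    [/\ PP x.1, stopping x.2 & z 0 point - m.+1%:R^-1 < gain point x.1 x.2].
  move=> m; have m0 : 0 < m.+1%:R^-1 :> R by rewrite invr_gt0.
  by have [P [g [? ? ?]]] := z_approx point T0 m0; exists (P, g).
have PQ m : PP (Qg m).1 by have [] := QgP m.
have [Phat PPhat clP] := weak_cluster_point PQ; exists Phat => //.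
have lower del e : 0 < del -> 0 < e -> exists N : nat, forall n, (N <= n)%N ->
    z 0 point - e <= Ex Phat (grid_sum n (soft n del)).
  move=> del0 e0; have e2 : 0 < e / 2 by rewrite divr_gt0.
  have [N [eps eps0 HN]] := soft_lower_bound del0 e2; exists N => n Nn.
  have [_ bF] := grid_sum_rv (@weight_soft n del).
  have [N' _ HN'] := @near_infty_natSinv_lt R (PosNum eps0).
  (* The functional is already fixed here. Since [HN] holds for every law of the class, [m] may
     depend on the grid. *)
  have [m N'm Hm] := clP _ (@grid_sum_continuous n del) bF _ N' e2.
  have [PQm sm gm] := QgP m.
  have := HN n _ _ Nn PQm sm (le_lt_trans _ gm).
  rewrite lerD2l lerN2 => /(_ (ltW (HN' m N'm))).
  move: Hm; rewrite ltr_distl => /andP[H1 _] H2.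
  rewrite [X in _ - X](splitr e) opprD addrA.
  by apply: le_trans (ltW H1); rewrite lerD2r.
pose del (m : nat) : R := m.+1%:R^-1.
have del0 m : 0 < del m by rewrite invr_gt0.
(* Diagonal choice: [m <= n] sends the mesh to 0 together with [del m]. *)
have /choice[n nP] : forall m, exists n : nat, (m <= n)%N /\
    z 0 point - del m <= Ex Phat (grid_sum n (soft n (del m))).
  move=> m; have [N HN] := lower (del m) (del m) (del0 m) (del0 m).
  by exists (maxn m N); split; [exact: leq_maxl|apply: HN; exact: leq_maxr].
pose b m i v := above (n m) (2 * del m) i v && (grid (n m) i < nu v).
pose F m := grid_sum (n m) (fun i v => (b m i v)%:R).
have wb m : weight (n m) (fun i v => (b m i v)%:R).
  by apply: weight_above_before; exact: nuhat_stopping.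
have bS m i v : b m i.+1 v -> b m i v.
  by move=> /andP[/aboveS a h]; rewrite /b a (le_lt_trans _ h)// grid_mono.
have FP m : z 0 point - del m <= Ex Phat (F m).
  have [_ H] := nP m; apply: le_trans H _.
  apply: (@grid_sum_mono _ _ _ _ (wb m) (@weight_soft _ _)) => // i v _.
  apply: le_trans (above_le_soft _ _ _ (del0 m)); rewrite ler_nat /b.
  by case: (above _ _ _ _) => //=; exact: leq_b1.
have Fcvg : Ex Phat (F m) @[m --> \oo] --> Ex Phat (fun v => z (nu v) v).
  apply: (@Ex_cvg _ _ _ _ _ _ M).
  - by move=> m; case: (grid_sum_rv (wb m)).
  - by move=> m v; apply: grid_sum_bool_le => i; exact: bS.
  move=> v; apply/cvgrPdist_le => e e0; have [h h0 H] := z_time_continuous v e0.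
  have [N1 HN1] := mesh_small h0.
  have /andP[nu0 nuT] := nuhat_itv v.
  (* Away from the contact time the gap stays above a positive constant, eventually larger than
     [2 * del m]. If [nu v < h] no time qualifies, and 1 is as good as any value. *)
  have [c c0 cP] : exists2 c : R, 0 < c & forall t, 0 <= t -> t <= nu v - h -> c < gap t v.
    have [hnu|nuh] := leP h (nu v); last first.
      exists 1 => // t t0 /(le_trans t0); rewrite subr_ge0 leNgt.
      by rewrite nuh.
    have sT : 0 <= nu v - h <= T.
      by rewrite subr_ge0 hnu (le_trans _ nuT)// gerBl ltW.
    have [c /andP[c0 cs] cmin] := gap_min v sT.
    have gc : 0 < gap c v by apply: gap_gt0 => //; apply: (le_lt_trans cs); rewrite gtrBl.
    exists (gap c v / 2) => [|t t0 tnu]; first by rewrite divr_gt0.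
    apply: (@lt_le_trans _ _ (gap c v)); last by apply: cmin; rewrite t0.
    by rewrite ltr_pdivrMr// ltr_pMr// ltr1n.
  have c2 : 0 < c / 2 by rewrite divr_gt0.
  have [N2 _ HN2] := @near_infty_natSinv_lt R (PosNum c2).
  exists (maxn N1 N2) => // m; rewrite /= geq_max => /andP[N1m N2m].
  have [k [kn kE Sk]] := grid_sum_bool (n m) (fun i => @bS m i v).
  rewrite /F Sk; apply: H; [exact: nuhat_itv|exact: grid_itv|].
  have [mn _] := nP m.
  (* If [grid (n m) k] were below [nu v - h], all gaps up to index [k] would exceed the level and
     flag [k] would still be on. For the other bound, flag [k - 1] is on, so the preceding grid
     point is before [nu v]; for [k = 0] the grid point is 0. *)
  rewrite ler_distl; apply/andP; split; last first.
    rewrite -lerBlDr leNgt; apply/negP => gk.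
    have gnu : grid (n m) k < nu v by rewrite (lt_le_trans gk)// gerBl ltW.
    have kn1 : (k < (n m).+1)%N.
      rewrite ltn_neqAle kn andbT; apply/eqP => kE'.
      by move: gnu; rewrite kE' gridT ltNge nuT.
    have := kE k kn1; rewrite ltnn /b gnu andbT => /negP; apply.
    apply/aboveP => j jk; apply: (@lt_trans _ _ c); last first.
      have jn : (j <= (n m).+1)%N := leq_trans jk kn.
      have /andP[g0 _] := grid_itv jn.
      by apply: cP => //; apply: le_trans (ltW gk); exact: grid_mono.
    by rewrite mulrC -ltr_pdivlMr//; exact: (HN2 m N2m).
  case: k kn kE Sk => [|k] kn kE Sk.
    by rewrite grid0 lerBlDr addr_ge0// ltW.
  have : b m k v by rewrite kE.
  move=> /andP[_ gk]; rewrite gridS lerBlDr.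
  by apply: lerD; [exact: ltW|apply: HN1; exact: leq_trans mn].
apply/ler_addgt0Pl => e e0; rewrite addrC -lerBlDr.
apply: (ler_cvg_to (cvg_cst (z 0 point - e)) Fcvg).
have [N _ HN] := @near_infty_natSinv_lt R (PosNum e0).
exists N => // m Nm; apply: le_trans (FP m); rewrite lerD2l lerN2.
exact: (ltW (HN m Nm)).
Qed.

Local Open Scope ereal_scope.

Lemma snell_stopped_integral (P : probability (Om 0) R) (tau : Om 0 -> R) : stopping tau ->
  \int[P]_v sample (snell PP Y wp) tau v = (Ex P (fun v => z (tau v) v))%:E.
Proof.
move=> st; rewrite -Ex_EFin; last exact: z_stopped_rv.
by apply: eq_integral => v _; rewrite /sample snellE//; exact: st.1.
Qed.

(** By [z_stopped_le] every law gives at most the initial value, and [Phat] gives at least that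
    much, so all the quantities coincide. *)
Lemma upper_expectation_stopped (Phat : probability (Om 0) R) (tau : Om 0 -> R) w :
  PP Phat -> stopping tau -> (z 0 point <= Ex Phat (fun v => z (tau v) v))%R ->
  snell PP Y wp 0%R w = upper_expectation PP 0%R (sample (snell PP Y wp) tau) w /\
  snell PP Y wp 0%R w = \int[Phat]_v sample (snell PP Y wp) tau v.
Proof.
move=> PPhat st zP; have T0 : (0 <= (0 : R) <= T)%R by rewrite lexx.
have E : (z 0 w)%:E = \int[Phat]_v sample (snell PP Y wp) tau v.
  rewrite snell_stopped_integral//; congr _%:E; apply/eqP; rewrite eq_le.
  by rewrite z_stopped_le// (z0_const w point) zP.
rewrite snellE//; split=> //; apply/eqP; rewrite eq_le; apply/andP; split.
  rewrite E; apply: ereal_sup_ubound; exists Phat => //.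
  by apply: eq_integral => v _; rewrite /shift_rv concat_0.
apply: ge_ereal_sup => _ [P PPP <-]; rewrite /shift_rv.
under eq_integral do rewrite concat_0.
by rewrite snell_stopped_integral// lee_fin z_stopped_le.
Qed.

Lemma snell_optimal_stopping :
  stopping nu /\
  exists2 Phat, PP Phat &
    [/\ (forall w : Om 0,
          [/\ snell PP Y wp 0%R w
                = upper_expectation PP 0%R (sample (snell PP Y wp) nu) w,
              snell PP Y wp 0%R w = \int[Phat]_w' sample (snell PP Y wp) nu w'
            & snell PP Y wp 0%R w = 'E_Phat[sample (Yhat Y wp) nu]]),
        ereal_sup [set 'E_P[sample (Yhat Y wp) gamma]
                  | P in @PP 0%R & gamma in @stopping R d T 0]
          = 'E_Phat[sample (Yhat Y wp) nu]
      & (forall (zeta : Om 0 -> R), stopping zeta ->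
         forall w : Om 0,
          snell PP Y wp 0%R w
            = upper_expectation PP 0%R
                (sample (snell PP Y wp) (fun w' => Num.min (nu w') (zeta w'))) w /\
          snell PP Y wp 0%R w
            = \int[Phat]_w' sample (snell PP Y wp)
                (fun w'' => Num.min (nu w'') (zeta w'')) w')].
Proof.
have sn := nuhat_stopping; split=> //.
have [Phat PPhat zP] := optimal_probability; exists Phat => //.
have EY : 'E_Phat[sample (Yhat Y wp) nu] = (Ex Phat (fun v => z (nu v) v))%:E.
  rewrite -snell_stopped_integral// unlock; apply: eq_integral => v _.
  rewrite /sample snellE ?nuhat_itv//; congr _%:E.
  by have /eqP := gap_nuhat v; rewrite subr_eq0 => /eqP.
have main w : [/\ snell PP Y wp 0%R w
    = upper_expectation PP 0%R (sample (snell PP Y wp) nu) w,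
    snell PP Y wp 0%R w = \int[Phat]_w' sample (snell PP Y wp) nu w'
  & snell PP Y wp 0%R w = 'E_Phat[sample (Yhat Y wp) nu]].
  have [A B] := upper_expectation_stopped w PPhat sn zP.
  by split=> //; rewrite EY -snell_stopped_integral.
split=> //; last first.
  (* Stopping earlier than [nu] can only increase the mean of [z], so [Phat] still gives at least
     the initial value. *)
  move=> zeta sz w; have sm := stopping_min sn sz.
  apply: upper_expectation_stopped => //; apply: le_trans zP _.
  by apply: z_optional_sampling => // v; rewrite ge_min lexx.
have [_ _ <-] := main point; congr ereal_sup; apply/seteqP; split=> x /=;
  move=> [P PPP [g sg <-]]; exists P => //; exists g => //;
  rewrite unlock; apply: eq_integral => v _; rewrite /sample /shift_process /shift_rv concat_0//.
Qed.

End snell_theory.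

Local Open Scope ereal_scope.

Theorem theorem4p1 (R : realType) (d : nat) (T : R) (rho0 : R -> R)
    (PP : forall t : R, set (probability (Omega d T t) R))
    (Y : R -> Omega d T 0 -> R) (wp : Omega d T 0 -> R)
    (d_gt0 : (0 < d)%N) (T_gt0 : (0 < T)%R)
    (rho0_power : power_modulus rho0)
    (PP_neq0 : forall t, (0 <= t <= T)%R -> PP t !=set0)
    (P1 : condP1 PP) (P2 : condP2 PP rho0) (P3 : condP3 PP) (P4 : condP4 PP)
    (Ywp : frakS Y wp) :
  stopping (nuhat PP Y wp) /\
  exists2 Phat, PP 0%R Phat &
    [/\ (forall w : Omega d T 0,
          [/\ snell PP Y wp 0%R w
                = upper_expectation PP 0%R
                    (sample (snell PP Y wp) (nuhat PP Y wp)) w,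
              snell PP Y wp 0%R w
                = \int[Phat]_w' sample (snell PP Y wp) (nuhat PP Y wp) w'
            & snell PP Y wp 0%R w
                = 'E_Phat[sample (Yhat Y wp) (nuhat PP Y wp)]]),
        ereal_sup [set 'E_P[sample (Yhat Y wp) gamma]
                  | P in PP 0%R & gamma in @stopping R d T 0]
          = 'E_Phat[sample (Yhat Y wp) (nuhat PP Y wp)]
      & (forall (zeta : Omega d T 0 -> R), stopping zeta ->
         forall w : Omega d T 0,
          snell PP Y wp 0%R w
            = upper_expectation PP 0%R
                (sample (snell PP Y wp)
                   (fun w' => Num.min (nuhat PP Y wp w') (zeta w'))) w /\
          snell PP Y wp 0%R w
            = \int[Phat]_w' sample (snell PP Y wp)
                (fun w'' => Num.min (nuhat PP Y wp w'') (zeta w'')) w')].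
Proof.
have [[M _ YM] [rho rhoP Yrho] swp [kappa kappa0 wpL]] := Ywp.
have [osc _] := P2.
exact: (@snell_optimal_stopping R d T PP Y wp M kappa rho).
Qed.
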